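(* Let $d\ge2$ and let $A$ be a real symmetric positive definite $d\times d$ matrix; put $v_j=A^{-1/2}e_j$, $w_j=A^{1/2}e_j$ for $1\le j\le d$. Let $\omega$ be a weight function satisfying $(\beta^*_2)$, $(\delta)$, and quadratic interpolation of dimension $d$. If $f\in L^2(\mathbb{R}^d)$ satisfies, for $1\le j\le d$, $$|f(x)|\lesssim e^{-\frac12|\langle Ax,v_j\rangle|^2+\lambda\omega(|\langle Ax,v_j\rangle|)}\quad\text{and}\quad|\widehat f(\xi)|\lesssim e^{-\frac12|\langle A^{-1}\xi,w_j\rangle|^2+\lambda\omega(|\langle A^{-1}\xi,w_j\rangle|)},$$ for some $\lambda>0$, then $$|H_A(f,\alpha)|\lesssim_r\sqrt{\alpha!}\,e^{-\frac1r\varphi^*(r|\alpha|)},\qquad 0<r<[\mathfrak{C}_{3,d}(\omega,\lambda)\,\lambda]^{-1},$$ where $$\mathfrak{C}_{3,d}(\omega,\lambda)=\mathfrak{m}_{d^{\frac{d-1}{2d}}}(\omega)\,\mathfrak{C}_{2,d}(\omega)\,\mathrm{QI}_d\big(\omega,(\mathfrak{C}_{2,d}(\omega)\lambda)^{-1}\big),\qquad \mathfrak{C}_{2,d}(\omega)=\mathfrak{m}(\omega)\,\mathfrak{m}_{\sqrt d}(\omega)\,\mathrm{PL}_{\frac\pi2}(\omega).$$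
   Context: A weight function is an unbounded non-decreasing $\omega:[0,\infty)\to[0,\infty)$. Conditions: $(\beta^*_2)$: $\int_1^\infty\omega(ts)s^{-3}ds=O(\omega(t))$ as $t\to\infty$; $(\delta)$: $\varphi(u)=\omega(e^u)$ is convex. The Young conjugate is $\varphi^*(v)=\sup_{u\ge0}[uv-\varphi(u)]$, $v\ge0$ (possibly $+\infty$; $e^{-\infty}=0$). Indices. $\mathfrak{m}(\omega)=\inf\{L\in[1,\infty]: \exists C>0\ \forall t,s\ge0,\ \omega(t+s)\le L(\omega(t)+\omega(s))+C\}$. For $\kappa\ge1$, $\mathfrak{m}_\kappa(\omega)=\inf\{L\in[1,\infty]:\exists C>0\ \forall t\ge0,\ \omega(\kappa t)\le L\omega(t)+C\}$. Phragmén–Lindelöf index: for $0<\varrho\le\pi/2$ let $S_\varrho=\{z\in\mathbb{C}:-\varrho/2<\arg z<\varrho/2\}$. $\omega$ is Phragmén–Lindelöf admissible of angle $\theta$ and order $L\in[1,\infty]$ if for any $\varrho\in(0,\theta]$ and $\lambda>0$ there is $C_{\theta,L}>0$ such that whenever $F$ is analytic on $S_\varrho$, continuous on $\overline{S}_\varrho$, satisfies $|F(z)|\le M_\lambda e^{\lambda\omega(|z|)}$ on $\partial S_\varrho$ for some constant $M_\lambda$ and, for every $\varepsilon>0$, $|F(z)|\lesssim_\varepsilon e^{\varepsilon|z|^{\pi/\varrho}}$ on $S_\varrho$, then $|F(z)|\le C_{\theta,L}M_\lambda e^{L\lambda\omega(|z|)}$ on $S_\varrho$. $\mathrm{PL}_\theta(\omega)$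 is the infimum of all $L\ge1$ such that $\omega$ is admissible of angle $\theta$ and order $L$. Quadratic interpolation: a weight function $\omega$ satisfying $(\delta)$ and $\omega(t)=o(t^2)$ satisfies quadratic interpolation of dimension $d\ge2$ if for some $L>0$ there is $C>0$ such that for all $t\ge0$ there is $\sigma\in[1,d]$ with $t^{2\frac{d-\sigma}{d-1}}+\omega(t^\sigma)\le L\omega(t)+C$. (A weight function satisfying $(\beta_2^* )$ automatically satisfies $\omega(t)=o(t^2)$.) For $\mu>0$, $$\mathrm{QI}_d(\omega,\mu)=\inf\Big\{L\in[1,\infty]:\exists C>0\ \forall t\ge0,\ \inf_{s>0}\Big[\tfrac{d-1}{2d}s^{\frac2{d-1}}+\tfrac1\mu\omega\big(\tfrac{t^d}{s}\big)\Big]\le\tfrac L\mu\omega(t)+C\Big\}.$$ $\langle\cdot,\cdot\rangle$ is the Euclidean inner product and $\{e_j\}$ the standard basis of $\mathbb{R}^d$. $\widehat f(\xi)=(2\pi)^{-d/2}\int f(x)e^{-i\langle x,\xi\rangle}dx$. For $\alpha\in\mathbb{N}^d$ ($0\in\mathbb{N}$), $|\alpha|=\sum\alpha_j$, $\alpha!=\prod\alpha_j!$. Hermite functions: $h_\alpha(x)=(-1)^{|\alpha|}\pi^{-d/4}(2^{|\alpha|}\alpha!)^{-1/2}e^{\frac12|x|^2}\partial^\alpha[e^{-|x|^2}]$; $h_{A,\alpha}(x)=(\det A)^{1/4}h_\alpha(A^{1/2}x)$; $H_A(f,\alpha)=(f,h_{A,\alpha})_{L^2}$. $\lesssim$ means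 $\le$ up to a positive multiplicative constant independent of $x,\xi,\alpha$; a subscript indicates dependence on that parameter. Pointwise bounds are understood almost everywhere. *)

(* Defs.v *)
From HB Require Import structures.
From mathcomp Require Import all_boot all_order all_algebra.
From mathcomp Require Import complex.
From mathcomp Require Import all_classical all_reals all_analysis.

Set Implicit Arguments.
Unset Strict Implicit.
Unset Printing Implicit Defensive.

Import Order.TTheory GRing.Theory Num.Theory.
Import numFieldNormedType.Exports.

Local Open Scope classical_set_scope.
Local Open Scope ring_scope.

Definition cV_display : measure_display.
Proof. exact: default_measure_display. Qed.

Section measurable_cV.
Context (R : realType) (n : nat).

Definition cV_coord (i : 'I_n) (x : 'cV[R]_n) : measurableTypeR R := x i ord0.

Let cV_set0 : g_sigma_preimage cV_coord set0.
Proof. exact: sigma_algebra0. Qed.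

Let cV_setC A : g_sigma_preimage cV_coord A -> g_sigma_preimage cV_coord (~` A).
Proof. exact: sigma_algebraC. Qed.

Let cV_bigcup (F : _^nat) : (forall i, g_sigma_preimage cV_coord (F i)) ->
  g_sigma_preimage cV_coord (\bigcup_i (F i)).
Proof. exact: sigma_algebra_bigcup. Qed.

(* The product sigma-algebra of the Borel sets of R, i.e. the Borel sets of
   R^n; the library has the same construction for n.-tuple. *)
HB.instance Definition _ := @isMeasurable.Build cV_display
  'cV[R]_n (g_sigma_preimage cV_coord) cV_set0 cV_setC cV_bigcup.

Lemma measurable_cV_coord (i : 'I_n) : measurable_fun setT (cV_coord i).
Proof.
move=> _ Y mY; rewrite setTI; apply: sub_sigma_algebra => /=.
rewrite -bigcup_seq/=; exists i => /=; first by rewrite mem_index_enum.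
by exists Y => //; rewrite setTI.
Qed.

Lemma measurable_fun_cV d (T : measurableType d) (f : T -> 'cV[R]_n) :
  (forall i, measurable_fun setT (cV_coord i \o f)) -> measurable_fun setT f.
Proof.
move=> mf.
have : g_sigma_preimage (fun i => cV_coord i \o f) `<=` measurable.
  apply: smallest_sub; first exact: sigma_algebra_measurable.
  move=> A; rewrite -bigcup_seq/= => -[i _ [B mB <-]].
  exact: mf.
rewrite g_sigma_preimage_comp => prefS.
by move=> _ A mA; apply: prefS; exists A.
Qed.

End measurable_cV.

Section lebesgue_cV.
Context (R : realType).

Definition cV_cons n (p : measurableTypeR R * 'cV[R]_n) : 'cV[R]_n.+1 :=
  col_mx (const_mx p.1 : 'cV[R]_1) p.2.

Definition cV_uncons n (x : 'cV[R]_n.+1) : measurableTypeR R * 'cV[R]_n :=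
  (x ord0 ord0, dsubmx (x : 'cV[R]_(1 + n))).

Lemma cV_consK n : cancel (@cV_cons n) (@cV_uncons n).
Proof.
move=> [a x]; rewrite /cV_cons /cV_uncons /= col_mxKd; congr (_, _).
by rewrite mxE; case: splitP => // j _; rewrite mxE.
Qed.

Lemma measurable_cV_cons n : measurable_fun setT (@cV_cons n).
Proof.
apply: measurable_fun_cV => i; case: (split_ordP (i : 'I_(1 + n))) => j ->.
  rewrite (_ : _ \o _ = fst) //; apply/funext => p.
  by apply: etrans (col_mxEu (const_mx p.1 : 'cV_1) p.2 j ord0) _; rewrite mxE.
rewrite (_ : _ \o _ = cV_coord j \o snd).
  by apply: measurableT_comp => //; exact: measurable_cV_coord.
apply/funext => p.
exact: (col_mxEd (const_mx p.1 : 'cV_1) p.2 j ord0).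
Qed.

Lemma measurable_cV_uncons n : measurable_fun setT (@cV_uncons n).
Proof.
apply: measurable_fun_pair; first exact: (measurable_cV_coord ord0).
apply: measurable_fun_cV => i.
rewrite (_ : _ \o _ = cV_coord (rshift 1 i)); first exact: measurable_cV_coord.
by apply/funext => x; rewrite /= /cV_coord mxE.
Qed.

Section cons_measure.
Context (n : nat) (mu : {sigma_finite_measure set 'cV[R]_n -> \bar R}).

Definition cons_measure : set 'cV[R]_n.+1 -> \bar R :=
  pushforward (@lebesgue_measure R \x mu)%E (@cV_cons n).

Let mcons X : measurable X -> measurable (@cV_cons n @^-1` X).
Proof.
by move=> mX; rewrite -[X in measurable X]setTI; exact: measurable_cV_cons.
Qed.

Let cons_measure0 : cons_measure set0 = 0%E.
Proof. by rewrite /cons_measure /pushforward preimage_set0 measure0. Qed.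

Let cons_measure_ge0 X : (0 <= cons_measure X)%E.
Proof. exact: (measure_ge0 (@lebesgue_measure R \x mu)%E). Qed.

Let cons_measure_sigma_additive : semi_sigma_additive cons_measure.
Proof.
move=> F mF tF mUF; rewrite /cons_measure /pushforward preimage_bigcup.
apply: measure_semi_sigma_additive.
- by move=> k; exact: mcons.
- apply/trivIsetP => /= i j _ _ ij; rewrite -preimage_setI.
  by move/trivIsetP : tF => /(_ _ _ _ _ ij) ->//; rewrite preimage_set0.
- by rewrite -preimage_bigcup; exact: mcons.
Qed.

HB.instance Definition _ := isMeasure.Build _ _ _
  cons_measure cons_measure0 cons_measure_ge0 cons_measure_sigma_additive.

Let cons_measure_sigma_finite : sigma_finite setT cons_measure.
Proof.
have /sigma_finiteP[F [TF ndF Foo]] := sigma_finiteT (@lebesgue_measure R).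
have /sigma_finiteP[G [TG ndG Goo]] := sigma_finiteT mu.
exists (fun k => @cV_uncons n @^-1` (F k `*` G k)).
  rewrite -preimage_bigcup -[LHS](preimage_setT (@cV_uncons n)); congr (_ @^-1` _).
  apply/seteqP; split => // -[x y] _.
  have [k _ Fk] : (\bigcup_k F k) x by rewrite -TF.
  have [l _ Gl] : (\bigcup_k G k) y by rewrite -TG.
  exists (maxn k l) => //; split.
    by move: x Fk; exact/subsetPset/ndF/leq_maxl.
  by move: y Gl; exact/subsetPset/ndG/leq_maxr.
move=> k; have [mF Fk] := Foo k; have [mG Gk] := Goo k; split.
  rewrite -[X in measurable X]setTI; apply: measurable_cV_uncons => //.
  exact: measurableX.
rewrite /cons_measure /pushforward -comp_preimage.
rewrite (_ : _ \o _ = id); last by apply/funext => p; exact: cV_consK.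
by rewrite preimage_id product_measure1E// lte_mul_pinfty// ge0_fin_numE.
Qed.

HB.instance Definition _ := Measure_isSigmaFinite.Build _ _ _ cons_measure
  cons_measure_sigma_finite.

End cons_measure.

Fixpoint lebesgue_cV n : {sigma_finite_measure set 'cV[R]_n -> \bar R} :=
  if n is m.+1 then cons_measure (lebesgue_cV m) else \d_(0 : 'cV[R]_0).

End lebesgue_cV.

(* A weight function is modelled by a total function w : R -> R of which only
   the values on [0, +oo[ are ever used. *)

Section weight.
Context (R : realType).
Implicit Types (w : R -> R) (t s : R) (L : \bar R).

Definition weight_function w :=
  [/\ forall t, 0 <= t -> 0 <= w t,
      forall t s, 0 <= t -> t <= s -> w t <= w s &
      forall M, exists2 t, 0 <= t & M <= w t].

Definition beta2star w := exists C T : R, forall t, T <= t -> 0 <= t ->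
  (\int[lebesgue_measure]_(s in `[1%R, +oo[%classic)
     (w (t * s) * s ^- 3)%:E <= (C * w t)%:E)%E.

Definition phi w : R^o -> R^o := fun u => w (expR u).

(* Convexity is only required on [0, +oo[, the range used by the Young
   conjugate; it is implied by convexity on the whole line. *)
Definition cond_delta w := convex_function [set u : R^o | 0 <= u] (phi w).

Definition young_conjugate w (v : R) : \bar R :=
  ereal_sup [set (u * v - phi w u)%:E | u in [set u : R | 0 <= u]].

Definition index_m w : \bar R := ereal_inf [set L | (1 <= L)%E /\
  exists2 C : R, 0 < C & forall t s, 0 <= t -> 0 <= s ->
    ((w (t + s))%:E <= L * (w t + w s)%:E + C%:E)%E].

Definition index_mk (k : R) w : \bar R := ereal_inf [set L | (1 <= L)%E /\
  exists2 C : R, 0 < C & forall t, 0 <= t ->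
    ((w (k * t))%:E <= L * (w t)%:E + C%:E)%E].

Definition quadratic_interpolation (d : nat) w :=
  exists2 L : R, 0 < L & exists2 C : R, 0 < C & forall t, 0 <= t ->
    exists2 s : R, 1 <= s <= d%:R &
      t `^ (2 * ((d%:R - s) / (d%:R - 1))) + w (t `^ s) <= L * w t + C.

Definition index_QI (d : nat) w (mu : R) : \bar R :=
  ereal_inf [set L | (1 <= L)%E /\
    exists2 C : R, 0 < C & forall t, 0 <= t ->
      (ereal_inf [set ((d%:R - 1) / (2 * d%:R) * s `^ (2 / (d%:R - 1))
                       + mu^-1 * w (t ^+ d / s))%:E | s in [set s : R | (0 < s)%R]]
       <= L * (mu^-1 * w t)%:E + C%:E)%E].

End weight.

Section phragmen_lindelof.
Context (R : realType).

Definition cmod (z : R[i]) : R := Normc.normc z.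

Definition cexpi (t : R) : R[i] := (cos t +i* sin t)%C.

Definition sector (rho : R) : set (R[i]^o) :=
  [set z | exists r t : R,
     [/\ 0 < r, - (rho / 2) < t, t < rho / 2 & z = (r%:C)%C * cexpi t]].

Definition boundary (T : topologicalType) (A : set T) := closure A `\` interior A.

(* [derivable F z 1] is taken over the field R[i]: complex differentiability.
   The constant C may depend on rho and lambda, but not on F and M. *)
Definition PL_admissible (w : R -> R) (theta : R) (L : \bar R) :=
  forall rho lambda : R, 0 < rho -> rho <= theta -> 0 < lambda ->
  exists2 C : R, 0 < C & forall (F : R[i]^o -> R[i]^o) (M : R),
    (forall z, sector rho z -> derivable F z 1) ->
    {within closure (sector rho), continuous F} ->
    (forall z, boundary (sector rho) z ->
      cmod (F z) <= M * expR (lambda * w (cmod z))) ->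
    (forall e : R, 0 < e -> exists2 K : R, 0 < K & forall z, sector rho z ->
      cmod (F z) <= K * expR (e * cmod z `^ (pi / rho))) ->
    forall z, sector rho z ->
      ((cmod (F z))%:E <=
         (C * M)%:E * expeR (L * (lambda * w (cmod z))%:E))%E.

Definition index_PL (theta : R) (w : R -> R) : \bar R :=
  ereal_inf [set L | (1 <= L)%E /\ PL_admissible w theta L].

End phragmen_lindelof.

Section constants.
Context (R : realType).

Definition C2 (d : nat) (w : R -> R) : \bar R :=
  (index_m w * index_mk (Num.sqrt d%:R) w * index_PL (pi / 2) w)%E.

(* [fine] sends +oo to 0, but when C2 = +oo the product is +oo whatever the
   last factor, all factors being at least 1. *)
Definition C3 (d : nat) (w : R -> R) (lambda : R) : \bar R :=
  (index_mk (d%:R `^ ((d%:R - 1) / (2 * d%:R))) w * C2 d w *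
   index_QI d w (fine (C2 d w) * lambda)^-1)%E.

End constants.

Section Rd.
Context (R : realType) (d : nat).
Notation V := 'cV[R]_d.
Notation mu := (lebesgue_cV R d).
Implicit Types (x y : V) (A B : 'M[R]_d) (f : V -> R[i]).

Definition dotv x y : R := \sum_(i < d) x i ord0 * y i ord0.

Definition stdbasis (j : 'I_d) : V := delta_mx j ord0.

Definition posdef A := A^T = A /\ forall x, x != 0 -> 0 < dotv (A *m x) x.

(* A^(1/2) is the unique positive definite square root of a positive definite
   matrix A; the default value 0 is never used for such an A. *)
Definition sqrtmx A : 'M[R]_d := xget 0 [set B | posdef B /\ B *m B = A].

Definition cintegral f : R[i] :=
  ((\int[mu]_x complex.Re (f x))%R +i* (\int[mu]_x complex.Im (f x))%R)%C.

Definition L2 f := [/\ measurable_fun setT (fun x => complex.Re (f x)),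
  measurable_fun setT (fun x => complex.Im (f x)) &
  (\int[mu]_x (cmod (f x) ^+ 2)%:E < +oo)%E].

(* The integral is well defined for the f of interest: a bound by
   exp(- q(x)/2 + o(|x|^2)), q positive definite, makes f integrable. *)
Definition fourier f (xi : V) : R[i] :=
  (((2 * pi) `^ (- (d%:R / 2)))%:C)%C *
  cintegral (fun x => f x * cexpi (- dotv x xi)).

Implicit Types alpha : 'I_d -> nat.

Definition mabs alpha : nat := (\sum_(j < d) alpha j)%N.

Definition mfact alpha : nat := (\prod_(j < d) (alpha j)`!)%N.

Definition mderiv alpha (g : V -> R) : V -> R :=
  foldr (fun j h => iter (alpha j) (fun k x => 'D_(stdbasis j) (k : V -> R^o) x) h)
    g (enum 'I_d).

Definition hermite alpha x : R :=
  (-1) ^+ mabs alpha * pi `^ (- (d%:R / 4))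
  * (2 ^+ mabs alpha * (mfact alpha)%:R) `^ (- (1 / 2))
  * expR (dotv x x / 2)
  * mderiv alpha (fun y => expR (- dotv y y)) x.

Definition hermiteA A alpha x : R :=
  (\det A) `^ (1 / 4) * hermite alpha (sqrtmx A *m x).

(* No conjugate: the Hermite functions are real-valued. *)
Definition hermite_coef A f alpha : R[i] :=
  cintegral (fun x => f x * ((hermiteA A alpha x)%:C)%C).

End Rd.

(* Main.v *)
Require Import Defs.
From HB Require Import structures.
From mathcomp Require Import all_boot all_order all_algebra.
From mathcomp Require Import complex.
From mathcomp Require Import all_classical all_reals all_analysis.
From mathcomp Require Import measurable_realfun.
From mathcomp Require Import ring lra.

(** Put [y = A^(1/2) x]. The kernels [gker z t = exp (- z^2 + 2 z t - t^2 / 2)]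
    generate the Hermite functions, so the Hermite coefficients of [f], suitably
    normalised, are the Taylor coefficients of the entire function
      F(z) = \int f(x) \prod_k gker z_k y_k dx
    of [d] complex variables, a Bargmann transform of [f]. The theorem is a growth
    estimate for [F] followed by Cauchy's estimate on well chosen tori.

    For the growth, single out a coordinate [j]. In the other coordinates the
    kernels are integrable, at the cost of [exp |z_k|^2]. In coordinate [j] the
    Gaussian decay of [f] gives, by completing the square, a bound by
    [exp ((Im z_j)^2 + mu w |Re z_j|)] ([directional_bound]). A quarter turn of [z]
    turns the kernel into its own Fourier transform, so the decay of the Fourier
    transform of [f] gives the same bound with the real and imaginary parts of
    [z_j] exchanged ([gker_prod_fourier]). As a function of [z_j] alone, [F] then
    has order two and is bounded by an exponential of the weight on both axes,
    which is a Phragmen-Lindelof situation in each quadrant ([PL_axes]). The outcome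
    is [entire_bound]: for each [j],
      |F(z)| <= C exp (\sum_(k != j) |z_k|^2 + kappa w |z_j|),
    where [kappa] is [lambda] times constants of the weight as close to their
    infima as desired ([C3_witness]).

    On the torus with [|z_j| = rho1 / sqrt 2] and all other radii [rho / sqrt 2],
    Cauchy's estimate ([torus_bound]) bounds the coefficient of index [alpha]. The
    geometric mean over [j] of these estimates depends on [alpha] only through
    [|alpha|] ([axis_mean]). When [rho^(d-1) rho1 = t^d], the exponent
    [(d-1) rho^2 / 2 + kappa w rho1] is the quantity minimised in the interpolation
    index at a dilate of [t], and the best choice makes it at most [w t / r] up to a
    constant ([optimal_radii]). So the coefficient is at most a constant times
    [exp (w t / r) / t^|alpha|] for all [t >= 1], and the infimum over [t = exp u]
    is the Young conjugate ([young_bound]).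

    The integral condition on the weight enters through [w t = o(t^2)]
    ([weight_small]), which lets Gaussians absorb weights in every integral above.
    Contour integrals are replaced by means over roots of unity ([gker_mean]), and
    the linear change of variables is made by eliminating one coordinate after the
    other ([integral_posdef]). *)

Set Implicit Arguments.
Unset Strict Implicit.
Unset Printing Implicit Defensive.

Import Order.TTheory GRing.Theory Num.Theory.
Import numFieldNormedType.Exports.

Local Open Scope classical_set_scope.
Local Open Scope ring_scope.

(** * The complex exponential *)

Section complex_exp.
Context {R : realType}.
Implicit Types (z u : R[i]) (t : R).

Lemma cmod_ge0 z : 0 <= cmod z.
Proof. by case: z => a b; exact: sqrtr_ge0. Qed.

Lemma cmodM z u : cmod (z * u) = cmod z * cmod u.
Proof. exact: Normc.normcM. Qed.

Lemma cmodD z u : cmod (z + u) <= cmod z + cmod u.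
Proof. exact: le_normcD. Qed.

Lemma cmodN z : cmod (- z) = cmod z.
Proof. exact: normcN. Qed.

Lemma cmodB z u : cmod (z - u) <= cmod z + cmod u.
Proof. by rewrite -(cmodN u); exact: cmodD. Qed.

Lemma cmod_real t : cmod (t%:C)%C = `|t|.
Proof. by rewrite /cmod /= expr0n addr0 sqrtr_sqr. Qed.

Lemma cmod0 : cmod (0 : R[i]) = 0.
Proof. by rewrite -[0]/((0:R)%:C)%C cmod_real normr0. Qed.

Lemma cmod1 : cmod (1 : R[i]) = 1.
Proof. by rewrite -[1]/((1:R)%:C)%C cmod_real normr1. Qed.

Lemma cmod_nat n : cmod (n%:R : R[i]) = n%:R.
Proof. by rewrite -(rmorph_nat (real_complex R)) cmod_real ger0_norm. Qed.

Lemma cmodX z n : cmod (z ^+ n) = cmod z ^+ n.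
Proof. by elim: n => [|n IH]; rewrite ?cmod1// !exprS cmodM IH. Qed.

Lemma cmodV z : cmod z^-1 = (cmod z)^-1.
Proof. exact: Normc.normcV. Qed.

Lemma normcE z : `|z| = ((cmod z)%:C)%C.
Proof. by []. Qed.

Lemma cmod_eq0 z : (cmod z == 0) = (z == 0).
Proof.
apply/idP/eqP => [/eqP|->]; last by rewrite cmod0.
exact: Normc.eq0_normc.
Qed.

Lemma cmod_sum (I : Type) (r : seq I) (P : pred I) (F : I -> R[i]) :
  cmod (\sum_(i <- r | P i) F i) <= \sum_(i <- r | P i) cmod (F i).
Proof.
elim/big_rec2 : _ => [|i x y _ h]; first by rewrite cmod0.
by apply: le_trans (cmodD _ _) _; rewrite lerD2l.
Qed.

Lemma cmod_prod (I : Type) (r : seq I) (P : pred I) (F : I -> R[i]) :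
  cmod (\prod_(i <- r | P i) F i) = \prod_(i <- r | P i) cmod (F i).
Proof. exact: (big_morph _ cmodM cmod1). Qed.

Lemma sqr_cmod z : cmod z ^+ 2 = complex.Re z ^+ 2 + complex.Im z ^+ 2.
Proof.
by case: z => a b; rewrite /cmod /= sqr_sqrtr// addr_ge0// sqr_ge0.
Qed.

Lemma Re_le_cmod z : `|complex.Re z| <= cmod z.
Proof.
rewrite -(ler_pXn2r (n := 2)) ?nnegrE ?cmod_ge0// sqr_cmod real_normK ?num_real//.
by rewrite lerDl sqr_ge0.
Qed.

Lemma Im_le_cmod z : `|complex.Im z| <= cmod z.
Proof.
rewrite -(ler_pXn2r (n := 2)) ?nnegrE ?cmod_ge0// sqr_cmod real_normK ?num_real//.
by rewrite lerDr sqr_ge0.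
Qed.

Lemma cmod_le z : cmod z <= `|complex.Re z| + `|complex.Im z|.
Proof.
rewrite -(ler_pXn2r (n := 2)) ?nnegrE ?cmod_ge0 ?addr_ge0//.
rewrite sqr_cmod sqrrD !real_normK ?num_real//.
have := mulr_ge0 (normr_ge0 (complex.Re z)) (normr_ge0 (complex.Im z)).
lra.
Qed.

Lemma ReD z u : complex.Re (z + u) = complex.Re z + complex.Re u.
Proof. by case: z u => a b [c e]. Qed.
Lemma ImD z u : complex.Im (z + u) = complex.Im z + complex.Im u.
Proof. by case: z u => a b [c e]. Qed.
Lemma ReN z : complex.Re (- z) = - complex.Re z.
Proof. by case: z. Qed.
Lemma ImN z : complex.Im (- z) = - complex.Im z.
Proof. by case: z. Qed.
Lemma ReM z u : complex.Re (z * u) =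
  complex.Re z * complex.Re u - complex.Im z * complex.Im u.
Proof. by case: z u => a b [c e]. Qed.
Lemma ImM z u : complex.Im (z * u) =
  complex.Re z * complex.Im u + complex.Im z * complex.Re u.
Proof. by case: z u => a b [c e]. Qed.

Lemma complex_ext z u :
  complex.Re z = complex.Re u -> complex.Im z = complex.Im u -> z = u.
Proof. by case: z u => a b [c e] /= -> ->. Qed.

Definition cexp z : R[i] :=
  ((expR (complex.Re z) * cos (complex.Im z)) +i*
   (expR (complex.Re z) * sin (complex.Im z)))%C.

Lemma cexpD z u : cexp (z + u) = cexp z * cexp u.
Proof.
by apply: complex_ext; rewrite ?ReM ?ImM /= ReD ImD expRD ?cosD ?sinD; ring.
Qed.

Lemma cexp0 : cexp 0 = 1.
Proof. by apply: complex_ext; rewrite /= expR0 ?cos0 ?sin0 ?mulr1 ?mulr0. Qed.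

Lemma cmod_cexp z : cmod (cexp z) = expR (complex.Re z).
Proof.
apply/eqP; rewrite -(eqrXn2 (n := 2)) ?cmod_ge0 ?expR_ge0//; apply/eqP.
rewrite sqr_cmod /= !exprMn -mulrDr.
by rewrite cos2Dsin2 mulr1.
Qed.

(** Real differentiation of a curve: the exponential series is estimated along
    the segment from [0] to [u], where the real mean value theorem suffices. *)
Definition cderiv (g : R -> R[i]) (t : R) (v : R[i]) :=
  is_derive t 1 (fun s => complex.Re (g s)) (complex.Re v) /\
  is_derive t 1 (fun s => complex.Im (g s)) (complex.Im v).

Lemma cderiv_cst (c : R[i]) t : cderiv (fun=> c) t 0.
Proof. by split; exact: is_derive_cst. Qed.

Lemma cderivD g h t u v : cderiv g t u -> cderiv h t v ->
  cderiv (fun s => g s + h s) t (u + v).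
Proof.
move=> [g1 g2] [h1 h2]; rewrite /cderiv ReD ImD.
under eq_fun do rewrite ReD; under [X in _ /\ is_derive _ _ X _]eq_fun do rewrite ImD.
by split; exact: is_deriveD.
Qed.

Lemma cderivM g h t u v : cderiv g t u -> cderiv h t v ->
  cderiv (fun s => g s * h s) t (u * h t + g t * v).
Proof.
move=> [g1 g2] [h1 h2]; rewrite /cderiv ReD ImD.
under eq_fun do rewrite ReM; under [X in _ /\ is_derive _ _ X _]eq_fun do rewrite ImM.
split.
  apply: (is_derive_eq (is_deriveB (is_deriveM g1 h1) (is_deriveM g2 h2))).
  by rewrite !ReM -![_ *: _]/(_ * _); ring.
apply: (is_derive_eq (is_deriveD (is_deriveM g1 h2) (is_deriveM g2 h1))).
by rewrite !ImM -![_ *: _]/(_ * _); ring.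
Qed.

Lemma cderivZ (c : R[i]) g t u : cderiv g t u -> cderiv (fun s => c * g s) t (c * u).
Proof.
move=> gu; have := cderivM (cderiv_cst c t) gu.
by rewrite mul0r add0r.
Qed.

Lemma cderivX g n t u : cderiv g t u ->
  cderiv (fun s => g s ^+ n) t (n%:R * g t ^+ n.-1 * u).
Proof.
move=> gu; elim: n => [|n IH].
  by rewrite !mul0r; apply: cderiv_cst.
rewrite (_ : (fun s => g s ^+ n.+1) = fun s => g s * g s ^+ n); last first.
  by apply/funext => s; rewrite exprS.
have := cderivM gu IH; congr (cderiv _ _ _).
case: n {IH} => [|n]; first by rewrite !expr0/=; ring.
by rewrite /= -[n.+2%:R]natr1 !exprS; ring.
Qed.

Lemma cderiv_sum n (g : 'I_n -> R -> R[i]) t (u : 'I_n -> R[i]) :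
  (forall i, cderiv (g i) t (u i)) ->
  cderiv (fun s => \sum_(i < n) g i s) t (\sum_(i < n) u i).
Proof.
elim: n g u => [|n IH] g u gu.
  rewrite big_ord0; under eq_fun do rewrite big_ord0.
  exact: cderiv_cst.
rewrite big_ord_recr; under eq_fun do rewrite big_ord_recr.
by apply: cderivD => //; apply: IH.
Qed.

Lemma cderiv_linear (u : R[i]) t : cderiv (fun s => (s%:C)%C * u) t u.
Proof.
have h (c : R) : is_derive t 1 (fun s : R => s * c) c.
  rewrite (_ : (fun s => _) = (fun s => c *: (id s : R^o))); last first.
    by apply/funext => s; rewrite mulrC.
  have := is_deriveZ c (is_derive_id t (1 : R)).
  by rewrite -[_ *: _]/(_ * _) mulr1.
by split; [under eq_fun do rewrite ReM/= mul0r subr0 |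
           under eq_fun do rewrite ImM/= mul0r addr0]; exact: h.
Qed.

Lemma cderiv_cexp (u : R[i]) t :
  cderiv (fun s => cexp ((s%:C)%C * u)) t (u * cexp ((t%:C)%C * u)).
Proof.
have [h1 h2] := cderiv_linear u t.
have e1 : is_derive t 1 (fun s : R => expR (complex.Re ((s%:C)%C * u)))
   (complex.Re u * expR (complex.Re ((t%:C)%C * u))).
  have := is_derive1_comp (is_derive_expR _) h1; rewrite mulrC; exact.
have e2 : is_derive t 1 (fun s : R => cos (complex.Im ((s%:C)%C * u)))
   (complex.Im u * - sin (complex.Im ((t%:C)%C * u))).
  have := is_derive1_comp (is_derive_cos _) h2; rewrite mulrC; exact.
have e3 : is_derive t 1 (fun s : R => sin (complex.Im ((s%:C)%C * u)))
   (complex.Im u * cos (complex.Im ((t%:C)%C * u))).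
  have := is_derive1_comp (is_derive_sin _) h2; rewrite mulrC; exact.
split; rewrite /cexp /=.
  apply: (is_derive_eq (is_deriveM e1 e2)).
  rewrite -![_ *: _]/(_ * _); move: ((t%:C)%C * u) => v.
  by rewrite ReM /=; ring.
apply: (is_derive_eq (is_deriveM e1 e3)).
rewrite -![_ *: _]/(_ * _); move: ((t%:C)%C * u) => v.
by rewrite ImM /=; ring.
Qed.

Lemma is_derive_cont (f : R -> R) (df : R -> R) :
  (forall x, is_derive x (1 : R) f (df x)) -> continuous f.
Proof.
by move=> h x; apply: differentiable_continuous; apply/derivable1_diffP;
  case: (h x).
Qed.

(** The mean value inequality: pairing [g] with the conjugate of its value at [t]
    reduces it to a real function. *)
Lemma cderiv_bound (g : R -> R[i]) (g' : R -> R[i]) (b b' : R -> R) :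
  (forall t, cderiv g t (g' t)) -> (forall t, is_derive t 1 b (b' t)) ->
  g 0 = 0 -> 0 <= b 0 ->
  (forall t, 0 <= t <= 1 -> cmod (g' t) <= b' t) ->
  forall t, 0 <= t <= 1 -> cmod (g t) <= b t.
Proof.
move=> dg db g0 b0 hb t /andP[t0 t1].
pose c : R[i] := (conjc (g t)).
pose h s := complex.Re (c * g s) - cmod (g t) * b s.
pose h' s := complex.Re (c * g' s) - cmod (g t) * b' s.
have dh (s : R) : is_derive s 1 h (h' s).
  have [h1 _] := cderivZ c (dg s).
  have h2 : is_derive s 1 (fun s => cmod (g t) * b s) (cmod (g t) * b' s).
    exact: is_deriveZ (db s).
  exact: is_deriveB.
have cc : cmod c = cmod (g t).
  by rewrite /c /cmod; case: (g t) => x y /=; rewrite sqrrN.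
have [x xt E] := MVT_segment t0 (fun x _ => dh x)
  (continuous_subspaceT (is_derive_cont dh)).
have hle : h t - h 0 <= 0.
  rewrite E subr0; apply: mulr_le0_ge0 => //.
  rewrite /h' subr_le0; apply: le_trans (ler_norm _) _.
  apply: le_trans (Re_le_cmod _) _; rewrite cmodM cc.
  apply: ler_wpM2l; first exact: cmod_ge0.
  apply: hb; move: xt; rewrite in_itv/= => /andP[-> xt].
  exact: le_trans t1.
have : h t <= 0.
  have : h 0 <= 0 by rewrite /h g0 mulr0/= sub0r oppr_le0 mulr_ge0// cmod_ge0.
  lra.
rewrite /h subr_le0 => le1.
have E2 : complex.Re (c * g t) = cmod (g t) * cmod (g t).
  by rewrite -expr2 sqr_cmod /c ReM; case: (g t) => x1 y1/=; ring.
move: le1; rewrite E2.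
have [/eqP ->|nz] := boolP (cmod (g t) == 0).
  move=> _; apply: le_trans (_ : b 0 <= _) => //.
  have [x1 xt1 E1] := MVT_segment t0 (fun x _ => db x)
    (continuous_subspaceT (is_derive_cont db)).
  rewrite -subr_ge0 E1 subr0 mulr_ge0//.
  apply: le_trans (cmod_ge0 (g' x1)) _; apply: hb.
  move: xt1; rewrite in_itv/= => /andP[-> xt1].
  exact: le_trans t1.
rewrite ler_pM2l// lt_neqAle eq_sym nz; exact: cmod_ge0.
Qed.

(** Along the segment from [0] to [u] the derivative of the remainder of order
    [N.+1] is [u] times the remainder of order [N]. *)
Lemma cexp_taylor (u : R[i]) (N : nat) :
  cmod (cexp u - \sum_(k < N) u ^+ k / (k`!)%:R) <=
    cmod u ^+ N / (N`!)%:R * expR (cmod u).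
Proof.
pose g (N : nat) (s : R) := cexp ((s%:C)%C * u) -
   \sum_(k < N) ((s%:C)%C * u) ^+ k / (k`!)%:R.
pose m := cmod u.
pose b (N : nat) (s : R) := (s ^+ N) * (m ^+ N / (N`!)%:R * expR (m)).
suff H : forall t, 0 <= t <= 1 -> cmod (g N t) <= b N t.
  have := H 1; rewrite ler01 lexx => /(_ isT).
  by rewrite /g /b !mul1r expr1n mul1r.
have gder N0 (s : R) : cderiv (g N0.+1) s (u * g N0 s).
  rewrite /g mulrBr; apply: cderivD; first exact: cderiv_cexp.
  rewrite (_ : (fun s => - _) = fun s : R => (-1) * (1 +
     \sum_(k < N0) (((k.+1)`!)%:R)^-1 * ((s%:C)%C * u) ^+ k.+1)); last first.
    apply/funext => s0; rewrite mulN1r; congr (- _).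
    rewrite big_ord_recl/= expr0 divr1; congr (_ + _).
    by apply: eq_bigr => i _; rewrite mulrC.
  rewrite -[X in cderiv _ _ X]mulN1r; apply: cderivZ.
  rewrite -[X in cderiv _ _ X]add0r; apply: cderivD; first exact: cderiv_cst.
  rewrite mulr_sumr; apply: cderiv_sum => i.
  have := cderivZ (((i.+1)`!)%:R^-1 : R[i]) (cderivX i.+1 (cderiv_linear u s)).
  congr (cderiv _ _ _) => /=.
  rewrite factS natrM invfM.
  have : (i.+1%:R : R[i]) != 0 by rewrite pnatr_eq0.
  move: (_.+1%:R : R[i]) => q q0.
  by field; rewrite q0 pnatr_eq0 -lt0n fact_gt0.
have bder N0 (s : R) : is_derive s 1 (b N0.+1) (m * b N0 s).
  rewrite (_ : b N0.+1 = (m ^+ N0.+1 / (N0.+1)`!%:R * expR m) \*: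
      ((id : R -> R) ^+ N0.+1)); last first.
    by apply/funext => x; rewrite /b /= exprfctE mulrC.
  apply: (is_derive_eq (is_deriveZ _ (is_deriveX N0.+1 (is_derive_id s (1 : R))))).
  rewrite -![_ *: _]/(_ * _) /b /=.
  rewrite mulr1 factS natrM invfM exprS.
  have : (N0.+1%:R : R) != 0 by rewrite pnatr_eq0.
  move: (_.+1%:R : R) => q q0; field.
  by rewrite q0 pnatr_eq0 -lt0n fact_gt0.
elim: N => [|N IH] t t01.
  have /andP[t0 t1] := t01.
  rewrite /g /b big_ord0 subr0 !expr0 mul1r fact0 divr1 mul1r cmod_cexp ler_expR.
  apply: le_trans (ler_norm _) _; apply: le_trans (Re_le_cmod _) _.
  by rewrite cmodM cmod_real ger0_norm// ler_piMl// cmod_ge0.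
apply: (cderiv_bound (gder N) (bder N)) => //.
- rewrite /g mul0r cexp0 big_ord_recl expr0 fact0 divr1 big1 ?addr0 ?subrr// => i _.
  by rewrite expr0n mul0r.
- by rewrite /b expr0n mul0r.
by move=> s s01; rewrite cmodM ler_wpM2l ?cmod_ge0// IH.
Qed.

End complex_exp.

(** * Integration of complex functions *)

Lemma integralZl_ge0 {R : realType} d (T : measurableType d)
    (mu : {measure set T -> \bar R}) (c : R) (f : T -> R) :
  0 <= c -> measurable_fun setT f -> (forall x, 0 <= f x) ->
  (\int[mu]_x (c%:E * (f x)%:E) = c%:E * \int[mu]_x (f x)%:E)%E.
Proof.
move=> c0 mf f0; apply: ge0_integralZl => //.
- exact/measurable_EFinP.
- by move=> x _; rewrite lee_fin.
Qed.

Section complex_measurable.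
Context {R : realType} d (T : measurableType d).
Implicit Types f g : T -> R[i].

Definition cmeas f := measurable_fun setT (fun x => complex.Re (f x)) /\
  measurable_fun setT (fun x => complex.Im (f x)).

Lemma cmeas_cst (c : R[i]) : cmeas (fun=> c).
Proof. by split; exact: measurable_cst. Qed.

Lemma cmeasD f g : cmeas f -> cmeas g -> cmeas (fun x => f x + g x).
Proof.
move=> [f1 f2] [g1 g2]; split.
  by under eq_fun do rewrite ReD; exact: measurable_funD.
by under eq_fun do rewrite ImD; exact: measurable_funD.
Qed.

Lemma cmeasM f g : cmeas f -> cmeas g -> cmeas (fun x => f x * g x).
Proof.
move=> [f1 f2] [g1 g2]; split.
  by under eq_fun do rewrite ReM; apply: measurable_funB; exact: measurable_funM.
by under eq_fun do rewrite ImM; apply: measurable_funD; exact: measurable_funM.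
Qed.

Lemma cmeasN f : cmeas f -> cmeas (fun x => - f x).
Proof.
move=> mf; under eq_fun do rewrite -mulN1r.
by apply: cmeasM => //; exact: cmeas_cst.
Qed.

Lemma cmeas_sum (I : Type) (r : seq I) (F : I -> T -> R[i]) :
  (forall i, cmeas (F i)) -> cmeas (fun x => \sum_(i <- r) F i x).
Proof.
move=> mF; elim: r => [|i r IH].
  by under eq_fun do rewrite big_nil; exact: cmeas_cst.
by under eq_fun do rewrite big_cons; exact: cmeasD.
Qed.

Lemma cmeas_prod (I : Type) (r : seq I) (F : I -> T -> R[i]) :
  (forall i, cmeas (F i)) -> cmeas (fun x => \prod_(i <- r) F i x).
Proof.
move=> mF; elim: r => [|i r IH].
  by under eq_fun do rewrite big_nil; exact: cmeas_cst.
by under eq_fun do rewrite big_cons; exact: cmeasM.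
Qed.

Lemma cmeas_real (f : T -> R) : measurable_fun setT f ->
  cmeas (fun x => ((f x)%:C)%C).
Proof. by move=> mf; split => //=; exact: measurable_cst. Qed.

Lemma cmeas_cmod f : cmeas f -> measurable_fun setT (fun x => cmod (f x)).
Proof.
move=> [f1 f2].
rewrite (_ : (fun x => cmod (f x)) = fun x =>
  Num.sqrt (complex.Re (f x) ^+ 2 + complex.Im (f x) ^+ 2)); last first.
  by apply/funext => x; case: (f x).
have ms : measurable_fun setT (@Num.sqrt R).
  by apply: continuous_measurable_fun => x; exact: sqrt_continuous.
by apply: (measurableT_comp ms); apply: measurable_funD; exact: measurable_funX.
Qed.

Lemma cmeas_cexp f : cmeas f -> cmeas (fun x => cexp (f x)).
Proof.
move=> [f1 f2]; split; apply: measurable_funM.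
- exact: measurableT_comp.
- apply: measurableT_comp f2.
  by apply: continuous_measurable_fun => x; exact: continuous_cos.
- exact: measurableT_comp.
- apply: measurableT_comp f2.
  by apply: continuous_measurable_fun => x; exact: continuous_sin.
Qed.

End complex_measurable.

Lemma cmeas_comp {R : realType} d1 d2 (T1 : measurableType d1)
    (T2 : measurableType d2) (f : T2 -> R[i]) (g : T1 -> T2) :
  cmeas f -> measurable_fun setT g -> cmeas (fun x => f (g x)).
Proof.
by move=> [f1 f2] mg; split; [exact: (measurableT_comp f1)|exact: (measurableT_comp f2)].
Qed.

Section complex_integral.
Context {R : realType} d (T : measurableType d)
  (mu : {measure set T -> \bar R}).
Implicit Types f g : T -> R[i].

(** Coordinatewise, so as to be convertible to the integral in the definition of
    the Fourier transform and of the Hermite coefficients. *)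
Definition cint f : R[i] :=
  (Rintegral mu setT (fun x => complex.Re (f x)) +i*
   Rintegral mu setT (fun x => complex.Im (f x)))%C.

Definition cintble f :=
  mu.-integrable setT (fun x => (complex.Re (f x))%:E) /\
  mu.-integrable setT (fun x => (complex.Im (f x))%:E).

Lemma cintble_meas f : cintble f -> cmeas f.
Proof.
by move=> [/integrableP[f1 _] /integrableP[f2 _]]; split;
  apply/measurable_EFinP.
Qed.

Lemma le_cintble f (g : T -> R) : cmeas f -> (forall x, cmod (f x) <= g x) ->
  mu.-integrable setT (fun x => (g x)%:E) -> cintble f.
Proof.
move=> [f1 f2] fg ig; split; apply: le_integrable ig => //.
- exact/measurable_EFinP.
- move=> x _; rewrite !abse_EFin lee_fin.
  exact: le_trans (Re_le_cmod _) (le_trans (fg x) (ler_norm _)).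
- exact/measurable_EFinP.
- move=> x _; rewrite !abse_EFin lee_fin.
  exact: le_trans (Im_le_cmod _) (le_trans (fg x) (ler_norm _)).
Qed.

Lemma cintble_cmod f : cintble f ->
  mu.-integrable setT (fun x => (cmod (f x))%:E).
Proof.
move=> cf; have mf := cintble_meas cf; case: cf => f1 f2.
have := integrableD measurableT (integrable_abse f1) (integrable_abse f2).
apply: le_integrable => //; first exact/measurable_EFinP/cmeas_cmod.
move=> x _; rewrite -[X in (_ <= X)%E]/(`|(`|complex.Re (f x)|%R + `|complex.Im (f x)|%R)%:E|)%E.
rewrite !abse_EFin lee_fin.
by rewrite (ger0_norm (cmod_ge0 _)); apply: le_trans (cmod_le _) (ler_norm _).
Qed.

Lemma cintble_finite f : cmeas f ->
  (\int[mu]_x (cmod (f x))%:E < +oo)%E -> cintble f.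
Proof.
move=> mf foo; apply: (le_cintble mf (fun x => lexx _)).
apply/integrableP; split; first exact/measurable_EFinP/cmeas_cmod.
under eq_integral do rewrite abse_EFin ger0_norm ?cmod_ge0//.
exact: foo.
Qed.

Lemma cintbleD f g : cintble f -> cintble g -> cintble (fun x => f x + g x).
Proof.
move=> [f1 f2] [g1 g2]; split.
  under eq_fun do rewrite ReD EFinD; exact: (integrableD measurableT f1 g1).
under eq_fun do rewrite ImD EFinD; exact: (integrableD measurableT f2 g2).
Qed.

Lemma cintbleZ (c : R[i]) f : cintble f -> cintble (fun x => c * f x).
Proof.
move=> cf; have := integrableZl measurableT (cmod c) (cintble_cmod cf).
apply: le_cintble; last by move=> x; rewrite cmodM.
by apply: cmeasM; [exact: cmeas_cst|exact: cintble_meas].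
Qed.

Lemma cintble_mulb f g (M : R) : cintble f -> cmeas g ->
  (forall x, cmod (g x) <= M) -> cintble (fun x => f x * g x).
Proof.
move=> cf mg gM; have := integrableZl measurableT M (cintble_cmod cf).
apply: le_cintble; first by apply: cmeasM => //; exact: cintble_meas.
by move=> x; rewrite cmodM mulrC ler_wpM2r ?cmod_ge0.
Qed.

Lemma cintD f g : cintble f -> cintble g ->
  cint (fun x => f x + g x) = cint f + cint g.
Proof.
move=> [f1 f2] [g1 g2]; apply: complex_ext; rewrite ?ReD ?ImD/=.
  by under eq_Rintegral do rewrite ReD; rewrite RintegralD.
by under eq_Rintegral do rewrite ImD; rewrite RintegralD.
Qed.

Lemma cintZ (c : R[i]) f : cintble f ->
  cint (fun x => c * f x) = c * cint f.
Proof.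
move=> [f1 f2].
have h (r : R) (h : T -> R) : mu.-integrable setT (EFin \o h) ->
    mu.-integrable setT (EFin \o (fun x => r * h x)).
  by move=> ih; exact: (integrableZl measurableT r ih).
apply: complex_ext; rewrite ?ReM ?ImM/=.
  under eq_Rintegral do rewrite ReM.
  by rewrite RintegralB//; [rewrite !RintegralZl|exact: h|exact: h].
under eq_Rintegral do rewrite ImM.
by rewrite RintegralD//; [rewrite !RintegralZl|exact: h|exact: h].
Qed.

Lemma cint0 : cint (fun=> 0) = 0.
Proof.
by apply: complex_ext; rewrite /= /Rintegral integral0.
Qed.

Lemma cintble0 : cintble (fun=> 0).
Proof. by split; exact: integrable0. Qed.

Lemma cintble_sum (I : Type) (r : seq I) (F : I -> T -> R[i]) :
  (forall i, cintble (F i)) -> cintble (fun x => \sum_(i <- r) F i x).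
Proof.
move=> iF; elim: r => [|i r IH].
  by under eq_fun do rewrite big_nil; exact: cintble0.
by under eq_fun do rewrite big_cons; exact: cintbleD.
Qed.

Lemma cint_sum (I : Type) (r : seq I) (F : I -> T -> R[i]) :
  (forall i, cintble (F i)) ->
  cint (fun x => \sum_(i <- r) F i x) = \sum_(i <- r) cint (F i).
Proof.
move=> iF; elim: r => [|i r IH].
  by under eq_fun do rewrite big_nil; rewrite big_nil cint0.
under eq_fun do rewrite big_cons; rewrite big_cons cintD ?IH//.
exact: cintble_sum.
Qed.

(** The factor [2] comes from bounding the two coordinates separately. *)
Lemma cint_bound f : cintble f ->
  ((cmod (cint f))%:E <= 2%:E * \int[mu]_x (cmod (f x))%:E)%E.
Proof.
move=> cf; have icf := cintble_cmod cf; case: cf => f1 f2.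
have fin : (\int[mu]_x (cmod (f x))%:E)%E \is a fin_num.
  exact: integrable_fin_num.
have h (k : T -> R) : mu.-integrable setT (EFin \o k) ->
    (forall x, `|k x| <= cmod (f x)) ->
    `|Rintegral mu setT k| <= Rintegral mu setT (fun x => cmod (f x)).
  move=> ik kf; apply: le_trans (le_normr_Rintegral measurableT ik) _.
  apply: le_Rintegral => //; exact: (integrable_abse ik).
rewrite -(fineK fin) -EFinM lee_fin.
apply: le_trans (cmod_le _) _; rewrite mulr_natl mulr2n; apply: lerD.
  by apply: h => // x; exact: Re_le_cmod.
by apply: h => // x; exact: Im_le_cmod.
Qed.

(** Dominated convergence in the form in which a bound on Riemann sums of Cauchy
    integrals becomes a bound on Taylor coefficients. *)
Lemma cint_dominated_le (f_ : nat -> T -> R[i]) f (g : T -> R) (M : R) :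
  (forall n, cmeas (f_ n)) -> cmeas f ->
  (forall x, cmod (f_ n x - f x) @[n --> \oo] --> 0) ->
  mu.-integrable setT (fun x => (g x)%:E) ->
  (forall n x, cmod (f_ n x) <= g x) -> (forall x, cmod (f x) <= g x) ->
  (forall n, cmod (cint (f_ n)) <= M) -> cmod (cint f) <= M.
Proof.
move=> mf_ mf cvf ig f_g fg HM.
have cf_ n : cintble (f_ n) by exact: le_cintble ig.
have cf : cintble f by exact: le_cintble ig.
have cd n : cintble (fun x => f x - f_ n x).
  by under eq_fun do rewrite -mulN1r; apply: cintbleD => //; exact: cintbleZ.
pose h n x := (cmod (f x - f_ n x))%:E.
have mh n : measurable_fun setT (h n).
  apply/measurable_EFinP/cmeas_cmod; apply: cmeasD => //; exact: cmeasN.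
have ig2 : mu.-integrable setT (fun x => (2%:E * (g x)%:E)%E).
  exact: integrableZl.
have h0 : {ae mu, forall x, setT x -> h n x @[n --> \oo] --> cst 0%E x}.
  apply: aeW => x _; apply: cvg_EFin; first by near=> n.
  rewrite /h/=.
  by under eq_fun do rewrite -cmodN opprB; exact: cvf.
have hg : {ae mu, forall x n, setT x -> (`|h n x| <= 2%:E * (g x)%:E)%E}.
  apply: aeW => x n _; rewrite /h abse_EFin -EFinM lee_fin ger0_norm ?cmod_ge0//.
  apply: le_trans (cmodB _ _) _; rewrite mulr_natl mulr2n.
  by rewrite lerD.
have [_ _] := dominated_convergence measurableT mh (measurable_cst _) h0 ig2 hg.
rewrite integral0 => /fine_cvgP[_ hcv].
apply/ler_addgt0Pr => e e0.
have /cvgrPdist_lt /(_ (e / 2)) := hcv.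
rewrite divr_gt0// => /(_ isT) [n _ /(_ n (leqnn n))] /=.
rewrite sub0r normrN => hn.
have E : cint f = cint (f_ n) + cint (fun x => f x - f_ n x).
  rewrite -cintD//; congr cint; apply/funext => x; ring.
suff : cmod (cint f) <= M + e by [].
rewrite E.
apply: le_trans (cmodD _ _) (lerD (HM n) _).
have := cint_bound (cd n).
have fin : (\int[mu]_x (cmod (f x - f_ n x))%:E)%E \is a fin_num.
  exact/integrable_fin_num/cintble_cmod.
rewrite -(fineK fin) -EFinM lee_fin => /le_trans; apply.
rewrite mulrC -ler_pdivlMr//; apply: ltW.
exact: le_lt_trans (ler_norm _) hn.
Unshelve. all: by end_near. Qed.

Lemma eq_cint f g : (forall x, f x = g x) -> cint f = cint g.
Proof. by move=> fg; congr cint; apply/funext. Qed.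

End complex_integral.

(** Integrability is asked of all sections rather than almost all: products of
    kernels provide it, and the inner integrals then have their usual algebra
    everywhere. *)
Lemma cint_fubini {R : realType} d1 d2 (T1 : measurableType d1)
    (T2 : measurableType d2) (m1 : {sigma_finite_measure set T1 -> \bar R})
    (m2 : {sigma_finite_measure set T2 -> \bar R}) (f : T1 * T2 -> R[i]) :
  cintble (m1 \x m2)%E f ->
  (forall x, cintble m2 (fun y => f (x, y))) ->
  (forall y, cintble m1 (fun x => f (x, y))) ->
  (cint m1 (fun x => cint m2 (fun y => f (x, y))) = cint (m1 \x m2)%E f) *
  (cint m2 (fun y => cint m1 (fun x => f (x, y))) = cint (m1 \x m2)%E f).
Proof.
move=> [f1 f2] fx fy.
have h (g : T1 * T2 -> R) : (m1 \x m2)%E.-integrable setT (fun p => (g p)%:E) ->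
    (forall x, m2.-integrable setT (fun y => (g (x, y))%:E)) ->
    (forall y, m1.-integrable setT (fun x => (g (x, y))%:E)) ->
  (Rintegral m1 setT (fun x => Rintegral m2 setT (fun y => g (x, y))) =
   Rintegral (m1 \x m2)%E setT g) *
  (Rintegral m2 setT (fun y => Rintegral m1 setT (fun x => g (x, y))) =
   Rintegral (m1 \x m2)%E setT g).
  move=> ig gx gy; split; rewrite /Rintegral; congr fine.
    rewrite -(integral12_prod_meas1 ig); apply: eq_integral => x _.
    by rewrite fineK//; exact: integrable_fin_num.
  rewrite -(integral21_prod_meas1 ig); apply: eq_integral => y _.
  by rewrite fineK//; exact: integrable_fin_num.
have [a1 a2] := h _ f1 (fun x => (fx x).1) (fun x => (fy x).1).
have [b1 b2] := h _ f2 (fun x => (fx x).2) (fun x => (fy x).2).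
by split; apply: complex_ext.
Qed.

Lemma cint_pushforward {R : realType} d1 d2 (T1 : measurableType d1)
    (T2 : measurableType d2) (phi : T1 -> T2) (mphi : measurable_fun setT phi)
    (m1 : {measure set T1 -> \bar R}) (m2 : {measure set T2 -> \bar R})
    (f : T2 -> R[i]) :
  (forall X, measurable X -> m2 X = pushforward m1 phi X) ->
  cintble m1 (fun x => f (phi x)) -> cmeas f ->
  cint m2 f = cint m1 (fun x => f (phi x)).
Proof.
move=> m2E [f1 f2] [mf1 mf2].
have h (g : T2 -> R) : m1.-integrable setT (fun x => (g (phi x))%:E) ->
    measurable_fun setT g ->
    Rintegral m2 setT g = Rintegral m1 setT (fun x => g (phi x)).
  move=> ig mg; rewrite /Rintegral; congr fine.
  have := @integral_pushforward _ _ _ _ R phi mphi m1 setT (fun x => (g x)%:E).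
  rewrite preimage_setT => <- //; last exact/measurable_EFinP.
  by apply: eq_measure_integral => A mA _; rewrite m2E.
by apply: complex_ext; apply: h.
Qed.

(** * Lebesgue measure on column vectors *)

Lemma lebesgue_affine {R : realType} (a b : R) (a0 : 0 < a)
    (G : measurableTypeR R -> \bar R) :
  measurable_fun setT G -> (forall x, 0 <= G x)%E ->
  (\int[@lebesgue_measure R]_x G (a * x + b)%R =
   (a^-1)%:E * \int[@lebesgue_measure R]_x G x)%E.
Proof.
move=> mG G0.
pose phi (x : measurableTypeR R) : measurableTypeR R := a * x + b.
have mphi : measurable_fun setT phi.
  by apply: measurable_funD => //; exact: measurable_funM.
pose pf : {measure set (measurableTypeR R) -> \bar R} :=
  measure_function_pushforward__canonical__measure_function_Measure (@lebesgue_measure R) mphi.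
pose nu := mscale (NngNum (ltW a0)) pf.
have nuE A : measurable A -> lebesgue_measure A = nu A.
  apply: lebesgue_measure_unique => _ [[c e] _ <-] /=.
  rewrite /nu /mscale /= /pushforward.
  have -> : phi @^-1` `]c, e]%classic = `](c - b) / a, (e - b) / a]%classic.
    apply/seteqP; split => x /=; rewrite !in_itv/= /phi.
      by rewrite ltr_pdivrMr// ler_pdivlMr// ltrBlDr lerBrDr (mulrC x).
    by rewrite ltr_pdivrMr// ler_pdivlMr// ltrBlDr lerBrDr (mulrC x).
  rewrite !lebesgue_measure_itv/= !lte_fin ltr_pM2r ?invr_gt0// ltrD2r.
  case: ifPn => _; last by rewrite mule0.
  by rewrite -EFinM; congr (_%:E); field; rewrite gt_eqF.
have -> : (\int[lebesgue_measure]_x G x = \int[nu]_x G x)%E.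
  by apply: eq_measure_integral => A mA _; exact: nuE.
rewrite ge0_integral_mscale//= muleA -EFinM mulVf ?gt_eqF// mul1e.
by rewrite ge0_integral_pushforward.
Qed.

Section lebesgue_vector.
Context {R : realType}.
Local Notation leb n := (lebesgue_cV R n).

Lemma measurable_cV_consr n (a : R) :
  measurable_fun setT (fun x : 'cV[R]_n => cV_cons (a, x)).
Proof.
apply: (measurableT_comp (@measurable_cV_cons R n)).
exact: measurable_fun_pair.
Qed.

Lemma measurable_mulmx m n (B : 'M[R]_(m, n)) :
  measurable_fun setT (fun x : 'cV[R]_n => B *m x).
Proof.
apply: measurable_fun_cV => i.
rewrite (_ : _ \o _ = fun x : 'cV[R]_n => \sum_(j < n) B i j * cV_coord j x); last first.
  by apply/funext => x; rewrite /cV_coord /= mxE.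
apply: measurable_sum => j; apply: measurable_funM => //.
exact: measurable_cV_coord.
Qed.

Lemma measurable_cVD d (T : measurableType d) n (f g : T -> 'cV[R]_n) :
  measurable_fun setT f -> measurable_fun setT g ->
  measurable_fun setT (fun x => f x + g x).
Proof.
move=> mf mg; apply: measurable_fun_cV => i.
rewrite (_ : _ \o _ = fun x => cV_coord i (f x) + cV_coord i (g x)); last first.
  by apply/funext => x; rewrite /cV_coord /= mxE.
by apply: measurable_funD; exact: (measurableT_comp (measurable_cV_coord i)).
Qed.

Lemma integral_cV_cons n (G : 'cV[R]_n.+1 -> \bar R) :
  measurable_fun setT G -> (forall x, 0 <= G x)%E ->
  (\int[leb n.+1]_x G x =
   \int[@lebesgue_measure R]_a \int[leb n]_x G (cV_cons (a, x)))%E.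
Proof.
move=> mG G0 /=.
have := @ge0_integral_pushforward _ _ _ _ R (@cV_cons R n)
  (measurable_cV_cons (n := n)) (@lebesgue_measure R \x leb n)%E setT G measurableT mG.
rewrite preimage_setT => h.
transitivity (\int[pushforward (@lebesgue_measure R \x leb n)%E (@cV_cons R n)]_y G y)%E => //.
rewrite h => [|? _]; last exact: G0.
rewrite fubini_tonelli1//; last by move=> ?; exact: G0.
by apply: measurableT_comp => //; exact: measurable_cV_cons.
Qed.

Lemma integral_cV_consC n (G : 'cV[R]_n.+1 -> \bar R) :
  measurable_fun setT G -> (forall x, 0 <= G x)%E ->
  (\int[leb n.+1]_x G x =
   \int[leb n]_x \int[@lebesgue_measure R]_a G (cV_cons (a, x)))%E.
Proof.
move=> mG G0; rewrite integral_cV_cons//.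
apply: (fubini_tonelli (fun p => G (cV_cons p))) => //.
by apply: measurableT_comp => //; exact: measurable_cV_cons.
Qed.

Lemma cV_cons0 n (a : measurableTypeR R) (x : 'cV[R]_n) : cV_cons (a, x) ord0 ord0 = a.
Proof.
by rewrite /cV_cons mxE; case: splitP => // j _; rewrite mxE.
Qed.

Lemma cV_consS n (a : measurableTypeR R) (x : 'cV[R]_n) i : cV_cons (a, x) (lift ord0 i) ord0 = x i ord0.
Proof.
have <- := col_mxEd (const_mx a : 'cV[R]_1) x i ord0.
congr (cV_cons _ _ _); exact/val_inj.
Qed.

Lemma cV_consD n (a b : measurableTypeR R) (x y : 'cV[R]_n) :
  cV_cons (a, x) + cV_cons (b, y) = cV_cons (a + b, x + y).
Proof.
apply/colP => i; rewrite [LHS]mxE; case: (unliftP ord0 i) => [j ->|->].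
  by rewrite !cV_consS !mxE.
by rewrite !cV_cons0.
Qed.

Lemma cV_cons_eta n (x : 'cV[R]_n.+1) :
  x = cV_cons (x ord0 ord0 : measurableTypeR R, \col_i x (lift ord0 i) ord0).
Proof.
apply/colP => i; case: (unliftP ord0 i) => [j ->|->]; last by rewrite cV_cons0.
by rewrite cV_consS mxE.
Qed.

Lemma integral_cV0 (G : 'cV[R]_0 -> \bar R) : measurable_fun setT G ->
  (\int[leb 0]_x G x = G 0%R)%E.
Proof. by move=> mG; rewrite /= integral_dirac// diracT mul1e. Qed.

Lemma integral_cV_translate n (v : 'cV[R]_n) (G : 'cV[R]_n -> \bar R) :
  measurable_fun setT G -> (forall x, 0 <= G x)%E ->
  (\int[leb n]_x G (x + v)%R = \int[leb n]_x G x)%E.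
Proof.
elim: n v G => [|n IH] v G mG G0.
  by apply: eq_integral => x _; congr G; apply/colP => -[].
have mGv : measurable_fun setT (fun x : 'cV[R]_n.+1 => G (x + v)).
  by apply: measurableT_comp mG _; exact: measurable_cVD.
rewrite integral_cV_cons// [RHS]integral_cV_cons//.
rewrite (cV_cons_eta v); set b := v ord0 ord0; set w := \col_i _.
transitivity (\int[@lebesgue_measure R]_a \int[leb n]_x G (cV_cons ((a + b)%R, x)))%E.
  apply: eq_integral => a _.
  under eq_integral do rewrite cV_consD.
  apply: (IH w (fun x => G (cV_cons ((a + b)%R, x)))) => //.
  by apply: measurableT_comp => //; exact: measurable_cV_consr.
have := @lebesgue_affine R 1 b ltr01 (fun a => \int[leb n]_x G (cV_cons (a, x)))%E.
under eq_integral do rewrite mul1r.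
rewrite invr1 mul1e; apply.
  apply: (measurable_fun_fubini_tonelli_F (fun p => G (cV_cons p))) => //.
  by apply: measurableT_comp => //; exact: measurable_cV_cons.
by move=> a; exact: integral_ge0.
Qed.

Lemma dotvE n (x y : 'cV[R]_n) : dotv x y = (x^T *m y) ord0 ord0.
Proof. by rewrite mxE; apply: eq_bigr => i _; rewrite mxE. Qed.

Lemma dotv_mulmx n (B : 'M[R]_n) (x y : 'cV[R]_n) :
  dotv (B *m x) y = dotv x (B^T *m y).
Proof. by rewrite !dotvE trmx_mul mulmxA. Qed.

Lemma dotv_cons n (a b : measurableTypeR R) (x y : 'cV[R]_n) :
  dotv (cV_cons (a, x)) (cV_cons (b, y)) = a * b + dotv x y.
Proof.
rewrite /dotv big_ord_recl !cV_cons0; congr (_ + _).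
by apply: eq_bigr => i _; rewrite !cV_consS.
Qed.

Lemma mul_sym_block_cons n (p : R) (b : 'cV[R]_n) (C : 'M[R]_n) (u : measurableTypeR R) (x : 'cV[R]_n) :
  (block_mx (p%:M : 'M[R]_1) b^T b C : 'M[R]_n.+1) *m cV_cons (u, x) =
  cV_cons (p * u + dotv b x : measurableTypeR R, u *: b + C *m x).
Proof.
rewrite /cV_cons /= (mul_block_col (p%:M : 'M[R]_1)).
apply: (f_equal2 (@col_mx R 1 n 1)).
  apply/matrixP => i j; rewrite !ord1 !mxE !big_ord1 !mxE eqxx mulr1n; congr (_ + _).
  by apply: eq_bigr => k _; rewrite mxE.
congr (_ + _); apply/matrixP => i j; rewrite !ord1 !mxE big_ord1 !mxE.
by rewrite mulrC.
Qed.

Lemma mulmx_col_row n (b x : 'cV[R]_n) : b *m (b^T *m x) = dotv b x *: b.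
Proof.
apply/matrixP => i j; rewrite !ord1 !mxE big_ord1 -dotvE.
by rewrite mulrC.
Qed.

(** On a tail [x] the Schur complement is the form [B] minimised over the head,
    which is why it inherits positivity. *)
Lemma posdef_block n (B : 'M[R]_n.+1) : posdef B ->
  exists p (b : 'cV[R]_n) (C : 'M[R]_n),
    [/\ B = block_mx (p%:M : 'M[R]_1) b^T b C, 0 < p &
        posdef (C - p^-1 *: (b *m b^T))].
Proof.
move=> [symB posB].
pose B' : 'M[R]_(1 + n) := B.
pose p := B' ord0 ord0; pose b := dlsubmx B'; pose C := drsubmx B'.
have BE : B = block_mx (p%:M : 'M[R]_1) b^T b C.
  rewrite -[LHS](submxK B') -/b -/C; apply: (f_equal4 (@block_mx R 1 n 1 n)) => //.
    apply/matrixP => i j; rewrite !ord1 !mxE eqxx mulr1n.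
    by congr (B' _ _); exact/val_inj.
  by rewrite /b trmx_dlsub symB.
have symC : C^T = C by rewrite /C trmx_drsub symB.
have p0 : 0 < p.
  have := posB (cV_cons (1 : measurableTypeR R, 0 : 'cV_n)).
  rewrite {1}BE mul_sym_block_cons dotv_cons mulmx0 addr0.
  have dv0 (y : 'cV[R]_n) : dotv y (0 : 'cV[R]_n) = 0.
    by rewrite /dotv big1// => i _; rewrite mxE mulr0.
  rewrite !dv0 !addr0 !mulr1.
  apply; apply/eqP => /(congr1 (fun m : 'cV_n.+1 => m ord0 ord0)).
  by rewrite cV_cons0 mxE => /eqP; rewrite oner_eq0.
exists p, b, C; split => //; split.
  by rewrite linearB linearZ/= trmx_mul trmxK symC.
move=> x x0; pose u : measurableTypeR R := - p^-1 * dotv b x.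
have := posB (cV_cons (u, x)).
rewrite {1}BE mul_sym_block_cons dotv_cons.
have -> : p * u + dotv b x = 0 :> R.
  by rewrite /u mulrA mulrN divff ?gt_eqF// mulN1r addNr.
rewrite mul0r add0r => H.
have -> : (C - p^-1 *: (b *m b^T)) *m x = u *: b + C *m x.
  rewrite mulmxBl addrC; congr (_ + _).
  by rewrite -scalemxAl -mulmxA -scaleNr /u -scalerA mulmx_col_row.
apply: H; apply: contra x0 => /eqP h; apply/eqP/colP => i.
by have := congr1 (fun m : 'cV_n.+1 => m (lift ord0 i) ord0) h; rewrite cV_consS !mxE.
Qed.

(** Eliminating the first variable: for a fixed tail the first coordinate of
    [B *m x] is an affine function of the head of [x], and once that
    coordinate is taken as variable the tail is acted on by the Schur
    complement, which is again positive definite. *)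
Lemma integral_posdef n (B : 'M[R]_n) : posdef B ->
  exists2 c : R, 0 < c & forall G : 'cV[R]_n -> \bar R,
    measurable_fun setT G -> (forall x, 0 <= G x)%E ->
    (\int[leb n]_x G (B *m x)%R = c%:E * \int[leb n]_x G x)%E.
Proof.
elim: n B => [|n IH] B pB.
  exists 1 => // G mG G0; rewrite mul1e; apply: eq_integral => x _.
  by congr G; apply/colP => -[].
have [p [b [C [-> p0 /IH[c c0 hc]]]]] := posdef_block pB.
set S := C - _ in hc.
exists (p^-1 * c) => [|G mG G0]; first by rewrite mulr_gt0 ?invr_gt0.
set B' := block_mx _ _ _ _.
have mGB : measurable_fun setT (fun x : 'cV[R]_n.+1 => G (B' *m x)).
  by apply: measurableT_comp mG _; exact: measurable_mulmx.
rewrite integral_cV_consC//.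
pose H (u : measurableTypeR R) (x : 'cV[R]_n) := G (cV_cons (u, (u / p) *: b + S *m x)).
have mH : measurable_fun setT (fun q : measurableTypeR R * 'cV[R]_n => H q.1 q.2).
  apply: measurableT_comp mG _; apply: (measurableT_comp (@measurable_cV_cons R n)).
  apply: measurable_fun_pair => //; apply: measurable_cVD.
    apply: measurable_fun_cV => i.
    rewrite (_ : _ \o _ = fun q : measurableTypeR R * 'cV[R]_n => (p^-1 * b i ord0) * q.1); last first.
      by apply/funext => q; rewrite /cV_coord /= mxE; ring.
    by apply: measurable_funM.
  by apply: measurableT_comp => //; exact: measurable_mulmx.
transitivity (\int[leb n]_x ((p^-1)%:E * \int[@lebesgue_measure R]_u H u x))%E.
  apply: eq_integral => x _.
  rewrite -(@lebesgue_affine R p (dotv b x) p0 (H^~ x)); last 2 first.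
  - by have := measurable_fun_pair1 x mH.
  - by move=> u; exact: G0.
  apply: eq_integral => u _; rewrite mul_sym_block_cons /H; congr (G (cV_cons (_, _))).
  have -> : S *m x = C *m x - (dotv b x / p) *: b.
    rewrite /S mulmxBl -scalemxAl -mulmxA.
    by rewrite mulmx_col_row scalerA mulrC.
  rewrite mulrDl (mulrC p) mulfK ?gt_eqF// scalerDl addrACA subrr addr0.
  by [].
rewrite ge0_integralZl//; last 3 first.
- apply: (measurable_fun_fubini_tonelli_G (m1 := @lebesgue_measure R) (fun q => H q.1 q.2)) => //.
  by move=> q; exact: G0.
- by move=> x _; apply: integral_ge0 => u _; exact: G0.
- by rewrite lee_fin invr_ge0 ltW.
rewrite EFinM -muleA; congr (_ * _)%E.
rewrite -(fubini_tonelli (m1 := @lebesgue_measure R) (fun q => H q.1 q.2))//; last first.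
  by move=> q; exact: G0.
rewrite /= integral_cV_cons// -ge0_integralZl//; last 3 first.
- apply: (measurable_fun_fubini_tonelli_F (fun p => G (cV_cons p))) => //.
  by apply: measurableT_comp => //; exact: measurable_cV_cons.
- by move=> u _; apply: integral_ge0.
- by rewrite lee_fin ltW.
apply: eq_integral => u _.
have mGu : measurable_fun setT (fun x : 'cV[R]_n => G (cV_cons (u, x))).
  by apply: measurableT_comp => //; exact: measurable_cV_consr.
rewrite /H (hc (fun y => G (cV_cons (u, (u / p) *: b + y))))//; last first.
  apply: measurableT_comp mGu _; apply: measurable_cVD => //; exact: measurable_cst.
congr (_ * _)%E; under eq_integral do rewrite addrC.
exact: (@integral_cV_translate _ ((u / p) *: b) (fun y => G (cV_cons (u, y)))).
Qed.

Lemma measurable_cV_prod n (g : 'I_n -> R -> R) :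
  (forall i, measurable_fun setT (g i)) ->
  measurable_fun setT (fun x : 'cV[R]_n => (\prod_(i < n) g i (x i ord0))%:E).
Proof.
move=> mg; apply/measurable_EFinP; apply: measurable_prod => i _.
exact: (measurableT_comp (mg i) (measurable_cV_coord i)).
Qed.

Lemma integral_cV_prod_le n (g : 'I_n -> R -> R) (c : 'I_n -> R) :
  (forall i, measurable_fun setT (g i)) -> (forall i x, 0 <= g i x) ->
  (forall i, \int[@lebesgue_measure R]_x (g i x)%:E <= (c i)%:E)%E ->
  (\int[leb n]_x (\prod_(i < n) g i (x i ord0))%:E <= (\prod_(i < n) c i)%:E)%E.
Proof.
elim: n g c => [|n IH] g c mg g0 gc.
  rewrite integral_cV0; first by rewrite !big_ord0.
  exact: measurable_cV_prod.
rewrite integral_cV_cons//; [|exact: measurable_cV_prod|by move=> x; rewrite lee_fin prodr_ge0].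
have c0 : 0 <= \prod_(i < n) c (lift ord0 i).
  apply: prodr_ge0 => i _; rewrite -lee_fin; apply: le_trans (gc _).
  by apply: integral_ge0 => x _; rewrite lee_fin.
apply: (@le_trans _ _ (\int[@lebesgue_measure R]_a ((\prod_(i < n) c (lift ord0 i))%:E * (g ord0 a)%:E))%E).
  apply: ge0_le_integral => //.
  - by move=> a _; apply: integral_ge0 => x _; rewrite lee_fin prodr_ge0.
  - apply: (measurable_fun_fubini_tonelli_F (fun p : measurableTypeR R * 'cV[R]_n => (\prod_(i < n.+1) g i (cV_cons p i ord0))%:E)).
      apply: (measurableT_comp (measurable_cV_prod mg)); exact: measurable_cV_cons.
    by move=> q; rewrite lee_fin prodr_ge0.
  - under eq_fun do rewrite -EFinM; apply/measurable_EFinP.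
  by apply: measurable_funM; [exact: measurable_cst|exact: mg].
  move=> a _.
  under eq_integral.
    move=> x _; rewrite big_ord_recl cV_cons0 EFinM.
    under eq_bigr do rewrite cV_consS.
    over.
  rewrite ge0_integralZl//; last 3 first.
  - exact: (@measurable_cV_prod n (fun i => g (lift ord0 i))).
  - by move=> x _; rewrite lee_fin prodr_ge0.
  - by rewrite lee_fin.
  rewrite muleC lee_wpmul2r ?lee_fin//.
  exact: (IH (fun i => g (lift ord0 i)) (fun i => c (lift ord0 i))).
have E : (\int[@lebesgue_measure R]_a ((\prod_(i < n) c (lift ord0 i))%:E * (g ord0 a)%:E) =
    (\prod_(i < n) c (lift ord0 i))%:E * \int[@lebesgue_measure R]_a (g ord0 a)%:E)%E.
  exact: (integralZl_ge0 (@lebesgue_measure R) c0 (mg ord0) (g0 ord0)).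
rewrite E.
by rewrite big_ord_recl EFinM muleC lee_wpmul2r ?lee_fin.
Qed.

Lemma cintble_cV_cons n (f : 'cV[R]_n.+1 -> R[i]) :
  cintble (leb n.+1) f ->
  cintble (@lebesgue_measure R \x leb n)%E (fun p => f (cV_cons p)).
Proof.
move=> cf; have mf := cintble_meas cf.
apply: cintble_finite; first exact: cmeas_comp (@measurable_cV_cons R n).
have := cintble_cmod cf => /integrableP[_].
under eq_integral do rewrite abse_EFin ger0_norm ?cmod_ge0//.
rewrite integral_cV_cons; last 2 first.
- by apply/measurable_EFinP; exact: cmeas_cmod.
- by move=> x; rewrite lee_fin cmod_ge0.
rewrite fubini_tonelli1//.
- apply/measurable_EFinP/cmeas_cmod.
  exact: cmeas_comp (@measurable_cV_cons R n).
- by move=> x; rewrite lee_fin cmod_ge0.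
Qed.

Lemma cint_cV_cons n (f : 'cV[R]_n.+1 -> R[i]) :
  cintble (leb n.+1) f ->
  cint (leb n.+1) f =
  cint (@lebesgue_measure R \x leb n)%E (fun p => f (cV_cons p)).
Proof.
move=> cf; have mf := cintble_meas cf.
apply: (cint_pushforward (@measurable_cV_cons R n)) => //.
exact: cintble_cV_cons.
Qed.

Lemma cmeas_cV_prod n (E : 'I_n -> R -> R[i]) : (forall i, cmeas (E i)) ->
  cmeas (fun x : 'cV[R]_n => \prod_(i < n) E i (x i ord0)).
Proof.
move=> mE; apply: cmeas_prod => i.
exact: (cmeas_comp (mE i) (measurable_cV_coord i)).
Qed.

Lemma cintble_cV_prod n (E : 'I_n -> R -> R[i]) :
  (forall i, cintble (@lebesgue_measure R) (E i)) ->
  cintble (leb n) (fun x => \prod_(i < n) E i (x i ord0)).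
Proof.
move=> iE; apply: cintble_finite.
  by apply: cmeas_cV_prod => i; exact: cintble_meas (iE i).
under eq_integral do rewrite cmod_prod.
pose c i := fine (\int[@lebesgue_measure R]_x (cmod (E i x))%:E)%E.
apply: le_lt_trans (ltry (\prod_(i < n) c i)).
apply: (@integral_cV_prod_le _ (fun i x => cmod (E i x)) c).
- by move=> i; apply: cmeas_cmod; exact: cintble_meas (iE i).
- by move=> i x; exact: cmod_ge0.
- by move=> i; rewrite /c fineK//; apply: integrable_fin_num => //; exact: cintble_cmod (iE i).
Qed.

Lemma cint_cV_prod n (E : 'I_n -> R -> R[i]) :
  (forall i, cintble (@lebesgue_measure R) (E i)) ->
  cint (leb n) (fun x => \prod_(i < n) E i (x i ord0)) =
  \prod_(i < n) cint (@lebesgue_measure R) (E i).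
Proof.
elim: n E => [|n IH] E iE.
  rewrite big_ord0; under eq_cint do rewrite big_ord0.
  by apply: complex_ext; rewrite /= /Rintegral integral_dirac// diracT mul1e.
have iP := cintble_cV_prod iE.
rewrite cint_cV_cons//.
have iP' : cintble (leb n) (fun x => \prod_(i < n) E (lift ord0 i) (x i ord0)).
  exact: (@cintble_cV_prod n (fun i => E (lift ord0 i))).
have eqE a x : \prod_(i < n.+1) E i (cV_cons (a, x) i ord0) =
    E ord0 a * \prod_(i < n) E (lift ord0 i) (x i ord0).
  rewrite big_ord_recl cV_cons0; congr (_ * _).
  by apply: eq_bigr => i _; rewrite cV_consS.
have sec1 a : cintble (leb n) (fun x => \prod_(i < n.+1) E i (cV_cons (a, x) i ord0)).
  by under eq_fun do rewrite eqE; exact: cintbleZ.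
have sec2 x : cintble (@lebesgue_measure R) (fun a => \prod_(i < n.+1) E i (cV_cons (a, x) i ord0)).
  by under eq_fun do rewrite eqE mulrC; apply: cintbleZ; exact: iE.
have [<- _] := cint_fubini (cintble_cV_cons iP) sec1 sec2.
rewrite big_ord_recl -(IH (fun i => E (lift ord0 i))); last by move=> i; exact: iE.
under eq_cint => a.
  under eq_cint do rewrite eqE.
  rewrite cintZ// mulrC; over.
by rewrite cintZ// mulrC.
Qed.

End lebesgue_vector.

(** * A Phragmen-Lindelof principle for growth along the axes *)

Section complex_differentiability.
Context {R : realType}.
Implicit Types (f : R[i]^o -> R[i]^o) (z h : R[i]).

Lemma nbhs_cmod (z : R[i]) (P : set R[i]^o) (e : R) : 0 < e ->
  (forall y, cmod (y - z) < e -> P y) -> nbhs (z : R[i]^o) P.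
Proof.
move=> e0 H; apply/nbhs_ballP; exists (e%:C)%C => /=; first by rewrite ltcR.
move=> y; rewrite /ball/= => zy; apply: H.
by rewrite -ltcR -normcE distrC.
Qed.

(** Differentiation under the integral sign yields a quadratic remainder, uniform
    in the direction of the increment. *)
Lemma quadratic_derivable f z (D : R[i]) (M : R) :
  (forall h, cmod h <= 1 -> cmod (f (z + h) - f z - h * D) <= M * cmod h ^+ 2) ->
  derivable f z 1.
Proof.
move=> H; apply/cvg_ex; exists D; apply/cvgrPdist_lt => e e0.
have [r re r0] : exists2 r : R, e = (r%:C)%C & 0 < r.
  exists (complex.Re e); last by move: e0; rewrite ltcE => /andP[].
  by apply: complex_ext => //=; move: e0; rewrite ltcE /= => /andP[/eqP].
have M0 : 0 < `|M| + 1 by rewrite ltr_wpDl.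
pose dl := Num.min 1 (r / (`|M| + 1)).
have dl0 : 0 < dl by rewrite lt_min ltr01 divr_gt0.
rewrite /dnbhs /within/=; apply: (@nbhs_cmod _ _ dl) => // h.
rewrite subr0 lt_min => /andP[h1 h2] hn0.
rewrite -![_ *: _]/(_ * _) mulr1 re normcE ltcR addrC.
have hc0 : 0 < cmod h by rewrite lt_neqAle cmod_ge0 eq_sym cmod_eq0 hn0.
have -> : - (h^-1 * (f (h + z) - f z)) + D = - (h^-1 * (f (z + h) - f z - h * D)).
  suff E (a b : R[i]) : - (h^-1 * (a - b)) + D = - (h^-1 * (a - b - h * D)).
    by rewrite (addrC h z); exact: E.
  by field.
rewrite cmodN cmodM cmodV -ltr_pdivlMl ?invr_gt0// invrK.
apply: le_lt_trans (H h (ltW h1)) _.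
rewrite expr2 mulrA [ltRHS]mulrC ltr_pM2r//.
apply: (@le_lt_trans _ _ ((`|M| + 1) * cmod h)).
  by apply: ler_wpM2r; [exact: ltW|apply: le_trans (ler_norm _) _; rewrite lerDl].
by rewrite mulrC -ltr_pdivlMr.
Qed.

Lemma derivable_ccontinuous f : (forall z, derivable f z 1) -> continuous f.
Proof.
by move=> df z; apply: differentiable_continuous; apply/derivable1_diffP.
Qed.

Lemma cexp_quadratic (u : R[i]) : cmod (cexp u - 1 - u) <= cmod u ^+ 2 * expR (cmod u).
Proof.
have := cexp_taylor u 2.
rewrite !big_ord_recl big_ord0 /= !expr0 expr1 addr0 !divr1 opprD addrA => /le_trans; apply.
apply: ler_wpM2r; first exact: expR_ge0.
rewrite ler_pdivrMr ?ltr0n// ler_peMr ?exprn_ge0 ?cmod_ge0//.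
by rewrite ler1n.
Qed.

Lemma derivable_cexp_square (c : R[i]) z :
  derivable (fun s : R[i]^o => cexp (c * s ^+ 2) : R[i]^o) z 1.
Proof.
pose q := cmod c * (2 * cmod z + 1).
have q0 : 0 <= q by rewrite mulr_ge0 ?cmod_ge0// addr_ge0// mulr_ge0 ?cmod_ge0.
apply: (@quadratic_derivable _ _ (2 * c * z * cexp (c * z ^+ 2))
  (cmod (cexp (c * z ^+ 2)) * (q ^+ 2 * expR q + cmod c))) => h h1.
pose u := c * (2 * z * h + h ^+ 2).
have -> : cexp (c * (z + h) ^+ 2) - cexp (c * z ^+ 2) - h * (2 * c * z * cexp (c * z ^+ 2)) =
    cexp (c * z ^+ 2) * (cexp u - 1 - u + c * h ^+ 2).
  have -> : c * (z + h) ^+ 2 = c * z ^+ 2 + u by rewrite /u; ring.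
  by rewrite cexpD /u; ring.
rewrite cmodM -mulrA; apply: ler_wpM2l; first exact: cmod_ge0.
rewrite mulrDl; apply: le_trans (cmodD _ _) _; apply: lerD; last by rewrite cmodM cmodX.
apply: le_trans (cexp_quadratic u) _.
have hu : cmod u <= q * cmod h.
  rewrite /u cmodM /q -[leRHS]mulrA; apply: ler_wpM2l; first exact: cmod_ge0.
  apply: le_trans (cmodD _ _) _; rewrite cmodX !cmodM [leRHS]mulrDl mul1r.
  apply: lerD.
    by rewrite cmod_nat.
  by rewrite expr2 ler_piMr ?cmod_ge0.
have hu2 : cmod u <= q by apply: le_trans hu _; rewrite ler_piMr.
rewrite -mulrA (mulrC (expR q)) mulrA -exprMn; apply: ler_pM.
- by rewrite exprn_ge0 ?cmod_ge0.
- exact: expR_ge0.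
- by rewrite lerXn2r ?nnegrE ?cmod_ge0// mulr_ge0 ?cmod_ge0.
- by rewrite ler_expR.
Qed.

Lemma derivable_comp_scale (c : R[i]) f z : derivable f (c * z) 1 ->
  derivable (fun s : R[i]^o => f (c * s)) z 1.
Proof.
move=> df.
have dg : is_derive (z : R[i]^o) (1 : R[i]^o) (fun s : R[i]^o => c * s : R[i]^o) (c * 1).
  exact: (is_deriveZ c (is_derive_id (z : R[i]^o) (1 : R[i]^o))).
apply/derivable1_diffP; apply: (@differentiable_comp _ _ _ _ (fun s : R[i]^o => c * s : R[i]^o) f).
  by apply/derivable1_diffP; case: dg.
exact/derivable1_diffP.
Qed.

End complex_differentiability.

Section phragmen_lindelof_quadrant.
Context {R : realType}.
Implicit Types (z : R[i]) (tau : R).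

Lemma ltr_atan (x y : R) : (atan x < atan y) = (x < y).
Proof.
by rewrite -[in RHS](atanK x) -[in RHS](atanK y) ltr_tan// in_itv/=
  atan_gtNpi2 atan_ltpi2.
Qed.

Lemma atan_bounds tau : 0 < tau -> 0 < atan tau < pi / 2.
Proof. by move=> t0; rewrite atan_ltpi2 andbT -atan0 ltr_atan. Qed.

Lemma sectorE tau : 0 < tau ->
  sector (2 * atan tau) =
  [set z : R[i]^o | 0 < complex.Re z /\ `|complex.Im z| < tau * complex.Re z].
Proof.
move=> t0; have /andP[at0 at1] := atan_bounds t0.
have E : 2 * atan tau / 2 = atan tau by field.
have pi0 := pi_gt0 R.
apply/seteqP; split=> [z [r [t []]]|z [x0 yx]].
  rewrite E => r0 t1 t2 -> /=.
  have tb : t \in `](- (pi / 2)), (pi / 2)[ by rewrite in_itv/=; apply/andP; split; lra.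
  have c0 : 0 < cos t by apply: cos_gt0_pihalf; move: tb; rewrite in_itv.
  rewrite !mul0r subr0 addr0; split; first by rewrite mulr_gt0.
  rewrite normrM gtr0_norm// mulrCA ltr_pM2l//.
  have -> : sin t = tan t * cos t by rewrite /tan divfK ?gt_eqF.
  rewrite normrM (gtr0_norm c0) ltr_pM2r// ltr_norml; apply/andP; split.
    have e : tan (- atan tau) = - tau by rewrite tanN atanK.
    by rewrite -e ltr_tan// in_itv/=; apply/andP; split; lra.
  by rewrite -{1}(atanK tau) ltr_tan// in_itv/=; apply/andP; split; lra.
pose x := complex.Re z; pose y := complex.Im z.
pose t := atan (y / x).
have c0 : 0 < cos t by apply: cos_gt0_pihalf; rewrite atan_gtNpi2 atan_ltpi2.
exists (x / cos t), t; rewrite E; split.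
- by rewrite divr_gt0.
- rewrite -atanN ltr_atan ltr_pdivlMr// mulNr.
  by move: yx; rewrite ltr_norml => /andP[].
- rewrite ltr_atan ltr_pdivrMr//.
  by move: yx; rewrite ltr_norml => /andP[].
- apply: complex_ext; rewrite /= ?mul0r ?subr0 ?addr0.
    by rewrite divfK ?gt_eqF.
  have -> : sin t = tan t * cos t by rewrite /tan divfK ?gt_eqF.
  have -> : tan t = y / x by rewrite /t atanK.
  by rewrite -/y; field; rewrite (gt_eqF x0) (gt_eqF c0).
Qed.

Lemma boundary_sector tau z : 0 < tau -> boundary (sector (2 * atan tau)) z ->
  0 <= complex.Re z /\ `|complex.Im z| = tau * complex.Re z.
Proof.
move=> t0; rewrite sectorE// => -[clz intz].
have near e : 0 < e -> exists2 y : R[i], 0 < complex.Re y /\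
    `|complex.Im y| < tau * complex.Re y & cmod (y - z) < e.
  move=> e0; have [|y [yS yz]] := clz [set y | cmod (y - z) < e].
    by apply: (@nbhs_cmod _ _ _ e).
  by exists y.
have x0 : 0 <= complex.Re z.
  apply/ler_addgt0Pr => e e0; have [y [y0 _] yz] := near e e0.
  have := le_lt_trans (Re_le_cmod _) yz; rewrite ReD ReN ltr_norml => /andP[]; lra.
have yx : `|complex.Im z| <= tau * complex.Re z.
  apply/ler_addgt0Pr => e e0; have [|y [_ y0] yz] := near (e / (tau + 1)).
    by rewrite divr_gt0// addr_gt0.
  have := le_lt_trans (Re_le_cmod _) yz; have := le_lt_trans (Im_le_cmod _) yz.
  set k := e / _; have ek : e = k * tau + k.
    by rewrite /k; field; rewrite gt_eqF// addr_gt0.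
  rewrite ReD ReN ImD ImN => hi.
  rewrite ltr_norml => /andP[_ hr].
  have h1 : `|complex.Im z| <= `|complex.Im y| + `|complex.Im y - complex.Im z|.
    rewrite -[X in `|X| <= _](subKr (complex.Im y)); exact: ler_normB.
  have h2 : tau * (complex.Re y - complex.Re z) <= tau * k by rewrite ler_pM2l// ltW.
  move: h2; rewrite mulrBr; lra.
split => //; apply/eqP; rewrite eq_le yx/= leNgt; apply/negP => lt1.
apply: intz; rewrite /interior.
have xp : 0 < complex.Re z.
  rewrite lt_neqAle x0 andbT; apply/eqP => e; move: lt1; rewrite -e mulr0.
  by rewrite ltNge normr_ge0.
pose m := Num.min (complex.Re z) ((tau * complex.Re z - `|complex.Im z|) / (tau + 1)).
have tau1 : 0 < tau + 1 by rewrite addr_gt0.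
apply: (@nbhs_cmod _ _ _ m).
  by rewrite lt_min xp divr_gt0// subr_gt0.
move=> y yz; rewrite /=.
have := le_lt_trans (Re_le_cmod _) yz; have := le_lt_trans (Im_le_cmod _) yz.
have m1 : m <= complex.Re z by rewrite /m ge_min lexx.
have m2 : m * (tau + 1) <= tau * complex.Re z - `|complex.Im z|.
  by rewrite -ler_pdivlMr// /m ge_min lexx orbT.
rewrite ReD ReN ImD ImN => hi.
rewrite ltr_norml => /andP[hr _]; split; first lra.
have h1 : `|complex.Im y| <= `|complex.Im z| + `|complex.Im y - complex.Im z|.
  have := ler_normD (complex.Im z) (complex.Im y - complex.Im z).
  by rewrite (_ : complex.Im z + (complex.Im y - complex.Im z) = complex.Im y)//; ring.
have h2 : tau * (- m) < tau * (complex.Re y - complex.Re z) by rewrite ltr_pM2l.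
move: h2; rewrite mulrBr mulrN; lra.
Qed.

Lemma sqr_le_powR (e p : R) : 0 < e -> 2 < p ->
  exists K : R, forall s, 0 <= s -> s ^+ 2 <= e * s `^ p + K.
Proof.
move=> e0 p2; pose s0 := e `^ (- (p - 2)^-1).
have s00 : 0 < s0 by rewrite powR_gt0.
exists (s0 ^+ 2) => s sge0; have [ss0|ss0] := leP s s0.
  apply: (@le_trans _ _ (s0 ^+ 2)); first by rewrite lerXn2r ?nnegrE// ltW.
  by rewrite lerDr mulr_ge0 ?powR_ge0// ltW.
apply: ler_wpDr; first by rewrite exprn_ge0// ltW.
have s1 : 0 < s by exact: lt_trans ss0.
have -> : s `^ p = s ^+ 2 * s `^ (p - 2).
  rewrite -powR_mulrn// -powRD ?(gt_eqF s1) ?implybT//; congr (_ `^ _); ring.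
rewrite mulrCA ler_peMr ?exprn_ge0//.
have : s0 `^ (p - 2) <= s `^ (p - 2).
  by rewrite ge0_ler_powR ?nnegrE ?ltW// subr_gt0.
rewrite /s0 -powRrM mulNr mulVf ?gt_eqF ?subr_gt0// powRN powRr1 ?(ltW e0)// => h.
by rewrite mulrC -ler_pdivrMr// mul1r.
Qed.

Context (w : R -> R) (hw : weight_function w)
  (wsmall : forall e : R, 0 < e -> exists K : R, forall t, 0 <= t -> w t <= e * t ^+ 2 + K).

Let w0 t : 0 <= t -> 0 <= w t. Proof. by case: hw => h _ _; exact: h. Qed.
Let wle s t : 0 <= s -> s <= t -> w s <= w t.
Proof. by case: hw => _ h _; exact: h. Qed.

(** On a ray [|y| = tau x] with [tau] close to [1] the quadratic term is small,
    and a factor [exp (- c z^2)] removes it. The sector between two such rays has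
    an opening below [pi / 2], so order two is admissible growth there and the
    type of [G] is at most [c] inside. Between these rays and the edges of the
    right angle the quadratic term is directly small. Letting [tau] tend to [1]
    leaves minimal type, which is the growth condition in the right angle. *)
Lemma PL_minimal_type (L mu : R) (G : R[i]^o -> R[i]^o) (M : R) :
  1 <= L -> PL_admissible w (pi / 2) L%:E -> 0 < mu -> 0 <= M ->
  (forall z, derivable G z 1) ->
  (forall z, cmod (G z) <= M * expR ((`|complex.Re z| - `|complex.Im z|) ^+ 2 / 2
     + mu * w (cmod z))) ->
  forall e, 0 < e -> exists2 K : R, 0 < K & forall z, sector (pi / 2) z ->
    cmod (G z) <= K * expR (e * cmod z ^+ 2).
Proof.
move=> L1 adm mu0 M0 dG hG e e0.
have L0 : 0 < L by exact: lt_le_trans ltr01 L1.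
have pi0 := pi_gt0 R.
pose tau := 1 - Num.min e (1 / 2).
have mine : Num.min e (1/2) <= e by rewrite ge_min lexx.
have mine2 : Num.min e (1/2) <= 1/2 by rewrite ge_min lexx orbT.
have mine0 : 0 < Num.min e (1/2) by rewrite lt_min e0 divr_gt0.
have t0 : 0 < tau by rewrite /tau; lra.
have t1 : tau < 1 by rewrite /tau; lra.
have te : 1 - tau <= e by rewrite /tau; lra.
(* The Gaussian factor cancels the quadratic growth on [|y| = tau x] exactly. *)
pose c := (1 - tau) / (2 * (1 + tau)).
have c0 : 0 <= c by rewrite divr_ge0//; lra.
have ce : c <= e / 2.
  rewrite /c ler_pdivrMr; last by lra.
  have : e * tau >= 0 by rewrite mulr_ge0// ltW.
  lra.
have ctau : c * (1 - tau ^+ 2) = (1 - tau) ^+ 2 / 2.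
  by rewrite /c; field; lra.
pose rho := 2 * atan tau.
have /andP[rho0 _] := atan_bounds t0.
have rho1 : rho < pi / 2.
  have : atan tau < atan 1 by rewrite ltr_atan.
  by rewrite atan1 /rho; lra.
have rhop : 0 < rho by rewrite /rho; lra.
have [C C0 HC] := adm rho mu rhop (ltW rho1) mu0.
pose H (z : R[i]^o) : R[i]^o := G z * cexp (- (c%:C)%C * z ^+ 2).
have modH z : cmod (H z) =
    cmod (G z) * expR (- c * (complex.Re z ^+ 2 - complex.Im z ^+ 2)).
  rewrite /H cmodM cmod_cexp; congr (_ * expR _).
  by case: z => x y; rewrite expr2 /=; ring.
have dH z : derivable H z 1.
  by apply: derivableM => //; exact: derivable_cexp_square.
have sq z : cmod z ^+ 2 = `|complex.Re z| ^+ 2 + `|complex.Im z| ^+ 2.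
  by rewrite sqr_cmod !real_normK ?num_real.
have p2 : 2 < pi / rho by rewrite ltr_pdivlMr//; lra.
have [K1 hK1] := wsmall (divr_gt0 ltr01 (mulr_gt0 (ltr0n _ 2) mu0)).
have secH e' : 0 < e' -> exists2 K : R, 0 < K & forall z, sector rho z ->
    cmod (H z) <= K * expR (e' * cmod z `^ (pi / rho)).
  move=> e'0; have [K2 hK2] := sqr_le_powR e'0 p2.
  exists ((M + 1) * expR (mu * K1 + K2)) => [|z].
    by rewrite mulr_gt0 ?expR_gt0// ltr_wpDl.
  rewrite /rho sectorE//= => -[x0 yx].
  rewrite modH -mulrA -expRD.
  have le1 : expR (- c * (complex.Re z ^+ 2 - complex.Im z ^+ 2)) <= 1.
    rewrite -expR0 ler_expR mulNr oppr_le0 mulr_ge0// subr_ge0.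
    rewrite -(real_normK (num_real (complex.Im z))) lerXn2r ?nnegrE ?normr_ge0 ?(ltW x0)//.
    by apply: le_trans (ltW yx) _; rewrite ger_pMl// ltW.
  apply: le_trans (_ : cmod (G z) <= _).
    by rewrite ler_piMr ?cmod_ge0.
  apply: le_trans (hG z) _; apply: ler_pM; rewrite ?expR_ge0//; first by rewrite lerDl.
  rewrite ler_expR.
  have h1 : mu * w (cmod z) <= cmod z ^+ 2 / 2 + mu * K1.
    have em : mu * (1 / (2 * mu)) = 1 / 2 by field; rewrite gt_eqF.
    by have := hK1 _ (cmod_ge0 z); rewrite -(ler_pM2l mu0) mulrDr mulrA em; lra.
  have h2 := hK2 _ (cmod_ge0 z).
  have h3 : (`|complex.Re z| - `|complex.Im z|) ^+ 2 <= cmod z ^+ 2.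
    rewrite sq sqrrB lerD2r lerBlDr lerDl mulrn_wge0// mulr_ge0//.
  lra.
have bdH z : boundary (sector rho) z -> cmod (H z) <= M * expR (mu * w (cmod z)).
  move=> /(boundary_sector t0)[x0 yx].
  rewrite modH; apply: le_trans (ler_wpM2r (expR_ge0 _) (hG z)) _.
  rewrite -mulrA -expRD; apply: ler_wpM2l => //; rewrite ler_expR.
  rewrite -(real_normK (num_real (complex.Im z))) yx ger0_norm//.
  have := ctau; set x := complex.Re z => ct.
  have : c * (x ^+ 2 - (tau * x) ^+ 2) = (x - tau * x) ^+ 2 / 2.
    have -> : c * (x ^+ 2 - (tau * x) ^+ 2) = (c * (1 - tau ^+ 2)) * x ^+ 2 by ring.
    by rewrite ct; ring.
  by rewrite mulNr => ->; lra.
have cH : {within closure (sector rho), continuous H}.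
  by apply: continuous_subspaceT; exact: derivable_ccontinuous.
have := HC H M (fun z _ => dH z) cH bdH secH.
have [K3 hK3] := wsmall (divr_gt0 e0 (mulr_gt0 (ltr0n _ 2) (mulr_gt0 L0 mu0))).
have wL z : L * (mu * w (cmod z)) <= e / 2 * cmod z ^+ 2 + L * mu * K3.
  have em : (L * mu) * (e / (2 * (L * mu))) = e / 2 by field; rewrite !gt_eqF.
  by have := hK3 _ (cmod_ge0 z); rewrite -(ler_pM2l (mulr_gt0 L0 mu0)) mulrDr [X in _ <= X + _]mulrA em mulrA.
move=> hin.
exists ((C + 1) * (M + 1) * expR (L * mu * K3)) => [|z].
  by rewrite !mulr_gt0 ?expR_gt0 ?ltr_wpDl// ltW.
have -> : pi / 2 = 2 * atan 1 :> R by rewrite atan1; field.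
rewrite sectorE//= mul1r => -[x0 yx].
rewrite -[leRHS]mulrA -expRD -[leRHS]mulrA.
have [yt|yt] := ltP (`|complex.Im z|) (tau * complex.Re z).
  have zr : sector rho z by rewrite /rho sectorE.
  have := hin z zr; rewrite -EFinM lee_fin modH.
  rewrite -ler_pdivlMr ?expR_gt0// -expRN -!mulrA => /le_trans; apply.
  apply: ler_pM; rewrite ?mulr_ge0 ?expR_ge0 ?(ltW C0)// ?lerDl//.
  rewrite -expRD.
  apply: ler_pM; rewrite ?expR_ge0// ?lerDl// ler_expR.
  have := wL z.
  have : c * (complex.Re z ^+ 2 - complex.Im z ^+ 2) <= e / 2 * cmod z ^+ 2.
    apply: le_trans (_ : c * cmod z ^+ 2 <= _); last by rewrite ler_wpM2r ?exprn_ge0 ?cmod_ge0.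
    by rewrite ler_wpM2l// sqr_cmod lerD2l lerNl; have := sqr_ge0 (complex.Im z); lra.
  rewrite mulNr opprK; lra.
apply: le_trans (hG z) _.
rewrite -[leLHS]mul1r; apply: ler_pM; rewrite ?mulr_ge0 ?expR_ge0//; first by rewrite lerDr ltW.
apply: ler_pM; rewrite ?expR_ge0// ?lerDl// ler_expR.
have := wL z.
have : mu * w (cmod z) <= L * (mu * w (cmod z)).
  by rewrite ler_peMl// mulr_ge0 ?(ltW mu0)// w0 ?cmod_ge0.
have : (`|complex.Re z| - `|complex.Im z|) ^+ 2 <= e * cmod z ^+ 2.
  rewrite (gtr0_norm x0).
  apply: le_trans (_ : ((1 - tau) * complex.Re z) ^+ 2 <= _).
    rewrite lerXn2r ?nnegrE//; first by rewrite subr_ge0 ltW.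
      by rewrite mulr_ge0 ?ltW// subr_gt0.
    by rewrite mulrBl mul1r lerD2l lerN2.
  rewrite exprMn; apply: ler_pM; rewrite ?sqr_ge0//.
    apply: le_trans te; rewrite expr2 ler_piMr//; lra.
  by rewrite sqr_cmod lerDl sqr_ge0.
lra.
Qed.

(** The quadratic term vanishes on the edges of the right angle, and
    [PL_minimal_type] supplies the growth condition inside it. *)
Lemma PL_right_angle (L mu : R) : 1 <= L -> PL_admissible w (pi / 2) L%:E -> 0 < mu ->
  exists2 C : R, 0 < C & forall (G : R[i]^o -> R[i]^o) (M : R), 0 <= M ->
  (forall z, derivable G z 1) ->
  (forall z, cmod (G z) <= M * expR ((`|complex.Re z| - `|complex.Im z|) ^+ 2 / 2
     + mu * w (cmod z))) ->
  forall z, `|complex.Im z| <= complex.Re z ->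
    cmod (G z) <= C * M * expR (L * (mu * w (cmod z))).
Proof.
move=> L1 adm mu0; have pi0 := pi_gt0 R.
have pi20 : 0 < pi / 2 :> R by lra.
have [C C0 HC] := adm (pi / 2) mu pi20 (lexx _) mu0.
exists (C + 1) => [|G M M0 dG hG z yx]; first by rewrite addr_gt0.
have CM : C * M <= (C + 1) * M by rewrite ler_wpM2r// lerDl.
have E : pi / 2 = 2 * atan 1 :> R by rewrite atan1; field.
have x0 : 0 <= complex.Re z by exact: le_trans yx.
have [|] := ltP (`|complex.Im z|) (complex.Re z) => yx'.
  apply: le_trans (ler_wpM2r (expR_ge0 _) CM).
  have := HC G M (fun z _ => dG z); rewrite -lee_fin EFinM; apply.
  - by apply: continuous_subspaceT; exact: derivable_ccontinuous.
  - move=> u; rewrite E => /(boundary_sector ltr01)[u0 uu].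
    apply: le_trans (hG u) _; apply: ler_wpM2l => //; rewrite ler_expR.
    by rewrite uu mul1r ger0_norm// subrr expr0n mul0r add0r.
  - move=> e e0; have [K K0 hK] := PL_minimal_type L1 adm mu0 M0 dG hG e0.
    have -> : pi / (pi / 2) = 2 :> R.
      by rewrite invf_div mulrCA mulfV ?mulr1// gt_eqF.
    exists K => // u /hK.
    by rewrite powR_mulrn ?cmod_ge0.
  - rewrite E sectorE//= mul1r; split => //; exact: le_lt_trans yx'.
have {}yx : `|complex.Im z| = complex.Re z by apply/eqP; rewrite eq_le yx yx'.
apply: le_trans (hG z) _; rewrite yx ger0_norm// subrr expr0n mul0r add0r.
apply: ler_pM; rewrite ?expR_ge0//; first by rewrite ler_peMl// lerDr ltW.
rewrite ler_expR ler_peMl// mulr_ge0 ?(ltW mu0)// w0 ?cmod_ge0//.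
Qed.

Let mulI z : (0 +i* 1)%C * z = (- complex.Im z +i* complex.Re z)%C.
Proof. by case: z => x y; apply: complex_ext; rewrite /=; ring. Qed.

(** A rotation by [pi / 4] carries the first quadrant to the right angle around
    the positive axis and turns the better of the two bounds into that of
    [PL_right_angle]; quarter turns bring the other quadrants to the first. *)
Lemma PL_axes (L mu : R) : 1 <= L -> PL_admissible w (pi / 2) L%:E -> 0 < mu ->
  exists2 C : R, 0 < C & forall (F : R[i]^o -> R[i]^o) (M : R), 0 <= M ->
  (forall z, derivable F z 1) ->
  (forall z, cmod (F z) <= M * expR (complex.Im z ^+ 2 + mu * w `|complex.Re z|)) ->
  (forall z, cmod (F z) <= M * expR (complex.Re z ^+ 2 + mu * w `|complex.Im z|)) ->
  forall z, cmod (F z) <= C * M * expR (L * (mu * w (cmod z))).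
Proof.
move=> L1 adm mu0; have [C C0 HC] := PL_right_angle L1 adm mu0.
exists C => // F M M0.
pose q := (Num.sqrt 2)^-1 : R.
have q2 : q ^+ 2 = 1 / 2 by rewrite exprVn sqr_sqrtr// mul1r.
have q0 : 0 < q by rewrite invr_gt0 sqrtr_gt0.
(* The rotation by [pi / 4]. *)
pose u0 : R[i] := (q +i* q)%C.
have cu0 : cmod u0 = 1.
  apply/eqP; rewrite -(eqrXn2 (n := 2)) ?cmod_ge0// sqr_cmod /= q2 expr1n.
  by apply/eqP; field.
pose hyp (F : R[i]^o -> R[i]^o) := [/\ (forall z, derivable F z 1),
  (forall z, cmod (F z) <= M * expR (complex.Im z ^+ 2 + mu * w `|complex.Re z|)) &
  (forall z, cmod (F z) <= M * expR (complex.Re z ^+ 2 + mu * w `|complex.Im z|))].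
have first F1 : hyp F1 -> forall z, 0 <= complex.Re z -> 0 <= complex.Im z ->
    cmod (F1 z) <= C * M * expR (L * (mu * w (cmod z))).
  move=> [dF1 h1 h2] z zr zi.
  pose G (s : R[i]^o) : R[i]^o := F1 (u0 * s).
  pose s : R[i] := (q * (complex.Re z + complex.Im z) +i* (q * (complex.Im z - complex.Re z)))%C.
  have us : u0 * s = z.
    by apply: complex_ext; rewrite /u0 /s /=;
      [transitivity (2 * q ^+ 2 * complex.Re z)|transitivity (2 * q ^+ 2 * complex.Im z)];
      try ring; rewrite q2; field.
  have cs : cmod s = cmod z by rewrite -us cmodM cu0 mul1r.
  have := HC G M M0; rewrite -cs -{1}us; apply.
  - by move=> t; exact: derivable_comp_scale.
  - move=> t; have ct : cmod (u0 * t) = cmod t by rewrite cmodM cu0 mul1r.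
    have wr : w `|complex.Re (u0 * t)| <= w (cmod t).
      by rewrite -ct; apply: wle => //; exact: Re_le_cmod.
    have wi : w `|complex.Im (u0 * t)| <= w (cmod t).
      by rewrite -ct; apply: wle => //; exact: Im_le_cmod.
    set x := complex.Re t; set y := complex.Im t.
    have er : complex.Re (u0 * t) ^+ 2 = (x - y) ^+ 2 / 2.
      by rewrite ReM /= -mulrBr exprMn q2; field.
    have ei : complex.Im (u0 * t) ^+ 2 = (x + y) ^+ 2 / 2.
      by rewrite ImM /= -mulrDr exprMn q2 (addrC (complex.Im t)); field.
    have [xy|xy] := leP 0 (x * y).
      apply: le_trans (h2 _) _; apply: ler_wpM2l => //; rewrite ler_expR er.
      apply: lerD; last by rewrite ler_pM2l.
      rewrite !sqrrB -normrM (ger0_norm xy) !real_normK ?num_real//.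
    apply: le_trans (h1 _) _; apply: ler_wpM2l => //; rewrite ler_expR ei.
    apply: lerD; last by rewrite ler_pM2l.
    rewrite sqrrB sqrrD -normrM (ltr0_norm xy) !real_normK ?num_real// mulNrn opprK//.
  - rewrite /s /= normrM (gtr0_norm q0) ler_pM2l// ler_norml; apply/andP; split; lra.
have rot F1 : hyp F1 -> hyp (fun s : R[i]^o => F1 ((0 +i* 1)%C * s)).
  move=> [dF1 h1 h2]; split.
  - by move=> t; exact: derivable_comp_scale.
  - by move=> t; have := h2 ((0 +i* 1)%C * t); rewrite mulI /= sqrrN.
  - by move=> t; have := h1 ((0 +i* 1)%C * t); rewrite mulI /= normrN.
have second F1 : hyp F1 -> forall z, 0 <= complex.Im z ->
    cmod (F1 z) <= C * M * expR (L * (mu * w (cmod z))).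
  move=> hF1 z zi; have [zr|/ltW zr] := leP 0 (complex.Re z); first exact: first.
  pose z1 : R[i] := (complex.Im z +i* - complex.Re z)%C.
  have e : (0 +i* 1)%C * z1 = z by rewrite mulI; apply: complex_ext => //=; rewrite opprK.
  have cz : cmod z1 = cmod z.
    by rewrite -e cmodM /cmod /= expr0n expr1n add0r sqrtr1 mul1r.
  have := first _ (rot _ hF1) z1 zi; cbv beta; rewrite e cz; apply.
  by rewrite oppr_ge0.
move=> dF h1 h2 z; have hF : hyp F by split.
have [zi|/ltW zi] := leP 0 (complex.Im z); first exact: second.
have := second _ (rot _ (rot _ hF)) (- z); cbv beta.
have -> : (0 +i* 1)%C * ((0 +i* 1)%C * - z) = z.
  by rewrite !mulI; apply: complex_ext; rewrite /= ?ReN ?ImN opprK.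
by rewrite cmodN; apply; rewrite ImN oppr_ge0.
Qed.

End phragmen_lindelof_quadrant.

(** * The Gaussian kernel *)

Section gaussian_kernel.
Context {R : realType}.
Local Notation leb := (@lebesgue_measure R).
Implicit Types (z h : R[i]) (x y : R).

(** The generating function of the Hermite functions, up to normalisation. The
    transform with this kernel is a form of the Bargmann transform. *)
Definition gker (z : R[i]) (x : R) : R[i] :=
  cexp (- z ^+ 2 + 2 * z * (x%:C)%C - ((x ^+ 2 / 2)%:C)%C).

Lemma Re_gker_exponent z x :
  complex.Re (- z ^+ 2 + 2 * z * (x%:C)%C - ((x ^+ 2 / 2)%:C)%C) =
  complex.Im z ^+ 2 - complex.Re z ^+ 2 + 2 * complex.Re z * x - x ^+ 2 / 2.
Proof.
have -> : (2 : R[i]) = ((2 : R)%:C)%C by rewrite (rmorph_nat (real_complex R)).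
by case: z => a b; rewrite expr2 /=; ring.
Qed.

Lemma cmod_gker z x : cmod (gker z x) =
  expR (cmod z ^+ 2) * expR (- (x - 2 * complex.Re z) ^+ 2 / 2).
Proof.
rewrite /gker cmod_cexp Re_gker_exponent sqr_cmod -expRD; congr expR.
by field.
Qed.

Lemma cmod_gker_le z x : cmod (gker z x) <= expR (cmod z ^+ 2).
Proof.
rewrite cmod_gker ler_piMr ?expR_ge0// -expR0 ler_expR mulNr oppr_le0.
by rewrite mulr_ge0// sqr_ge0.
Qed.

Lemma cmeas_gker d (T : measurableType d) (y : T -> R) z :
  measurable_fun setT y -> cmeas (fun t => gker z (y t)).
Proof.
move=> my; apply: cmeas_cexp; apply: cmeasD.
  apply: cmeasD; first exact: cmeas_cst.
  by apply: cmeasM; [exact: cmeas_cst|exact: cmeas_real].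
apply: cmeasN; apply: cmeas_real.
by apply: measurable_funM => //; exact: measurable_funX.
Qed.

Lemma measurable_gauss (m : R) :
  measurable_fun setT (fun x : R => expR (- (x - m) ^+ 2 / 2)).
Proof.
apply: measurableT_comp => //; apply: measurable_funM => //.
apply: measurableT_comp => //; apply: measurable_funX.
exact: measurable_funB.
Qed.

Lemma integral_gauss (m : R) :
  (\int[leb]_x (expR (- (x - m) ^+ 2 / 2))%:E = (Num.sqrt (2 * pi))%:E)%E.
Proof.
have s0 : 0 < Num.sqrt (2 * pi) :> R by rewrite sqrtr_gt0 mulr_gt0// pi_gt0.
have := integral_normal_pdf m (1 : R).
have -> : (fun x => (normal_pdf m 1 x)%:E) = (fun x : R =>
   ((Num.sqrt (2 * pi))^-1%:E * (expR (- (x - m) ^+ 2 / 2))%:E)%E).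
  apply/funext => x; rewrite normal_pdfE ?oner_eq0//.
  rewrite -[X in X%:E]/((Num.sqrt (1 ^+ 2 * pi *+ 2))^-1 *
    expR (- (x - m) ^+ 2 / (1 ^+ 2 *+ 2))).
  by rewrite expr1n mul1r mulr_natl EFinM.
have s0' : 0 <= (Num.sqrt (2 * pi))^-1 :> R by rewrite invr_ge0 ltW.
have E : (\int[leb]_x ((Num.sqrt (2 * pi))^-1%:E * (expR (- (x - m) ^+ 2 / 2))%:E) =
  (Num.sqrt (2 * pi))^-1%:E * \int[leb]_x (expR (- (x - m) ^+ 2 / 2))%:E)%E.
  exact: (integralZl_ge0 leb s0' (measurable_gauss m) (fun x => expR_ge0 _)).
rewrite E.
move=> /(congr1 (fun t => (Num.sqrt (2 * pi))%:E * t)%E).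
by rewrite muleA -EFinM divff ?gt_eqF// mul1e mule1.
Qed.

Lemma integral_cmod_gker z :
  (\int[leb]_x (cmod (gker z x))%:E =
   (Num.sqrt (2 * pi) * expR (cmod z ^+ 2))%:E)%E.
Proof.
under eq_integral do rewrite cmod_gker EFinM.
apply: etrans (integralZl_ge0 leb (expR_ge0 _) (measurable_gauss _) (fun x => expR_ge0 _)) _.
by rewrite integral_gauss muleC.
Qed.

Lemma cintble_gker z : cintble leb (gker z).
Proof.
apply: cintble_finite; first exact: (@cmeas_gker _ _ id).
by rewrite integral_cmod_gker ltry.
Qed.

Definition gker_bound z : R :=
  5 * expR (cmod z ^+ 2 + (2 * cmod z + 4) ^+ 2 / 2 + 4 * cmod z + 2).

(** The decay of the kernel beats, uniformly in [x], all factors that two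
    differentiations in [z] can produce. *)
Lemma gker_growth z x : 5 * (cmod (gker z x) *
   expR (2 * (2 * `|x| + 2 * cmod z + 1))) <= gker_bound z.
Proof.
rewrite ler_pM2l// /gker cmod_cexp Re_gker_exponent -expRD ler_expR sqr_cmod.
set a := complex.Re z; set b := complex.Im z; set r := cmod z.
have ar : `|a| <= r by exact: Re_le_cmod.
have h1 : a * x <= r * `|x|.
  apply: le_trans (ler_norm _) _; rewrite normrM; exact: ler_wpM2r.
have h2 : (2 * r + 4) * `|x| <= (2 * r + 4) ^+ 2 / 2 + x ^+ 2 / 2.
  have := sqr_ge0 ((2 * r + 4) - `|x|); rewrite sqrrB real_normK ?num_real//.
  lra.
have := sqr_ge0 a; nra.
Qed.

Lemma sqr_expR_bound (q : R) : 0 <= q -> q ^+ 2 * expR q + 1 <= 5 * expR (2 * q).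
Proof.
move=> q0.
have h : q ^+ 2 <= 4 * expR q.
  have h1 : q / 2 <= expR (q / 2).
    by apply: le_trans (expR_ge1Dx _); rewrite lerDr.
  have -> : expR q = expR (q / 2) ^+ 2.
    by rewrite expr2 -expRD; congr expR; field.
  have -> : q ^+ 2 = 4 * (q / 2) ^+ 2 by field.
  by rewrite ler_pM2l// lerXn2r ?nnegrE ?divr_ge0 ?expR_ge0.
have e1 : 1 <= expR (2 * q) by rewrite -expR0 ler_expR mulr_ge0.
have -> : 5 * expR (2 * q) = 4 * expR q * expR q + expR (2 * q).
  by rewrite -mulrA -expRD (_ : q + q = 2 * q); ring.
by apply: lerD => //; apply: ler_wpM2r => //; exact: expR_ge0.
Qed.

Lemma gker_deriv_bound z x :
  cmod ((2 * (x%:C)%C - 2 * z) * gker z x) <= gker_bound z.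
Proof.
set q := 2 * `|x| + 2 * cmod z + 1.
have q0 : 0 <= q by rewrite /q !addr_ge0// mulr_ge0// cmod_ge0.
apply: le_trans (gker_growth z x); rewrite cmodM -/q mulrC mulrCA.
apply: ler_wpM2l; first exact: cmod_ge0.
apply: le_trans (cmodB _ _) _; rewrite !cmodM cmod_nat cmod_real.
apply: (@le_trans _ _ (expR q)).
  by apply: le_trans (expR_ge1Dx _); rewrite /q; lra.
have : expR q <= expR (2 * q) by rewrite ler_expR; lra.
have := expR_ge0 (2 * q); lra.
Qed.

(** Uniformity in [x] is what differentiation under the integral requires. *)
Lemma gker_quadratic z h x : cmod h <= 1 ->
  cmod (gker (z + h) x - gker z x - h * ((2 * (x%:C)%C - 2 * z) * gker z x)) <=
    gker_bound z * cmod h ^+ 2.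
Proof.
move=> h1; set q := 2 * `|x| + 2 * cmod z + 1.
have q0 : 0 <= q by rewrite /q !addr_ge0// mulr_ge0// cmod_ge0.
pose u := h * (2 * (x%:C)%C - 2 * z - h).
have -> : gker (z + h) x = gker z x * cexp u.
  by rewrite /gker -cexpD; congr cexp; rewrite /u; ring.
have -> : gker z x * cexp u - gker z x - h * ((2 * (x%:C)%C - 2 * z) * gker z x) =
    gker z x * ((cexp u - 1 - u) - h ^+ 2).
  by rewrite /u; ring.
rewrite cmodM.
have hu : cmod u <= q * cmod h.
  rewrite /u cmodM mulrC; apply: ler_wpM2r; first exact: cmod_ge0.
  apply: le_trans (cmodB _ _) _; apply: lerD => //.
  by apply: le_trans (cmodB _ _) _; rewrite !cmodM cmod_nat cmod_real.
have hu2 : cmod u <= q by apply: le_trans hu _; rewrite ler_piMr.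
apply: (@le_trans _ _ (cmod (gker z x) * ((q ^+ 2 * expR q + 1) * cmod h ^+ 2))).
  apply: ler_wpM2l; first exact: cmod_ge0.
  apply: le_trans (cmodB _ _) _; rewrite mulrDl mul1r cmodX; apply: lerD => //.
  apply: le_trans (cexp_quadratic u) _.
  rewrite -mulrA (mulrC (expR q)) mulrA -exprMn; apply: ler_pM.
  - by rewrite exprn_ge0 ?cmod_ge0.
  - exact: expR_ge0.
  - by rewrite lerXn2r ?nnegrE ?cmod_ge0// mulr_ge0 ?cmod_ge0.
  - by rewrite ler_expR.
rewrite mulrA; apply: ler_wpM2r; first by rewrite exprn_ge0 ?cmod_ge0.
apply: le_trans (gker_growth z x); rewrite mulrCA; apply: ler_wpM2l; first exact: cmod_ge0.
exact: sqr_expR_bound.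
Qed.

Section transform.
Context d (T : measurableType d) (mu : {measure set T -> \bar R}).
Context (g : T -> R[i]) (y : T -> R).
Hypotheses (ig : cintble mu g) (my : measurable_fun setT y).

Definition gker_transform z := cint mu (fun t => g t * gker z (y t)).

Lemma cintble_gker_transform z : cintble mu (fun t => g t * gker z (y t)).
Proof.
apply: (cintble_mulb ig (cmeas_gker z my)) => t.
exact: cmod_gker_le.
Qed.

Lemma gker_transform_quadratic z : exists D M, forall h, cmod h <= 1 ->
  cmod (gker_transform (z + h) - gker_transform z - h * D) <= M * cmod h ^+ 2.
Proof.
pose k t := (2 * ((y t)%:C)%C - 2 * z) * gker z (y t).
have mk : cmeas k.
  apply: cmeasM; last exact: cmeas_gker.
  apply: cmeasD; last exact: cmeas_cst.
  by apply: cmeasM; [exact: cmeas_cst|exact: cmeas_real].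
have ik : cintble mu (fun t => g t * k t).
  by apply: (cintble_mulb ig mk) => t; exact: gker_deriv_bound.
exists (cint mu (fun t => g t * k t)).
exists (2 * (fine (\int[mu]_t (cmod (g t))%:E)%E * gker_bound z)) => h h1.
pose E t := gker (z + h) (y t) - gker z (y t) - h * k t.
have mE : cmeas E.
  apply: cmeasD; last by apply: cmeasN; apply: cmeasM => //; exact: cmeas_cst.
  by apply: cmeasD; [exact: cmeas_gker|apply: cmeasN; exact: cmeas_gker].
have Eb t : cmod (E t) <= gker_bound z * cmod h ^+ 2 by exact: gker_quadratic.
have iE : cintble mu (fun t => g t * E t) by exact: cintble_mulb Eb.
have -> : gker_transform (z + h) - gker_transform z -
    h * cint mu (fun t => g t * k t) = cint mu (fun t => g t * E t).
  have i1 := cintble_gker_transform z.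
  have i2 : cintble mu (fun t => h * (g t * k t)) by exact: cintbleZ.
  have -> : gker_transform (z + h) = cint mu (fun t => g t * E t) +
      (gker_transform z + h * cint mu (fun t => g t * k t)).
    rewrite /gker_transform -cintZ// -!cintD//; last exact: cintbleD.
    by apply: eq_cint => t; rewrite /E; ring.
  ring.
rewrite -lee_fin; apply: le_trans (cint_bound iE) _.
rewrite -mulrA EFinM; apply: lee_wpmul2l => //.
have fin : (\int[mu]_t (cmod (g t))%:E)%E \is a fin_num.
  exact/integrable_fin_num/cintble_cmod.
rewrite -mulrA EFinM fineK// muleC.
have gb0 : 0 <= gker_bound z * cmod h ^+ 2.
  by rewrite mulr_ge0 ?exprn_ge0 ?cmod_ge0// mulr_ge0// expR_ge0.
have EZ : (\int[mu]_t ((gker_bound z * cmod h ^+ 2)%:E * (cmod (g t))%:E) =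
    (gker_bound z * cmod h ^+ 2)%:E * \int[mu]_t (cmod (g t))%:E)%E.
  exact: (integralZl_ge0 _ gb0 (cmeas_cmod (cintble_meas ig)) (fun t => cmod_ge0 (g t))).
rewrite -EZ.
apply: ge0_le_integral => //.
- by move=> t _; rewrite lee_fin cmod_ge0.
- by apply/measurable_EFinP/cmeas_cmod; exact: cintble_meas iE.
- apply/measurable_EFinP; apply: measurable_funM => //.
  by apply: cmeas_cmod; exact: cintble_meas ig.
move=> t _; rewrite lee_fin cmodM mulrC; apply: ler_wpM2r => //.
exact: cmod_ge0.
Qed.

Lemma derivable_gker_transform z :
  derivable (gker_transform : R[i]^o -> R[i]^o) z 1.
Proof.
have [D [M H]] := gker_transform_quadratic z.
exact: quadratic_derivable H.
Qed.

End transform.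

End gaussian_kernel.

(** * Gaussian integrals with complex centre *)

Section gaussian_fourier.
Context {R : realType}.
Local Notation leb := (@lebesgue_measure R).
Implicit Types (z : R[i]) (x y : R).

Lemma quadratic_is_derive0 (f : R -> R) (t M : R) :
  (forall h : R, `|h| <= 1 -> `|f (t + h) - f t| <= M * h ^+ 2) ->
  is_derive t (1 : R) f 0.
Proof.
move=> H.
suff cv : (fun h : R => h^-1 *: ((f \o shift t) (h *: (1 : R)) - f t)) @ 0^' --> (0 : R).
  by apply: DeriveDef; [exact: cvgP cv|exact: cvg_lim cv].
apply/cvgrPdist_lt => e e0.
have M0 : 0 < `|M| + 1 by rewrite ltr_wpDl.
pose dl := Num.min 1 (e / (`|M| + 1)).
have dl0 : 0 < dl by rewrite lt_min ltr01 divr_gt0.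
rewrite /dnbhs /within/=; apply/nbhs_ballP; exists dl => //= h.
rewrite /ball/= sub0r normrN lt_min => /andP[h1 h2] hn0.
rewrite sub0r normrN normrM -![_ *: _]/(_ * _) mulr1 normfV.
have hp : 0 < `|h| by rewrite normr_gt0.
rewrite -ltr_pdivlMl ?invr_gt0// invrK.
rewrite (addrC h); apply: le_lt_trans (H h (ltW h1)) _.
rewrite -(real_normK (num_real h)) expr2 mulrA [ltRHS]mulrC ltr_pM2r//.
apply: (@le_lt_trans _ _ ((`|M| + 1) * `|h|)).
  by apply: ler_wpM2r => //; apply: le_trans (ler_norm _) _; rewrite lerDl.
by rewrite mulrC -ltr_pdivlMr.
Qed.

Lemma lebesgue_translate (b : R) (A : set (measurableTypeR R)) : measurable A ->
  leb A = pushforward leb (fun x : measurableTypeR R => x + b : measurableTypeR R) A.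
Proof.
move=> mA.
have mphi : measurable_fun setT (fun x : measurableTypeR R => x + b : measurableTypeR R).
  exact: measurable_funD.
have indA : (\int[leb]_x (\1_A x)%:E = leb A)%E by rewrite integral_indic// setIT.
have mpA : measurable ((fun x : measurableTypeR R => x + b : measurableTypeR R) @^-1` A).
  by rewrite -[X in measurable X]setTI; exact: mphi.
pose phi (x : measurableTypeR R) : measurableTypeR R := x + b.
have indP : (\int[leb]_x (\1_A (phi x))%:E = pushforward leb phi A)%E.
  by rewrite /pushforward -[in RHS](setIT (_ @^-1` _)) -integral_indic.
rewrite -indA -indP.
have := @lebesgue_affine R 1 b ltr01 (fun x => (\1_A x)%:E).
rewrite invr1 mul1e => <-.
- by apply: eq_integral => x _; rewrite /phi mul1r.
- by apply/measurable_EFinP; exact: measurable_indic.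
- by move=> x; rewrite lee_fin.
Qed.

Lemma cint_translate (b : R) (f : R -> R[i]) : cintble leb (fun x => f (x + b)) ->
  cmeas f -> cint leb (fun x => f (x + b)) = cint leb f.
Proof.
move=> cf mf; apply/esym.
apply: (cint_pushforward (phi := fun x : measurableTypeR R => x + b : measurableTypeR R)) => //.
  exact: measurable_funD.
by move=> X mX; exact: lebesgue_translate.
Qed.

Let s2 : R := Num.sqrt 2.
Let s20 : s2 != 0. Proof. by rewrite gt_eqF// sqrtr_gt0. Qed.
Let s2s : s2 ^+ 2 = 2. Proof. by rewrite sqr_sqrtr. Qed.

Definition cgauss (u : R[i]) (x : R) : R[i] := cexp (- ((x%:C)%C - u) ^+ 2 / 2).

(** Splitting off an integrable factor presents the Gaussian as a kernel, so that
    its integral is an entire function of the centre. *)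
Lemma cgauss_gker (z : R[i]) (x : R) :
  ((expR (- x ^+ 2 / 4))%:C)%C * gker z (x / s2) = cgauss ((s2%:C)%C * z) x.
Proof.
rewrite /gker /cgauss.
have -> : ((expR (- x ^+ 2 / 4))%:C)%C = cexp ((- x ^+ 2 / 4)%:C)%C.
  by apply: complex_ext; rewrite /= ?cos0 ?sin0 ?mulr1 ?mulr0.
rewrite -cexpD; congr cexp.
have e2 : ((s2%:C)%C : R[i]) ^+ 2 = 2 by rewrite -rmorphXn/= s2s (rmorph_nat (real_complex R)).
have eX : ((- x ^+ 2 / 4)%:C)%C = - ((x%:C)%C) ^+ 2 / 4 :> R[i].
  by rewrite rmorphM rmorphN rmorphXn fmorphV/= (rmorph_nat (real_complex R)).
have eX2 : (((x / s2) ^+ 2 / 2)%:C)%C = ((x%:C)%C) ^+ 2 / 4 :> R[i].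
  rewrite exprMn exprVn s2s -mulrA -invfM -natrM.
  by rewrite rmorphM rmorphXn fmorphV/= (rmorph_nat (real_complex R)).
have eX1 : ((x / s2)%:C)%C = (x%:C)%C / (s2%:C)%C :> R[i].
  by rewrite rmorphM fmorphV.
rewrite eX eX2 eX1.
have nz : ((s2%:C)%C : R[i]) != 0 by rewrite (fmorph_eq0 (real_complex R)).
move: nz e2; set r := (s2%:C)%C; set X := (x%:C)%C => nz e2.
have -> : 2 * z * (X / r) = r * z * X.
  by rewrite -e2; field.
by rewrite sqrrB exprMn e2; field.
Qed.

Let gauss4_int : cintble leb (fun x => ((expR (- x ^+ 2 / 4))%:C)%C).
Proof.
apply: cintble_finite.
  apply: cmeas_real; apply: measurableT_comp => //; apply: measurable_funM => //.
  by apply: measurableT_comp => //; exact: measurable_funX.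
have -> : (fun x : R => (cmod ((expR (- x ^+ 2 / 4))%:C)%C)%:E) =
    (fun x : R => (expR (- ((s2^-1 * x + 0) - 0) ^+ 2 / 2))%:E).
  apply/funext => x; rewrite cmod_real ger0_norm ?expR_ge0//; congr ((expR _)%:E).
  by rewrite subr0 addr0 exprMn exprVn s2s; field.
have s2p : 0 < s2^-1 by rewrite invr_gt0 sqrtr_gt0.
rewrite (@lebesgue_affine R s2^-1 0 s2p (fun x => (expR (- (x - 0) ^+ 2 / 2))%:E)).
- by rewrite integral_gauss -EFinM ltry.
- by apply/measurable_EFinP; exact: measurable_gauss.
- by move=> x; rewrite lee_fin expR_ge0.
Qed.

Let Phi : R[i] -> R[i] :=
  gker_transform leb (fun x => ((expR (- x ^+ 2 / 4))%:C)%C) (fun x => x / s2).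

Let mdiv : measurable_fun setT (fun x : R => x / s2).
Proof. exact: measurable_funM. Qed.

Let PhiE z : Phi z = cint leb (cgauss ((s2%:C)%C * z)).
Proof. by apply: eq_cint => x; exact: cgauss_gker. Qed.

Lemma cintble_cgauss u : cintble leb (cgauss u).
Proof.
have E : cgauss u = (fun x : R => ((expR (- x ^+ 2 / 4))%:C)%C *
    gker (((s2^-1)%:C)%C * u) (x / s2)).
  apply/funext => x; rewrite cgauss_gker mulrA.
  have -> : (s2%:C)%C * (s2^-1%:C)%C = 1 :> R[i] by rewrite -rmorphM/= divff.
  by rewrite mul1r.
rewrite E; exact: (cintble_gker_transform gauss4_int mdiv).
Qed.

Let Phi_translate z (t : R) : Phi (z + (t%:C)%C) = Phi z.
Proof.
rewrite !PhiE -(@cint_translate (- (s2 * t)) (cgauss ((s2%:C)%C * z))).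
- apply: eq_cint => x; rewrite /cgauss; congr cexp; rewrite rmorphB rmorphM/=.
  by congr (- _ ^+ 2 / 2); ring.
- have -> : (fun x => cgauss ((s2%:C)%C * z) (x - s2 * t)) =
    cgauss ((s2%:C)%C * (z + (t%:C)%C)).
    apply/funext => x; rewrite /cgauss; congr cexp; rewrite rmorphB rmorphM/=.
    by congr (- _ ^+ 2 / 2); ring.
  exact: cintble_cgauss.
- exact: cintble_meas (cintble_cgauss _).
Qed.

(** Invariance under real translations makes the complex derivative of the
    integral vanish, so the centre can be moved to [0]. *)
Lemma cint_cgauss u : cint leb (cgauss u) = ((Num.sqrt (2 * pi))%:C)%C.
Proof.
have flat z : exists M, forall h, cmod h <= 1 -> cmod (Phi (z + h) - Phi z) <= M * cmod h ^+ 2.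
  have [D [M H]] := gker_transform_quadratic gauss4_int mdiv z.
  exists M => h h1; suff D0 : D = 0 by have := H h h1; rewrite D0 mulr0 subr0.
  apply/eqP; rewrite -cmod_eq0 eq_le cmod_ge0 andbT leNgt; apply/negP => D0.
  have M1 : 0 < `|M| + 1 by rewrite ltr_wpDl.
  pose t := Num.min 1 (cmod D / 2 / (`|M| + 1)).
  have t0 : 0 < t by rewrite lt_min ltr01 !divr_gt0.
  have t1 : t <= 1 by rewrite /t ge_min lexx.
  have t2 : t * (`|M| + 1) <= cmod D / 2 by rewrite -ler_pdivlMr// /t ge_min lexx orbT.
  have := H (t%:C)%C; rewrite cmod_real gtr0_norm// => /(_ t1).
  rewrite -/(Phi _) -/(Phi z) Phi_translate subrr sub0r cmodN cmodM cmod_real gtr0_norm//.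
  rewrite expr2 mulrA mulrC ler_pM2r// => h2.
  have : M * t <= t * (`|M| + 1).
    by rewrite mulrC ler_pM2l//; apply: le_trans (ler_norm _) _; rewrite lerDl.
  lra.
have vert (p : R[i] -> R) (hp : forall z z', `|p z - p z'| <= cmod (z - z')) (t : R) :
    p (Phi (0 +i* t)%C) = p (Phi 0).
  have := @is_derive_0_is_cst R (fun t => p (Phi (0 +i* t)%C)) t 0; apply=> {}t.
  have [M HM] := flat (0 +i* t)%C; apply: (@quadratic_is_derive0 _ _ M) => h h1.
  have ch : cmod (0 +i* h)%C = `|h| by rewrite /cmod /= expr0n add0r sqrtr_sqr.
  have := HM (0 +i* h)%C; rewrite ch => /(_ h1); rewrite real_normK ?num_real//.
  apply: le_trans; apply: le_trans (hp _ _) _.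
  by rewrite (_ : ((0 +i* t) + (0 +i* h))%C = (0 +i* (t + h))%C)//; apply: complex_ext; rewrite /= ?addr0.
have const z : Phi z = Phi 0.
  have -> : z = (0 +i* complex.Im z)%C + ((complex.Re z)%:C)%C.
    by case: z => a b; apply: complex_ext; rewrite /= ?add0r ?addr0.
  rewrite Phi_translate; apply: complex_ext.
    by apply: (vert (@complex.Re R)) => a b; rewrite -ReN -ReD; exact: Re_le_cmod.
  by apply: (vert (@complex.Im R)) => a b; rewrite -ImN -ImD; exact: Im_le_cmod.
have <- : Phi 0 = ((Num.sqrt (2 * pi))%:C)%C.
  rewrite PhiE mulr0.
  have E x : cgauss 0 x = ((expR (- (x - 0) ^+ 2 / 2))%:C)%C.
    rewrite /cgauss subr0 -[X in cexp (- X ^+ 2 / _)]/((x%:C)%C).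
    have -> : - ((x%:C)%C) ^+ 2 / 2 = ((- x ^+ 2 / 2)%:C)%C :> R[i].
      by rewrite rmorphM rmorphN rmorphXn fmorphV/= (rmorph_nat (real_complex R)).
    by apply: complex_ext; rewrite /= ?cos0 ?sin0 ?mulr1 ?mulr0 ?subr0.
  rewrite (eq_cint leb E); apply: complex_ext; rewrite /= /Rintegral.
    by rewrite integral_gauss.
  by rewrite integral0.
rewrite -(const (((s2^-1)%:C)%C * u)) PhiE mulrA.
have -> : (s2%:C)%C * (s2^-1%:C)%C = 1 :> R[i] by rewrite -rmorphM/= divff.
by rewrite mul1r.
Qed.

Let fourier_exponent (J X Y z : R[i]) : J ^+ 2 = -1 ->
  - (J * z) ^+ 2 + 2 * (J * z) * X - X ^+ 2 / 2 - J * (X * Y) =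
  - z ^+ 2 + 2 * z * Y - Y ^+ 2 / 2 + - (X - J * (2 * z - Y)) ^+ 2 / 2.
Proof.
move=> J2; rewrite sqrrB !exprMn J2.
by field.
Qed.

Lemma cexpiE (t : R) : cexpi t = cexp (0 +i* t)%C.
Proof. by rewrite /cexp /= expR0 !mul1r. Qed.

(** Completing the square: up to a quarter turn of its parameter, the kernel is
    its own Fourier transform. *)
Lemma fourier_gker (z : R[i]) (y : R) :
  cint leb (fun x => gker ((0 +i* 1)%C * z) x * cexpi (- (x * y))) =
  ((Num.sqrt (2 * pi))%:C)%C * gker z y.
Proof.
pose I : R[i] := (0 +i* 1)%C.
have I2 : I ^+ 2 = -1 by apply: complex_ext; rewrite expr2 /=; ring.
pose u : R[i] := I * (2 * z - (y%:C)%C).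
have E x : gker (I * z) x * cexpi (- (x * y)) = gker z y * cgauss u x.
  rewrite cexpiE /gker /cgauss -!cexpD; congr cexp.
  have -> : (0 +i* - (x * y))%C = - (I * ((x%:C)%C * (y%:C)%C)).
    by apply: complex_ext; rewrite /=; ring.
  rewrite !(rmorphM, rmorphXn, fmorphV)/= (rmorph_nat (real_complex R)).
  by rewrite -!expr2 /u; exact: fourier_exponent.
under eq_cint do rewrite E.
by rewrite cintZ ?cint_cgauss 1?mulrC//; exact: cintble_cgauss.
Qed.

End gaussian_fourier.

(** * Hermite functions as Taylor coefficients of the kernel *)

Section hermite_polynomials.
Context {R : realType}.
Implicit Types (x t : R) (n N : nat).

(** The Hermite polynomials orthogonal for the weight [exp (- t^2)], produced by
    Rodrigues' formula. *)
Fixpoint hpoly n : {poly R} :=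
  if n is m.+1 then 2%:P * 'X * hpoly m - (hpoly m)^`() else 1.

Lemma deriv_hpoly n : (hpoly n.+1)^`() = (2 * n.+1%:R)%:P * hpoly n.
Proof.
elim: n => [|n IH].
  by rewrite /= mulr1 -polyC1 derivC subr0 derivM derivC mul0r add0r derivX !mulr1.
rewrite [hpoly n.+2]/= derivB derivM IH derivM derivC mul0r add0r derivX mulr1.
rewrite derivM derivC mul0r add0r.
have -> : (2 * n.+2%:R)%:P = (2 * n.+1%:R)%:P + 2%:P :> {poly R}.
  by rewrite -polyCD -[n.+2%:R]natr1 mulrDr mulr1.
by rewrite [hpoly n.+1]/=; ring.
Qed.

Lemma hpoly_rec n : hpoly n.+2 = 2%:P * 'X * hpoly n.+1 - (2 * n.+1%:R)%:P * hpoly n.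
Proof. by rewrite -deriv_hpoly. Qed.

Definition gauss_deriv n t : R := (-1) ^+ n * (hpoly n).[t] * expR (- t ^+ 2).

Lemma hgauss0 t : gauss_deriv 0 t = expR (- t ^+ 2).
Proof. by rewrite /gauss_deriv expr0 mul1r hornerC mul1r. Qed.

Lemma is_derive_hgauss n t : is_derive t (1 : R) (gauss_deriv n) (gauss_deriv n.+1 t).
Proof.
have h1 : is_derive t (1 : R) (fun s : R => expR (- s ^+ 2)) (- (2 * t) * expR (- t ^+ 2)).
  have h : is_derive t (1 : R) (fun s : R => - s ^+ 2) (- (2 * t)).
    rewrite (_ : (fun s : R => - s ^+ 2) = - ((id : R -> R) ^+ 2)); last first.
      by apply/funext => s; rewrite /= exprfctE.
    apply: (is_derive_eq (is_deriveN (is_deriveX 2 (is_derive_id t (1 : R))))).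
    by rewrite -![_ *: _]/(_ * _) /= expr1 mulr1.
  have := is_derive1_comp (is_derive_expR _) h.
  by rewrite mulrC; exact.
have h2 := is_deriveZ ((-1) ^+ n) (is_deriveM (is_derive_poly (hpoly n) t) h1).
rewrite (_ : gauss_deriv n = (-1) ^+ n \*: ((fun s => (hpoly n).[s]) * (fun s : R => expR (- s ^+ 2)))); last first.
  by apply/funext => s; rewrite /gauss_deriv -mulrA.
apply: (is_derive_eq h2).
have hE : (hpoly n.+1).[t] = 2 * t * (hpoly n).[t] - (hpoly n)^`().[t].
  by rewrite /= !hornerE.
rewrite -![_ *: _]/(_ * _) /gauss_deriv hE (exprS (-1) n).
by ring.
Qed.

Lemma derive_prod_cV d (phi : 'I_d -> R -> R) (j : 'I_d) (phi' : R -> R) :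
  (forall t, is_derive t (1 : R) (phi j) (phi' t)) ->
  (fun x : 'cV[R]_d => 'D_(stdbasis R j) ((fun y : 'cV[R]_d => \prod_(i < d) phi i (y i ord0)) : _ -> R^o) x) =
  (fun x : 'cV[R]_d => \prod_(i < d) (if i == j then phi' else phi i) (x i ord0)).
Proof.
move=> dphi; apply/funext => x.
rewrite (bigD1 j)//= eqxx mulrC; set G := \prod_(i < d | _) _.
have EG : G = \prod_(i < d | i != j) phi i (x i ord0).
  by apply: eq_bigr => i /negbTE ->.
rewrite /derive.
rewrite (_ : (fun h : R => _) = (fun h : R => G *: (h^-1 *:
    ((phi j \o shift (x j ord0)) (h *: (1 : R)) - phi j (x j ord0))))); last first.
  apply/funext => h; rewrite -[LHS]/(h^-1 * _) -[RHS]/(G * (h^-1 * _)).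
  rewrite /= /shift -[h *: 1]/(h * 1) mulr1 mulrCA; congr (_ * _).
  rewrite (bigD1 j)//= [X in _ - X](bigD1 j)//= mulrBr.
  rewrite !mxE !eqxx mulr1 EG mulrC; congr (_ * _ - _); last by rewrite mulrC.
  apply: eq_bigr => i ij; congr (phi i _).
  by rewrite !mxE (negbTE ij) mulr0 add0r.
have [ex <-] := dphi (x j ord0).
apply/cvg_lim => //; apply: cvgZl_tmp.
exact: ex.
Qed.

Lemma mderiv_gauss d (alpha : 'I_d -> nat) (x : 'cV[R]_d) :
  mderiv alpha (fun y => expR (- dotv y y)) x =
  \prod_(i < d) gauss_deriv (alpha i) (x i ord0).
Proof.
pose psi (s : seq 'I_d) (i : 'I_d) : R -> R := gauss_deriv (if i \in s then alpha i else 0%N).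
have E0 : (fun y : 'cV[R]_d => expR (- dotv y y)) =
    (fun y => \prod_(i < d) psi [::] i (y i ord0)).
  apply/funext => y; rewrite /dotv -sumrN expR_sum; apply: eq_bigr => i _.
  by rewrite /psi hgauss0 expr2.
have H (s : seq 'I_d) : uniq s ->
    foldr (fun j (h : 'cV[R]_d -> R) => iter (alpha j) (fun k (x : 'cV[R]_d) => 'D_(stdbasis R j) (k : 'cV[R]_d -> R^o) x) h)
      (fun y => expR (- dotv y y)) s = (fun y => \prod_(i < d) psi s i (y i ord0)).
  elim: s => [//|j s IH] /= /andP[js us].
  rewrite IH//.
  have it n : iter n (fun (k : 'cV[R]_d -> R) (x : 'cV[R]_d) => 'D_(stdbasis R j) (k : 'cV[R]_d -> R^o) x)
      (fun y => \prod_(i < d) psi s i (y i ord0)) =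
      (fun y => \prod_(i < d) (if i == j then gauss_deriv n else psi s i) (y i ord0)).
    elim: n => [|n IHn].
      apply/funext => y /=; apply: eq_bigr => i _; case: eqP => // ->.
      by rewrite /psi (negbTE js).
    rewrite iterS IHn.
    have dj t : is_derive t (1 : R) ((fun i => if i == j then gauss_deriv n else psi s i) j)
        (gauss_deriv n.+1 t) by rewrite eqxx; exact: is_derive_hgauss.
    apply: etrans (@derive_prod_cV d (fun i => if i == j then gauss_deriv n else psi s i) j (gauss_deriv n.+1) dj) _.
    by apply/funext => y; apply: eq_bigr => i _; case: eqP.
  rewrite it; apply/funext => y; apply: eq_bigr => i _; rewrite /psi inE.
  by case: eqP => // ->.
rewrite /mderiv H ?enum_uniq//; apply: eq_bigr => i _.
by rewrite /psi mem_enum.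
Qed.

(** The division by [n!] makes [gker] the ordinary generating function of the
    [hfun n]. *)
Definition hfun n t : R := (hpoly n).[t] / (n`!)%:R * expR (- t ^+ 2 / 2).

Lemma hermiteE d (alpha : 'I_d -> nat) (x : 'cV[R]_d) :
  hermite alpha x = pi `^ (- (d%:R / 4)) * (2 ^+ mabs alpha * (mfact alpha)%:R) `^ (- (1 / 2))
    * (mfact alpha)%:R * \prod_(i < d) hfun (alpha i) (x i ord0).
Proof.
rewrite /hermite mderiv_gauss.
have -> : expR (dotv x x / 2) = \prod_(i < d) expR (x i ord0 ^+ 2 / 2).
  by rewrite -expR_sum /dotv mulr_suml; congr expR; apply: eq_bigr => i _; rewrite expr2.
have -> : (-1) ^+ (\sum_(j < d) alpha j) = \prod_(j < d) (-1) ^+ alpha j :> R.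
  by rewrite (big_morph _ (exprD (-1 : R)) (expr0 _)).
have -> : (mfact alpha)%:R = \prod_(i < d) ((alpha i)`!)%:R :> R by rewrite natr_prod.
set P := pi `^ _; set Q := (_ * _) `^ _.
rewrite -[in RHS]mulrA -big_split/=.
rewrite (mulrC _ P) -!mulrA; congr (P * _).
rewrite mulrCA; congr (Q * _); rewrite -!big_split/=.
apply: eq_bigr => i _; rewrite /gauss_deriv /hfun.
have f0 : ((alpha i)`!)%:R != 0 :> R by rewrite pnatr_eq0 -lt0n fact_gt0.
have -> : expR (- x i ord0 ^+ 2 / 2) = expR (x i ord0 ^+ 2 / 2) * expR (- x i ord0 ^+ 2).
  by rewrite -expRD; congr expR; field.
have s1 : (-1) ^+ alpha i * (-1) ^+ alpha i = 1 :> R by rewrite -exprMn mulrNN mulr1 expr1n.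
set m := (-1) ^+ _ in s1 *; set p := _.[_]; set e := expR _; set g := expR _.
transitivity ((m * m) * (p * e * g)); first ring.
by rewrite s1; field.
Qed.

End hermite_polynomials.

Section generating_function.
Context {R : realType}.
Local Notation C := R[i].

(** A polynomial in the parameter whose coefficients of low degree are those of
    the generating function; for polynomials Cauchy's formula is a finite sum. *)
Definition gen_exp (x : C) N : {poly C} :=
  \sum_(k < N) ((k`!)%:R^-1) *: ((2 * x)%:P * 'X - 'X ^+ 2) ^+ k.

Lemma deriv_gen_exp x N : (gen_exp x N.+1)^`() =
  (2 *: (x%:P - 'X)) * gen_exp x N.
Proof.
rewrite /gen_exp raddf_sum /= big_ord_recl /= expr0 derivZ -polyC1 derivC scaler0 add0r.
rewrite mulr_sumr; apply: eq_bigr => k _; rewrite derivZ /= deriv_exp /bump/= add1n /=.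
rewrite derivB derivM derivC mul0r add0r derivX mulr1 derivXn expr1.
rewrite factS natrM invfM.
have k0 : k.+1%:R != 0 :> C by rewrite pnatr_eq0.
move: (_ ^+ k) => Q.
have e1 : (k.+1%:R^-1)%:P * k.+1%:R = 1 :> {poly C} by rewrite -polyC_natr -polyCM mulVf.
have two : 2%:P = 2 :> {poly C} by rewrite polyC_natr.
rewrite -!mul_polyC !polyCM two -(mulr_natl (_ * Q)) -['X *+ 2]mulr_natl.
transitivity (((k.+1%:R^-1)%:P * k.+1%:R) * ((k`!%:R^-1)%:P * (2 * x%:P - 2 * 'X) * Q)); first ring.
by rewrite e1; ring.
Qed.

(** The differential equation [deriv_gen_exp] gives the coefficients the recurrence
    of the Hermite polynomials. *)
Lemma coef_gen_exp (x : R) n N : (n < N)%N ->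
  (gen_exp (x%:C)%C N)`_n = (((hpoly n).[x] / (n`!)%:R)%:C)%C.
Proof.
suff H n0 : (forall N, (n0 < N)%N -> (gen_exp (x%:C)%C N)`_n0 = (((hpoly n0).[x] / (n0`!)%:R)%:C)%C) /\
    (forall N, (n0.+1 < N)%N -> (gen_exp (x%:C)%C N)`_n0.+1 = (((hpoly n0.+1).[x] / (n0.+1`!)%:R)%:C)%C).
  by case: (H n) => + _; exact.
have rec (m M : nat) : (gen_exp (x%:C)%C M.+1)`_m.+1 *+ m.+1 =
    2 * ((x%:C)%C * (gen_exp (x%:C)%C M)`_m - (if m is m'.+1 then (gen_exp (x%:C)%C M)`_m' else 0)).
  rewrite -coef_deriv deriv_gen_exp -scalerAl coefZ mulrBl coefB coefCM coefXM.
  by case: m.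
have base M : (0 < M)%N -> (gen_exp (x%:C)%C M)`_0 = 1.
  case: M => // M _; rewrite -horner_coef0 /gen_exp horner_sum big_ord_recl.
  rewrite big1 => [|i _]; last first.
    have q0 : ((2 * (x%:C)%C)%:P * 'X - 'X ^+ 2 : {poly C}).[0] = 0.
      by rewrite hornerD hornerN hornerMX hornerXn expr0n mulr0 subr0.
    by rewrite hornerZ horner_exp q0 expr0n mulr0.
  by rewrite hornerZ expr0 hornerC fact0 invr1 mulr1 addr0.
elim: n0 => [|n0 [IH1 IH2]].
  split=> M; first by move=> /base ->; rewrite hornerC fact0 divr1.
  case: M => // M M0.
  have := rec 0 M; rewrite mulr1n => ->; rewrite base// subr0 mulr1 /= -polyC1 derivC subr0 mulr1.
  by rewrite !hornerE (factS 0) fact0 muln1 divr1 rmorphM/= (rmorph_nat (real_complex R)).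
split=> // M; case: M => // M nM.
have := rec n0.+1 M; rewrite IH1 ?IH2//; last exact: ltnW.
move=> /(congr1 (fun t => t / n0.+2%:R)).
have k2 : n0.+2%:R != 0 :> C by rewrite pnatr_eq0.
rewrite -(mulr_natr (gen_exp (x%:C)%C M.+1)`_n0.+2) mulfK// => ->.
have -> : (hpoly n0.+2).[x] = 2 * x * (hpoly n0.+1).[x] - 2 * n0.+1%:R * (hpoly n0).[x].
  by rewrite hpoly_rec !hornerE.
move: (hpoly n0.+1).[x] (hpoly n0).[x] => a b.
rewrite -rmorphM -rmorphB/= -(rmorph_nat (real_complex R) n0.+2) -(rmorph_nat (real_complex R) 2).
rewrite -rmorphM -fmorphV -rmorphM/=; congr (_%:C)%C.
rewrite !factS !natrM.
have n00 := ler0n R n0.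
field.
apply/and3P; split; first by rewrite pnatr_eq0 -lt0n fact_gt0.
  by apply: lt0r_neq0; lra.
by apply: lt0r_neq0; lra.
Qed.

Lemma size_gen_exp x N : (size (gen_exp x N) <= N.*2)%N.
Proof.
apply: leq_trans (size_sum _ _ _) _; apply/bigmax_leqP => k _.
apply: leq_trans (size_scale_leq _ _) _.
have sq : (size ((2 * x)%:P * 'X - 'X ^+ 2 : {poly C})%R <= 3)%N.
  apply: leq_trans (size_polyD _ _) _; rewrite geq_max size_polyN size_polyXn leqnn andbT.
  apply: leq_trans (size_mul_leq _ _) _; rewrite size_polyX addn2 /= .
  by apply: leq_trans (_ : 2 <= 3)%N => //; rewrite ltnS size_polyC leq_b1.
apply: leq_trans (size_exp_leq _ _) _.
have k1 : ((size ((2 * x)%:P * 'X - 'X ^+ 2 : {poly C})%R).-1 * k <= 2 * k)%N.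
  by rewrite leq_mul2r; apply/orP; right; case: (size _) sq.
apply: leq_ltn_trans k1 _; rewrite -muln2 mulnC ltn_mul2r /=.
exact: ltn_ord.
Qed.

Definition unity_root N : C := cexp (0 +i* (2 * pi / N%:R))%C.

Lemma zrootX N k : unity_root N ^+ k = cexp (0 +i* (2 * pi * k%:R / N%:R))%C.
Proof.
elim: k => [|k IH]; first by
  rewrite expr0 mulr0 mul0r; apply: complex_ext; rewrite /= expR0 ?cos0 ?sin0 mul1r.
rewrite exprS IH -cexpD; congr cexp; apply: complex_ext; rewrite /= ?addr0//.
by rewrite -natr1; ring.
Qed.

Lemma cmod_zroot N : cmod (unity_root N) = 1.
Proof. by rewrite cmod_cexp /= expR0. Qed.

Lemma zrootN N : (0 < N)%N -> unity_root N ^+ N = 1.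
Proof.
move=> N0; rewrite zrootX mulfK ?pnatr_eq0 -?lt0n//.
by apply: complex_ext; rewrite /= expR0 mul1r ?(mulrC 2) ?mulr_natr ?cos2pi ?sin2pi.
Qed.

Lemma zroot_neq1 N k : (0 < k < N)%N -> unity_root N ^+ k != 1.
Proof.
move=> /andP[k0 kN]; rewrite zrootX; apply/eqP => /(congr1 (@complex.Re R)) /=.
rewrite expR0 mul1r; set t := pi * k%:R / N%:R : R.
have N0 : 0 < N%:R :> R by rewrite ltr0n (leq_ltn_trans _ kN).
have -> : 2 * pi * k%:R / N%:R = t *+ 2.
  by rewrite /t -mulr_natl; ring.
have s0 : 0 < sin t.
  apply: sin_gt0_pi; rewrite /t divr_gt0// ?mulr_gt0 ?pi_gt0 ?ltr0n//=.
  by rewrite ltr_pdivrMr// ltr_pM2l ?pi_gt0// ltr_nat.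
rewrite mulr2n cosD => e.
have := cos2Dsin2 t; rewrite !expr2 => e2.
have : sin t * sin t = 0 by lra.
by move/eqP; rewrite mulf_eq0 (gt_eqF s0).
Qed.

Lemma zroot_sum N n m : (n < N)%N -> (m < N)%N ->
  \sum_(k < N) (unity_root N ^+ k) ^- n * (unity_root N ^+ k) ^+ m = if n == m then N%:R else 0.
Proof.
move=> nN mN; set z := unity_root N.
have z0 : z != 0 by rewrite -cmod_eq0 cmod_zroot oner_eq0.
have N0 : (0 < N)%N by exact: leq_ltn_trans nN.
case: eqP => [->|nm].
  under eq_bigr do rewrite mulVf ?expf_neq0//.
  by rewrite sumr_const card_ord.
pose v := z ^- n * z ^+ m.
have -> : \sum_(k < N) (z ^+ k) ^- n * (z ^+ k) ^+ m = \sum_(k < N) v ^+ k.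
  apply: eq_bigr => k _; rewrite /v exprMn -!exprM exprVn -exprM.
  by rewrite (mulnC n) (mulnC m).
have vN : v ^+ N = 1.
  by rewrite /v exprMn exprVn -!exprM !(mulnC _ N) !exprM zrootN// !expr1n invr1 mulr1.
have v1 : v != 1.
  apply/eqP => e; have : z ^+ m = z ^+ n.
    by rewrite -[RHS]mulr1 -e /v mulrA mulfV ?mul1r// expf_neq0.
  wlog : n m nN mN nm {v vN e} / (n < m)%N.
    move=> W h; case: (ltngtP n m) => [nm'|mn'|nm'].
    - exact: (W n m).
    - by apply: (W m n) => //; exact/nesym.
    - by case: nm.
  move=> lt_nm; rewrite -(subnK (ltnW lt_nm)) exprD => /eqP.
  rewrite -[X in _ == X]mul1r (inj_eq (mulIf _)) ?expf_neq0//.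
  apply/negP; apply: zroot_neq1; rewrite subn_gt0 lt_nm /=.
  by rewrite (leq_ltn_trans _ mN)// leq_subr.
have := subrX1 v N; rewrite vN subrr => /esym/eqP.
by rewrite mulf_eq0 subr_eq0 (negbTE v1) /= => /eqP.
Qed.

(** Cauchy's formula: the powers of a root of unity are orthogonal. *)
Lemma poly_mean (p : {poly C}) (r : C) N n : (size p <= N)%N -> (n < N)%N ->
  N%:R^-1 * \sum_(k < N) (unity_root N ^+ k) ^- n * p.[r * unity_root N ^+ k] = p`_n * r ^+ n.
Proof.
move=> pN nN.
have N0 : N%:R != 0 :> C by rewrite pnatr_eq0 -lt0n (leq_ltn_trans _ nN).
under eq_bigr do rewrite (horner_coef_wide _ pN) mulr_sumr.
rewrite exchange_big /=.
transitivity (N%:R^-1 * \sum_(j < N) p`_j * r ^+ j * (if n == j then N%:R else 0)).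
  congr (_ * _); apply: eq_bigr => j _; rewrite -(zroot_sum nN (ltn_ord j)) mulr_sumr.
  by apply: eq_bigr => k _; rewrite exprMn; ring.
rewrite (bigD1 (Ordinal nN))//= eqxx big1 ?addr0 => [|j].
  by rewrite mulrCA mulVf// mulr1.
by rewrite -val_eqE /= eq_sym => /negbTE ->; rewrite mulr0.
Qed.

(** A Riemann sum for the Cauchy integral of the [n]-th Taylor coefficient over the
    circle of radius [r]. *)
Definition gker_mean (r : R) n N (x : R) : C :=
  N%:R^-1 * \sum_(k < N) (unity_root N ^+ k) ^- n * gker ((r%:C)%C * unity_root N ^+ k) x.

Lemma gker_factor (z : C) (x : R) : gker z x =
  ((expR (- x ^+ 2 / 2))%:C)%C * cexp (2 * (x%:C)%C * z - z ^+ 2).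
Proof.
have -> : ((expR (- x ^+ 2 / 2))%:C)%C = cexp ((- x ^+ 2 / 2)%:C)%C.
  by apply: complex_ext; rewrite /= ?cos0 ?sin0 ?mulr1 ?mulr0.
by rewrite -cexpD /gker; congr cexp; rewrite mulNr rmorphN; ring.
Qed.

(** The mean is exact on polynomials of degree less than the number of points, so
    that only the tail of the exponential series contributes. *)
Lemma gker_mean_error (r : R) n N (x : R) : 0 <= r -> (n < N)%N ->
  forall Q, Q = 2 * `|x| * r + r ^+ 2 ->
  cmod (gker_mean r n N.*2 x - (((hfun n x) * r ^+ n)%:C)%C) <=
    Q ^+ N / (N`!)%:R * expR Q.
Proof.
move=> r0 nN Q QE.
have N0 : (0 < N)%N by exact: leq_ltn_trans nN.
have nN2 : (n < N.*2)%N by rewrite -addnn ltn_addr.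
have N20 : (0 < N.*2)%N by rewrite double_gt0.
set M := N.*2; set rc : C := (r%:C)%C; set e : C := ((expR (- x ^+ 2 / 2))%:C)%C.
have E : (((hfun n x) * r ^+ n)%:C)%C = M%:R^-1 * \sum_(k < M) (unity_root M ^+ k) ^- n *
    (e * (gen_exp (x%:C)%C N).[rc * unity_root M ^+ k]).
  transitivity (e * ((gen_exp (x%:C)%C N)`_n * rc ^+ n)).
    by rewrite coef_gen_exp// /hfun /e /rc -rmorphXn -!rmorphM/=; congr (_%:C)%C; ring.
  rewrite -(poly_mean rc (size_gen_exp _ _) nN2) mulrCA; congr (_ * _).
  by rewrite mulr_sumr; apply: eq_bigr => k _; rewrite mulrCA.
rewrite E /gker_mean -mulrBr -sumrB cmodM cmodV cmod_nat.
rewrite mulrC ler_pdivrMr ?ltr0n//.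
apply: le_trans (cmod_sum _ _ _) _.
apply: (@le_trans _ _ (\sum_(k < M) (Q ^+ N / (N`!)%:R * expR Q))); last first.
  by rewrite sumr_const card_ord mulr_natr.
apply: ler_sum => k _; rewrite -mulrBr cmodM cmodV !cmodX cmod_zroot !expr1n invr1 mul1r.
rewrite gker_factor -mulrBr cmodM cmod_real ger0_norm ?expR_ge0//.
apply: (@le_trans _ _ (1 * cmod (cexp (2 * (x%:C)%C * (rc * unity_root M ^+ k) - (rc * unity_root M ^+ k) ^+ 2) -
    (gen_exp (x%:C)%C N).[rc * unity_root M ^+ k]))).
  apply: ler_wpM2r; first exact: cmod_ge0.
  by rewrite -expR0 ler_expR mulNr oppr_le0 mulr_ge0// sqr_ge0.
rewrite mul1r; set z := rc * _.
have cz : cmod z = r by rewrite /z cmodM cmodX cmod_zroot expr1n mulr1 cmod_real ger0_norm.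
set u := _ - z ^+ 2.
have -> : (gen_exp (x%:C)%C N).[z] = \sum_(k < N) u ^+ k / (k`!)%:R.
  rewrite /gen_exp horner_sum; apply: eq_bigr => l _.
  have qz : ((2 * (x%:C)%C)%:P * 'X - 'X ^+ 2 : {poly C}).[z] = u.
    by rewrite hornerD hornerN hornerMX hornerC hornerXn.
  by rewrite hornerZ horner_exp qz mulrC.
have hu : cmod u <= Q.
  apply: le_trans (cmodB _ _) _; rewrite cmodX cz cmodM cz cmodM cmod_nat cmod_real.
  by rewrite QE.
apply: le_trans (cexp_taylor u N) _.
apply: ler_pM; rewrite ?expR_ge0 ?ler_expR//.
  by rewrite mulr_ge0 ?exprn_ge0 ?cmod_ge0// invr_ge0.
apply: ler_wpM2r; first by rewrite invr_ge0.
by rewrite lerXn2r ?nnegrE ?cmod_ge0// (le_trans (cmod_ge0 u)).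
Qed.

Lemma cvg_gker_mean (r : R) n m (x : R) : 0 <= r -> (n < m)%N ->
  cmod (gker_mean r n (N + m).*2 x - (((hfun n x) * r ^+ n)%:C)%C) @[N --> \oo] --> (0 : R).
Proof.
move=> r0 nm; set Q := 2 * `|x| * r + r ^+ 2.
have h0 : (Q ^+ (N + m) / ((N + m)`!)%:R * expR Q) @[N --> \oo] --> (0 : R).
  rewrite -[X in _ --> X](mul0r (expR Q)); apply: cvgMl.
  have := @cvg_exp_coeff R Q.
  by rewrite -(cvg_shiftn m).
apply: squeeze_cvgr h0; last exact: cvg_cst.
near=> N; rewrite cmod_ge0 /=.
by apply: gker_mean_error => //; rewrite ltn_addl.
Unshelve. all: by end_near. Qed.

Lemma cmod_gker_mean (r : R) n N (x : R) : 0 <= r -> (0 < N)%N ->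
  cmod (gker_mean r n N x) <= expR (r ^+ 2).
Proof.
move=> r0 N0; rewrite /gker_mean cmodM cmodV cmod_nat mulrC ler_pdivrMr ?ltr0n//.
apply: le_trans (cmod_sum _ _ _) _.
apply: (@le_trans _ _ (\sum_(k < N) expR (r ^+ 2))); last first.
  by rewrite sumr_const card_ord mulr_natr.
apply: ler_sum => k _; rewrite cmodM cmodV !cmodX cmod_zroot !expr1n invr1 mul1r.
apply: le_trans (cmod_gker_le _ _) _.
by rewrite cmodM cmodX cmod_zroot expr1n mulr1 cmod_real ger0_norm.
Qed.

End generating_function.

(** * Weight functions and their indices *)

Section weights.
Context {R : realType}.
Context (w : R -> R) (hw : weight_function w).

Lemma weight_ge0 t : 0 <= t -> 0 <= w t.
Proof. by case: hw => h _ _; exact: h. Qed.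

Lemma weight_le s t : 0 <= s -> s <= t -> w s <= w t.
Proof. by case: hw => _ h _; exact: h. Qed.

Lemma measurable_weight (c : R) : 0 <= c ->
  measurable_fun setT (fun s : R => w (Num.max 0 (c * s))).
Proof.
move=> c0; apply: nondecreasing_measurable => // s t st.
apply: weight_le; first by rewrite le_max lexx.
by rewrite ge_max le_max lexx /= le_max (ler_wpM2l c0 st) orbT.
Qed.

Lemma measurable_weight_norm : measurable_fun setT (fun s : R => w `|s|).
Proof.
have -> : (fun s : R => w `|s|) = (fun s : R => w (Num.max 0 (1 * s))) \o (fun s : R => `|s|).
  by apply/funext => s /=; rewrite mul1r max_r.
apply: measurableT_comp => //; exact: measurable_weight.
Qed.

(** On dyadic blocks the integral condition bounds the series with terms
    [w (t0 2^k) / 4^k], up to a constant; its terms tend to [0], and monotonicity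
    interpolates between the points [t0 2^k]. *)
Lemma weight_small : beta2star w ->
  forall e : R, 0 < e -> exists K : R, forall t, 0 <= t -> w t <= e * t ^+ 2 + K.
Proof.
move=> [C [T hC]] e e0.
pose t0 := Num.max T 1.
have t01 : 1 <= t0 by rewrite le_max lexx orbT.
have t0p : 0 < t0 by exact: lt_le_trans t01.
have hB := hC t0 (_ : T <= t0) (ltW t0p).
have {}hB := hB (_ : T <= t0).
have Tt0 : T <= t0 by rewrite le_max lexx.
have {}hB := hC t0 Tt0 (ltW t0p).
pose D : set (measurableTypeR R) := `[1, +oo[%classic.
pose I (s : measurableTypeR R) : R := w (t0 * s) * s ^- 3.
have mD : measurable D by exact: measurable_itv.
have mI : measurable_fun D (fun s => (I s)%:E).
  apply/measurable_EFinP.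
  apply: (@eq_measurable_fun _ _ _ _ D (fun s : R => w (Num.max 0 (t0 * s)) * s `^ (- 3))).
    move=> s; rewrite inE /D /= in_itv/= andbT => s1.
    have s0 : 0 < s by exact: lt_le_trans s1.
    rewrite /I max_r ?mulr_ge0// ?ltW//; congr (_ * _).
    by rewrite powRN -(powR_mulrn 3 (ltW s0)).
  apply: (@measurable_funS _ _ _ _ setT) => //.
  apply: measurable_funM; first exact: measurable_weight (ltW t0p).
  exact: measurable_powR.
have I0 s : D s -> 0 <= I s.
  rewrite /D /= in_itv/= andbT => s1; have s0 : 0 <= s by exact: le_trans s1.
  by rewrite mulr_ge0 ?weight_ge0 ?mulr_ge0 ?(ltW t0p)// invr_ge0 exprn_ge0.
pose U n : set (measurableTypeR R) := `]1, 2 ^+ n]%classic.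
(* On the block above [2^k], of length [2^k], the factor [s^(-3)] is at least
   [(8 * 8^k)^(-1)]. *)
pose a k : R := w (t0 * 2 ^+ k) / (8 * 4 ^+ k).
have p2 k : 0 < 2 ^+ k :> R by rewrite exprn_gt0.
have p21 k : 1 <= 2 ^+ k :> R by rewrite exprn_ege1// ler1n.
have a0 k : 0 <= a k.
  by rewrite divr_ge0 ?weight_ge0 ?mulr_ge0 ?(ltW t0p) ?exprn_ge0// ltW.
have UD n : U n `<=` D.
  by move=> s; rewrite /U /D /= !in_itv/= andbT => /andP[/ltW].
have sumU n : ((\sum_(k < n) a k)%:E <= \int[@lebesgue_measure R]_(s in U n) (I s)%:E)%E.
  elim: n => [|n IH].
    by rewrite big_ord0; apply: integral_ge0 => s Us; rewrite lee_fin I0//; exact: UD Us.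
  have UE : U n.+1 = U n `|` `]2 ^+ n, 2 ^+ n.+1]%classic.
    rewrite /U -itv_bndbnd_setU//; rewrite bnd_simp//.
    by rewrite exprS ler_peMl ?(ltW (p2 n))// ler1n.
  have blockD : `]2 ^+ n, 2 ^+ n.+1]%classic `<=` D.
    move=> s; rewrite /D /= !in_itv/= andbT => /andP[/ltW h _].
    exact: le_trans h.
  rewrite UE ge0_integral_setU//=; last 3 first.
  - by rewrite -UE; exact: (measurable_funS mD (@UD n.+1) mI).
  - by move=> s h; rewrite lee_fin I0//; apply: (@UD n.+1); rewrite UE.
  - apply/disj_setPS => s [] /=; rewrite /U /= !in_itv/= => /andP[_ h1] /andP[h2 _].
    by have := lt_le_trans h2 h1; rewrite ltxx.
  rewrite big_ord_recr/= EFinD; apply: leeD => //.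
  pose c : R := w (t0 * 2 ^+ n) * (2 ^+ n.+1) ^- 3.
  pose Dn : set (measurableTypeR R) := [set` `](2 ^+ n : R), 2 ^+ n.+1]].
  have -> : ((a n)%:E = \int[@lebesgue_measure R]_(s in Dn) c%:E)%E.
    have muD : @lebesgue_measure R Dn = (2 ^+ n)%:E.
      rewrite /Dn (lebesgue_measure_itv `](2 ^+ n : R), 2 ^+ n.+1]) /= lte_fin.
      rewrite exprS ltr_pMl ?p2// ltr1n /= -EFinB; congr EFin.
      by rewrite mulr_natl mulr2n addrK.
    rewrite integral_cst ?muD; last exact: measurable_itv.
    rewrite [X in (_ * X)%E](muD : _ = (2 ^+ n)%:E) -EFinM.
    have -> : a n = w (t0 * 2 ^+ n) / (8 * 4 ^+ n) by [].
    have -> : 4 ^+ n = (2 ^+ n) ^+ 2 :> R by rewrite -exprM mulnC exprM; congr (_ ^+ _); ring.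
    congr EFin; rewrite /c [2 ^+ n.+1]exprS.
    have : 2 ^+ n != 0 :> R by rewrite gt_eqF.
    by move: (2 ^+ n : R) (w _) => P W P0; field.
  apply: ge0_le_integral => //.
  - exact: measurable_itv.
  - move=> s _; rewrite lee_fin mulr_ge0 ?weight_ge0 ?mulr_ge0 ?(ltW t0p) ?(ltW (p2 _))//.
  - exact: (measurable_funS mD blockD mI).
  move=> s; rewrite /Dn /= in_itv/= => /andP[s1 s2]; rewrite lee_fin /I.
  have s0 : 0 < s by exact: lt_trans s1.
  apply: ler_pM.
  - by rewrite weight_ge0// mulr_ge0 ?(ltW t0p)// ltW.
  - by rewrite invr_ge0 exprn_ge0// ltW.
  - by rewrite weight_le ?mulr_ge0 ?(ltW t0p) ?(ltW (p2 _))// ler_pM2l// ltW.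
  - by rewrite lef_pV2 ?posrE ?exprn_gt0// lerXn2r ?nnegrE// ltW.
  exact: measurable_itv.
have bnd n : \sum_(k < n) a k <= C * w t0.
  rewrite -lee_fin; apply: le_trans (sumU n) _; apply: le_trans hB.
  apply: (@ge0_subset_integral _ _ _ _ (U n) D _ mD _ mI _ (@UD n)).
    exact: measurable_itv.
  by move=> s Ds; rewrite lee_fin I0.
have acv : a k @[k --> \oo] --> (0 : R).
  apply: cvg_series_cvg_0; apply: nondecreasing_is_cvgn.
    by apply: nondecreasing_series => k _ _; exact: a0.
  exists (C * w t0) => _ [n _ <-].
  by rewrite /series /= big_mkord.
(* [32 = 8 * 4]: a further factor [4] is lost between consecutive powers of [2]. *)
have e32 : 0 < e / 32 by rewrite divr_gt0.
have /cvgrPdist_lt /(_ _ e32) [N _ hN] := acv.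
exists (w (t0 * 2 ^+ N)) => t tge0.
have [tN|tN] := leP t (t0 * 2 ^+ N).
  by apply: (le_trans (weight_le tge0 tN)); rewrite lerDr mulr_ge0 ?sqr_ge0// ltW.
apply: ler_wpDr; first by rewrite weight_ge0// mulr_ge0 ?(ltW t0p)// ltW.
have tp : 0 < t by apply: lt_trans tN; rewrite mulr_gt0.
have exk : exists k, t <= t0 * 2 ^+ k.
  have [m hm] : exists m : nat, t < m%:R.
    by exists (Num.bound t); exact: archi_boundP.
  exists m; apply: le_trans (ltW hm) _.
  apply: (@le_trans _ _ (2 ^+ m)); last by rewrite ler_peMl// ltW.
  by rewrite -natrX ler_nat ltnW// ltn_expl.
have [k tk mink] := ex_minnP exk.
have kN : (N < k)%N.
  rewrite ltnNge; apply/negP => kN; have := lt_le_trans tN tk.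
  rewrite ltr_pM2l// => h; have : 2 ^+ k <= 2 ^+ N :> R by rewrite ler_eXn2l// ltr1n.
  by rewrite leNgt h.
case: k tk mink kN => // k tk mink kN.
have tk' : t0 * 2 ^+ k < t.
  by rewrite ltNge; apply/negP => /mink; rewrite ltnn.
apply: le_trans (weight_le tge0 tk) _.
have := hN k.+1 (ltnW kN); rewrite /= sub0r normrN ger0_norm// /a.
rewrite ltr_pdivrMr; last by rewrite mulr_gt0// exprn_gt0.
move=> /ltW /le_trans; apply.
have -> : 4 ^+ k.+1 = 4 * (2 ^+ k) ^+ 2 :> R.
  by rewrite exprS -exprM mulnC exprM; congr (_ * _ ^+ _); ring.
have -> : e / 32 * (8 * (4 * (2 ^+ k) ^+ 2)) = e * (2 ^+ k) ^+ 2 by field.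
rewrite ler_pM2l// lerXn2r ?nnegrE// ?(ltW (p2 _))//.
apply: le_trans (ltW tk'); rewrite ler_peMl// ltW.
Qed.

(** An infimum of constants need not be attained, but every larger number is
    above an attained one. *)
Lemma index_witness (S : set (\bar R)) (l q : R) :
  (forall L, S L -> (1 <= L)%E) -> ereal_inf S = l%:E -> l < q ->
  exists2 L : R, S L%:E & 1 <= L < q.
Proof.
move=> S1 Sl lq; have : (ereal_inf S < q%:E)%E by rewrite Sl lte_fin.
move=> /ereal_inf_lt[L SL Lq]; have := S1 L SL.
case: L SL Lq => [L|//|//] SL; rewrite lte_fin lee_fin => Lq L1.
by exists L => //; rewrite L1.
Qed.

Lemma index_ge1 (S : set (\bar R)) : (forall L, S L -> (1 <= L)%E) -> (1 <= ereal_inf S)%E.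
Proof. by move=> S1; apply: le_ereal_inf_tmp => L /S1. Qed.

Lemma mule_ge1_fin (x y : \bar R) : (1 <= x)%E -> (1 <= y)%E -> (x * y < +oo)%E ->
  exists p q : R, [/\ x = p%:E, y = q%:E, 1 <= p & 1 <= q].
Proof.
case: x => [p||]; case: y => [q||] //=; rewrite ?lee_fin => p1 q1.
- by exists p, q.
- by rewrite gt0_muley ?ltxx// lte_fin (lt_le_trans _ p1).
- by rewrite gt0_mulye ?ltxx// lte_fin (lt_le_trans _ q1).
Qed.

(** The indices as explicit estimates. Since none of the infima need be attained,
    four of the constants are enlarged by a factor [dl], for whose fourth power
    the strict inequality on [r] leaves room. *)
Lemma C3_witness (d : nat) (lambda r : R) : 0 < lambda -> 0 < r ->
  (r%:E < (C3 d w lambda * lambda%:E)^-1)%E ->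
  exists Lm Lp Lk LQ kap : R,
    [/\ [/\ 1 <= Lm, 1 <= Lp, 0 <= LQ & 0 <= kap],
       Lm * Lp * lambda <= kap, r * (kap * LQ * Lk) <= 1,
       (exists C : R, forall t s, 0 <= t -> 0 <= s -> w (t + s) <= Lm * (w t + w s) + C) /\
       PL_admissible w (pi / 2) Lp%:E &
       (exists C : R, forall t, 0 <= t ->
          w (d%:R `^ ((d%:R - 1) / (2 * d%:R)) * t) <= Lk * w t + C) /\
       (exists C : R, forall t, 0 <= t -> exists2 s : R, 0 < s &
          (d%:R - 1) / (2 * d%:R) * s `^ (2 / (d%:R - 1)) + kap * w (t ^+ d / s) <=
          LQ * kap * w t + C)].
Proof.
move=> l0 r0 hr.
pose kd : R := d%:R `^ ((d%:R - 1) / (2 * d%:R)).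
have i1 := @index_ge1 _ (fun L (h : _ /\ _) => h.1) : (1 <= index_mk kd w)%E.
have im := @index_ge1 _ (fun L (h : _ /\ _) => h.1) : (1 <= index_m w)%E.
have i2 := @index_ge1 _ (fun L (h : _ /\ _) => h.1) : (1 <= index_mk (Num.sqrt d%:R) w)%E.
have ip := @index_ge1 _ (fun L (h : _ /\ _) => h.1) : (1 <= index_PL (pi / 2) w)%E.
pose mu := (fine (C2 d w) * lambda)^-1.
have iQ := @index_ge1 _ (fun L (h : _ /\ _) => h.1) : (1 <= index_QI d w mu)%E.
have mule1 (x y : \bar R) : (1 <= x)%E -> (1 <= y)%E -> (1 <= x * y)%E.
  by move=> x1 y1; rewrite -[leLHS]mule1; apply: lee_pmul.
have C3oo : (C3 d w lambda < +oo)%E.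
  rewrite ltey; apply/eqP => e; move: hr; rewrite e.
  have -> : (+oo * lambda%:E = +oo)%E by rewrite gt0_mulye// lte_fin.
  rewrite invey lte_fin.
  by rewrite ltNge (ltW r0).
have iC2 : (1 <= C2 d w)%E by rewrite /C2 !mule1.
have [m1Q [q [e1 eQ m1Q1 q1]]] := mule_ge1_fin (mule1 _ _ i1 iC2) iQ C3oo.
have [m1 [c2 [em1 ec2 m11 c21]]] : exists p q, [/\ index_mk kd w = p%:E, C2 d w = q%:E, 1 <= p & 1 <= q].
  by apply: mule_ge1_fin => //; rewrite e1 ltry.
have [mk2 [p [emk2 ep mk21 p1]]] : exists p q, [/\ (index_m w * index_mk (Num.sqrt d%:R) w)%E = p%:E,
    index_PL (pi / 2) w = q%:E, 1 <= p & 1 <= q].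
  by apply: mule_ge1_fin => //; [exact: mule1|rewrite -/(C2 d w) ec2 ltry].
have [m [k2 [em ek2 m_1 k21]]] : exists p q, [/\ index_m w = p%:E,
    index_mk (Num.sqrt d%:R) w = q%:E, 1 <= p & 1 <= q].
  by apply: mule_ge1_fin => //; rewrite emk2 ltry.
have m1p : 0 < m1 by exact: lt_le_trans m11.
have qp : 0 < q by exact: lt_le_trans q1.
have c2p : 0 < c2 by exact: lt_le_trans c21.
have c2E : c2 = m * k2 * p.
  by apply: EFin_inj; rewrite -ec2 /C2 em ek2 ep.
pose kap1 := c2 * lambda.
have kap1p : 0 < kap1 by rewrite mulr_gt0// (lt_le_trans _ c21).
have muE : mu = kap1^-1 by rewrite /mu ec2.
pose X := r * m1 * kap1 * q.
have X0 : 0 < X by rewrite !mulr_gt0.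
have X1 : X < 1.
  move: hr; rewrite /C3 -/kd -/mu em1 ec2 eQ -!EFinM inver.
  have nz : 0 < m1 * c2 * q * lambda.
    by rewrite !mulr_gt0.
  rewrite gt_eqF// lte_fin -[X in _ < X]mul1r ltr_pdivlMr//.
  by congr (_ < _); rewrite /X /kap1; ring.
(* [X < 1] is the margin; the four enlarged constants cost [dl ^ 4 = 1 / X]. *)
pose dl := Num.sqrt (Num.sqrt X^-1).
have dl4 : dl ^+ 4 = X^-1 by rewrite (exprM _ 2 2) !sqr_sqrtr ?sqrtr_ge0// invr_ge0 ltW.
have dl1 : 1 < dl.
  rewrite -(@ltr_pXn2r _ 4) ?nnegrE ?sqrtr_ge0// expr1n dl4.
  by rewrite invf_gt1.
have dlp : 0 < dl by exact: lt_trans dl1.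
have up (l : R) : 1 <= l -> l < dl * l by move=> l1; rewrite ltr_pMl// (lt_le_trans _ l1).
have [Lm [_ [Cm Cm0 hLm]] /andP[Lm1 Lm2]] := index_witness (fun L (h : _ /\ _) => h.1) em (up _ m_1).
have [Lp [_ hLp] /andP[Lp1 Lp2]] := index_witness (fun L (h : _ /\ _) => h.1) ep (up _ p1).
have [Lk [_ [Ck Ck0 hLk]] /andP[Lk1 Lk2]] := index_witness (fun L (h : _ /\ _) => h.1) em1 (up _ m11).
have [LQ [_ [CQ CQ0 hLQ]] /andP[LQ1 LQ2]] := index_witness (fun L (h : _ /\ _) => h.1) eQ (up _ q1).
exists Lm, Lp, Lk, LQ, (dl ^+ 2 * kap1); split.
- split=> //; first exact: le_trans ler01 LQ1.
  by rewrite mulr_ge0 ?exprn_ge0// ltW.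
- have h : Lm * Lp <= (dl * m) * (dl * p).
    by apply: ler_pM; rewrite ?(ltW Lm2) ?(ltW Lp2)//; [exact: le_trans ler01 Lm1|exact: le_trans ler01 Lp1].
  apply: (@le_trans _ _ ((dl * m) * (dl * p) * lambda)); first by rewrite ler_pM2r.
  have -> : dl ^+ 2 * kap1 = ((dl * m) * (dl * p) * lambda) * k2.
    by rewrite /kap1 c2E; ring.
  rewrite ler_peMr// !mulr_ge0 ?(ltW dlp) ?(ltW l0)//; [exact: le_trans ler01 m_1|exact: le_trans ler01 p1].
- have h : LQ * Lk <= (dl * q) * (dl * m1).
    by apply: ler_pM; rewrite ?(ltW LQ2) ?(ltW Lk2)//; [exact: le_trans ler01 LQ1|exact: le_trans ler01 Lk1].
  apply: (@le_trans _ _ (r * (dl ^+ 2 * kap1 * ((dl * q) * (dl * m1))))).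
    by rewrite ler_pM2l// -mulrA ler_pM2l// mulr_gt0// exprn_gt0.
  have -> : r * (dl ^+ 2 * kap1 * ((dl * q) * (dl * m1))) = dl ^+ 4 * X by rewrite /X; ring.
  by rewrite dl4 mulVf// gt_eqF.
- split => //; exists Cm => t s t0 s0.
  by have := hLm t s t0 s0; rewrite -EFinM -EFinD lee_fin.
- split.
    by exists Ck => t t0; have := hLk t t0; rewrite -EFinM -EFinD lee_fin.
  exists (dl ^+ 2 * (CQ + 1)) => t t0.
  have := hLQ t t0; rewrite muE invrK -EFinM -EFinD => hinf.
  have : (ereal_inf [set ((d%:R - 1) / (2 * d%:R) * s `^ (2 / (d%:R - 1)) +
     kap1 * w (t ^+ d / s))%:E | s in [set s : R | (0 < s)%R]] < (LQ * (kap1 * w t) + CQ + 1)%:E)%E.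
    by apply: le_lt_trans hinf _; rewrite lte_fin ltrDl.
  move=> /ereal_inf_lt[_ [s s0 <-]]; rewrite lte_fin => hs.
  exists s => //.
  have dl21 : 1 <= dl ^+ 2 by rewrite exprn_ege1// ltW.
  have dlp2 : 0 < dl ^+ 2 by rewrite exprn_gt0.
  apply: (@le_trans _ _ (dl ^+ 2 * ((d%:R - 1) / (2 * d%:R) * s `^ (2 / (d%:R - 1)) +
     kap1 * w (t ^+ d / s)))).
    rewrite mulrDr [X in _ <= _ + X]mulrA; apply: lerD => //.
    have [d0|d1] := leqP d 0.
      by move: d0; rewrite leqn0 => /eqP ->; rewrite (_ : (0%:R : R) = 0)// mulr0 invr0 mulr0 !mul0r mulr0.
    have h0 : 0 <= (d%:R - 1) / (2 * d%:R) :> R.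
      by rewrite divr_ge0 ?mulr_ge0// subr_ge0 ler1n.
    by rewrite ler_peMl// mulr_ge0// powR_ge0.
  apply: le_trans (ler_wpM2l (ltW dlp2) (ltW hs)) _.
  by rewrite le_eqVlt; apply/orP; left; apply/eqP; ring.
Qed.

(** Taking logarithms turns a bound for every [u] into a bound by the supremum;
    for [X > 0] this also shows that the Young conjugate is finite. *)
Lemma young_bound (r v X C : R) : 0 < r -> 0 <= X -> 0 < C ->
  (forall u, 0 <= u -> X <= C * expR (- (r^-1 * (u * v - phi w u)))) ->
  (X%:E <= C%:E * expeR (- ((r^-1)%:E * young_conjugate w v)))%E.
Proof.
move=> r0; rewrite le_eqVlt => /orP[/eqP <-|X0] C0 H.
  by rewrite mule_ge0 ?lee_fin ?(ltW C0)// expeR_ge0.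
pose B := r * ln (C / X).
have hB : (young_conjugate w v <= B%:E)%E.
  apply: ge_ereal_sup => _ [u u0 <-]; rewrite lee_fin /B.
  rewrite -ler_pdivrMl// -ler_expR lnK ?posrE ?divr_gt0// ler_pdivlMr//.
  rewrite -ler_pdivlMl ?expR_gt0// -expRN mulrC.
  exact: H.
have yfin : young_conjugate w v \is a fin_num.
  rewrite fin_numE; apply/andP; split; apply/eqP => e.
    have : ((0 * v - phi w 0)%:E <= young_conjugate w v)%E.
      by apply: ereal_sup_ubound; exists 0 => //=.
    by rewrite e leeNy_eq.
  by move: hB; rewrite e leye_eq.
move: hB; rewrite -(fineK yfin) lee_fin => hB.
rewrite -EFinM /= lee_fin.
have -> : X = C * expR (- (r^-1 * B)).
  rewrite /B mulrA mulVf ?gt_eqF// mul1r -lnV ?posrE ?divr_gt0// invf_div.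
  by rewrite lnK ?posrE ?divr_gt0// mulrC divfK ?gt_eqF.
by rewrite ler_pM2l// ler_expR lerN2 ler_pM2l// invr_gt0.
Qed.

End weights.

(** * Square roots of positive definite matrices *)

Section square_root_of_matrix.
Context {R : realType}.

Lemma poly_interpolation (F : fieldType) (s : seq F) (f : F -> F) :
  exists p : {poly F}, forall x, x \in s -> p.[x] = f x.
Proof.
elim: s => [|x s [p hp]]; first by exists 0.
have [xs|xs] := boolP (x \in s).
  by exists p => y; rewrite inE => /predU1P[->|]; exact: hp.
pose q := \prod_(y <- s) ('X - y%:P).
have qx : q.[x] != 0 by rewrite -[_ == 0]/(root q x) root_prod_XsubC.
have qs y : y \in s -> q.[y] = 0 by move=> ys; apply/eqP; rewrite -/(root q y) root_prod_XsubC.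
exists (p + ((f x - p.[x]) / q.[x])%:P * q) => y.
rewrite inE hornerD hornerM hornerC => /predU1P[->|ys].
  by rewrite divfK// addrC subrK.
by rewrite (qs y ys) mulr0 addr0 hp.
Qed.

Lemma trmx_horner_mx n (A : 'M[R]_n.+1) (p : {poly R}) : A^T = A ->
  (horner_mx A p)^T = horner_mx A p.
Proof.
move=> sA; elim/poly_ind: p => [|p c IH]; first by rewrite rmorph0 trmx0.
rewrite rmorphD rmorphM /= horner_mx_X horner_mx_C linearD /= tr_scalar_mx.
congr (_ + _).
rewrite -[_ * A]/(_ *m A) trmx_mul sA IH.
exact: (comm_mx_horner p (erefl : comm_mx A A)).
Qed.

Lemma dotv_ge0 n (x : 'cV[R]_n) : 0 <= dotv x x.
Proof. by apply: sumr_ge0 => i _; rewrite -expr2 sqr_ge0. Qed.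

Lemma dotv_eq0 n (x : 'cV[R]_n) : (dotv x x == 0) = (x == 0).
Proof.
apply/idP/eqP => [|->]; last by rewrite /dotv big1// => i _; rewrite mxE mulr0.
rewrite psumr_eq0 => [/allP h|i _]; last by rewrite -expr2 sqr_ge0.
apply/colP => i; have := h i (mem_index_enum _); rewrite mxE /= mulf_eq0 orbb.
by move/eqP.
Qed.

Lemma posdef_eigenvalue n (A : 'M[R]_n) (r : R) (x : 'cV[R]_n) :
  posdef A -> x != 0 -> A *m x = r *: x -> 0 < r.
Proof.
move=> [_ pA] x0 Ax; have := pA x x0; rewrite Ax.
have -> : dotv (r *: x) x = r * dotv x x.
  by rewrite /dotv mulr_sumr; apply: eq_bigr => i _; rewrite mxE mulrA.
by rewrite pmulr_lgt0// lt_neqAle dotv_ge0 eq_sym dotv_eq0 x0.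
Qed.

(** A polynomial whose values at the eigenvalues of [A] are their fourth roots
    gives a symmetric [E] with [E^4 = A]; the square of [E] is positive
    definite because [E] is symmetric and invertible. *)
Lemma posdef_sqrt n (A : 'M[R]_n.+1) : posdef A ->
  exists B, posdef B /\ B *m B = A.
Proof.
move=> pA; have [sA _] := pA.
pose toC := real_complex R.
pose Ac : 'M[R[i]]_n.+1 := map_mx toC A.
have rA : Ac \is a realmx.
  by apply/mxOverP => i j; rewrite mxE complex_real.
have symA : Ac \is symmetricmx.
  apply/is_hermitianmxP; rewrite expr0 scale1r; apply/matrixP => i j; rewrite !mxE.
  by rewrite -[in LHS]sA mxE.
have hA := realsym_hermsym symA rA.
have /orthomx_spectralP AE := hermitian_normalmx hA.
have /mxOverP rD := hermitian_spectral_diag_real hA.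
set P := spectralmx Ac in AE; set D := spectral_diag Ac in AE rD.
have uP : P \in unitmx by exact: spectral_unit.
clearbody P D.
pose r k : R := complex.Re (D 0 k).
have DE k : D 0 k = toC (r k) by rewrite /r /toC RRe_real.
have r0 k : 0 < r k.
  have uk : row k P *m Ac = D 0 k *: row k P.
    rewrite -row_mul {1}AE !mulmxA mulmxV// mul1mx.
    by apply/rowP => j; rewrite mul_diag_mx !mxE.
  have nz : row k P != 0.
    apply/eqP => e; have : row k (P *m invmx P) = 0 by rewrite row_mul e mul0mx.
    rewrite mulmxV// => /rowP/(_ k); rewrite !mxE eqxx => /eqP.
    by rewrite oner_eq0.
  (* The real and imaginary parts of a complex eigenvector are eigenvectors. *)
  have part (p : R[i] -> R) : (forall a b, p (a + b) = p a + p b) -> p 0 = 0 ->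
      (forall a (c : R), p (a * toC c) = p a * c) ->
      A *m (\col_i p (P k i)) = r k *: (\col_i p (P k i)).
    move=> pD p0 pM; apply/colP => i; rewrite !mxE.
    have /rowP/(_ i) := uk; rewrite !mxE DE => e.
    rewrite mulrC -pM mulrC -e (big_morph p pD p0).
    apply: eq_bigr => j _; rewrite !mxE pM mulrC; congr (_ * _).
    by rewrite -[in LHS]sA mxE.
  have eR := part (@complex.Re R) (@ReD R) erefl.
  have eI := part (@complex.Im R) (@ImD R) erefl.
  have [xR|xR] := eqVneq (\col_i complex.Re (P k i)) 0; last first.
    apply: posdef_eigenvalue pA xR (eR _) => a c.
    by rewrite ReM /= mulr0 subr0.
  apply: posdef_eigenvalue pA _ (eI _); last first.
    by move=> a c; rewrite ImM /= mulr0 add0r.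
  apply: contra nz => /eqP xI; apply/eqP/rowP => i; rewrite !mxE.
  apply: complex_ext.
    by have /colP/(_ i) := xR; rewrite !mxE.
  by have /colP/(_ i) := xI; rewrite !mxE.
have [p hp] := poly_interpolation [seq r k | k : 'I_n.+1] (fun t => Num.sqrt (Num.sqrt t)).
have p4 k : p.[r k] ^+ 4 = r k.
  rewrite hp; last exact: map_f (mem_enum _ _).
  by rewrite (exprM _ 2 2) !sqr_sqrtr ?sqrtr_ge0// ltW.
pose E := horner_mx A p.
have sE : E^T = E by exact: trmx_horner_mx.
have E4 : E ^+ 4 = A.
  apply: (map_mx_inj (f := toC)).
  have -> : E ^+ 4 = horner_mx A (p ^+ 4) by rewrite rmorphXn.
  pose q := map_poly toC (p ^+ 4).
  have qD : map_mx (horner q) D = D.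
    by apply/rowP => k; rewrite mxE DE /q horner_map /= horner_exp p4.
  have cj : horner_mx (invmx P *m diag_mx D *m P) q =
      invmx P *m horner_mx (diag_mx D) q *m P by exact: horner_mx_uconjC.
  apply: etrans (map_horner_mx toC A (p ^+ 4)) _.
  by rewrite -/Ac -/q {1}AE cj horner_mx_diag qD -AE.
have E4m : E *m E *m (E *m E) = A.
  have -> : E *m E *m (E *m E) = (E * E) * (E * E) by [].
  by rewrite -!expr2 -exprM E4.
exists (E *m E); split => //; split; first by rewrite trmx_mul sE.
move=> x x0; rewrite -mulmxA dotv_mulmx sE.
rewrite lt_neqAle dotv_ge0 andbT eq_sym dotv_eq0.
apply: contraNneq x0 => Ex.
have Ax : A *m x = 0 by rewrite -E4m -!mulmxA Ex !mulmx0.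
have [//|xn0] := eqVneq x 0.
have := pA.2 x xn0; rewrite Ax /dotv big1 ?ltxx// => i _.
by rewrite mxE mul0r.
Qed.

Lemma sqrtmxP n (A : 'M[R]_n) : (0 < n)%N -> posdef A ->
  posdef (sqrtmx A) /\ sqrtmx A *m sqrtmx A = A.
Proof.
case: n A => // n A _ /posdef_sqrt[B hB].
exact: (@xgetPex _ 0 [set B | posdef B /\ B *m B = A] (ex_intro _ B hB)).
Qed.

Lemma posdef_unit n (B : 'M[R]_n) : posdef B -> B \in unitmx.
Proof.
move=> [sB pB]; rewrite -row_free_unit -kermx_eq0; apply/rowV0P => v /sub_kermxP vB.
apply/eqP/negPn/negP => v0.
have : 0 < dotv (B *m v^T) v^T.
  by apply: pB; rewrite -(inj_eq trmx_inj) trmxK trmx0.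
have -> : B *m v^T = 0 by rewrite -sB -trmx_mul vB trmx0.
by rewrite /dotv big1 ?ltxx// => i _; rewrite mxE mul0r.
Qed.

End square_root_of_matrix.

(** * Bounds from decay in one direction *)

Section directional.
Context {R : realType}.
Local Notation leb n := (lebesgue_cV R n).

Lemma posdef1 n : posdef (1%:M : 'M[R]_n).
Proof.
split=> [|x x0]; first by rewrite trmx1.
by rewrite mul1mx lt_neqAle dotv_ge0 eq_sym dotv_eq0 x0.
Qed.

(** A change of variables multiplies integrals by a constant, so it preserves null
    sets. *)
Lemma ae_posdef n (B : 'M[R]_n) (P : 'cV[R]_n -> Prop) : posdef B ->
  {ae leb n, forall x, P x} -> {ae leb n, forall x, P (B *m x)}.
Proof.
move=> pB [N [mN N0 sN]]; have [c c0 hc] := integral_posdef pB.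
have mBN : measurable ((fun x : 'cV[R]_n => B *m x) @^-1` N).
  by rewrite -[X in measurable X]setTI; exact: (measurable_mulmx B).
exists ((fun x : 'cV[R]_n => B *m x) @^-1` N); split=> //; last first.
  by move=> x; exact: (sN (B *m x)).
have H : (\int[leb n]_x (\1_N (B *m x))%:E = c%:E * \int[leb n]_x (\1_N x)%:E)%E.
  apply: (hc (fun x => (\1_N x)%:E)); last by move=> x; rewrite lee_fin.
  exact/measurable_EFinP/measurable_indic.
have I1 : (\int[leb n]_x (\1_N x)%:E = 0)%E.
  by rewrite (integral_indic _ measurableT mN) setIT; exact: N0.
have I2 := integral_indic (leb n) measurableT mBN; rewrite setIT in I2.
by apply: etrans (esym I2) _; rewrite -(mule0 c%:E) -I1 -H.
Qed.

Section weighted.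
Context (w : R -> R) (hw : weight_function w).
Hypothesis wsmall : forall e : R, 0 < e -> exists K : R, forall t, 0 <= t ->
  w t <= e * t ^+ 2 + K.

Definition wgauss (lam x : R) : R := expR (- (1 / 2) * `|x| ^+ 2 + lam * w `|x|).

Lemma wgauss_ge0 lam x : 0 <= wgauss lam x. Proof. exact: expR_ge0. Qed.

Lemma measurable_wgauss lam : measurable_fun setT (wgauss lam).
Proof.
apply: measurableT_comp => //; apply: measurable_funD.
  apply: measurable_funM; first exact: measurable_cst.
  by apply: measurable_funX; exact: normr_measurable.
by apply: measurable_funM => //; exact: measurable_weight_norm.
Qed.

(** Completing the square: the kernel moves the Gaussian to [Re z] and the
    quasi-subadditivity of the weight moves the weight along with it. *)
Lemma integral_wgauss_gker (lam Lm Cm : R) : 0 < lam -> 1 <= Lm ->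
  (forall t s, 0 <= t -> 0 <= s -> w (t + s) <= Lm * (w t + w s) + Cm) ->
  exists2 C : R, 0 < C & forall z : R[i],
    (\int[@lebesgue_measure R]_x (wgauss lam x * cmod (gker z x))%:E <=
     (C * expR (complex.Im z ^+ 2 + lam * Lm * w `|complex.Re z|))%:E)%E.
Proof.
move=> l0 L1 hL; have L0 : 0 < Lm by exact: lt_le_trans L1.
have lL0 : 0 < lam * Lm by rewrite mulr_gt0.
have e0 : 0 < (2 * (lam * Lm))^-1 by rewrite invr_gt0 mulr_gt0.
have [K hK] := wsmall e0.
pose K' := lam * Lm * K + lam * Cm.
exists (expR K' * Num.sqrt (2 * pi)).
  by rewrite mulr_gt0 ?expR_gt0// sqrtr_gt0 mulr_gt0// pi_gt0.
move=> z; set a := complex.Re z; set b := complex.Im z.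
set E := expR (b ^+ 2 + lam * Lm * w `|a|).
have -> : ((expR K' * Num.sqrt (2 * pi) * E)%:E =
   \int[@lebesgue_measure R]_x ((expR K' * E)%:E * (expR (- (x - a) ^+ 2 / 2))%:E))%E.
  rewrite integralZl_ge0 ?mulr_ge0 ?expR_ge0//.
  - by rewrite integral_gauss -EFinM mulrAC.
  - exact: measurable_gauss.
apply: ge0_le_integral => //.
- by move=> x _; rewrite lee_fin mulr_ge0 ?wgauss_ge0 ?cmod_ge0.
- apply/measurable_EFinP; apply: measurable_funM; first exact: measurable_wgauss.
  by apply: cmeas_cmod; exact: cmeas_gker.
- apply: emeasurable_funM; first exact: measurable_cst.
  by apply/measurable_EFinP; exact: measurable_gauss.
move=> x _; rewrite -EFinM lee_fin /wgauss cmod_cexp -!expRD ler_expR.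
rewrite Re_gker_exponent -/a -/b (real_normK (num_real _)).
have h1 : w `|x| <= Lm * (w `|a| + w `|x - a|) + Cm.
  apply: le_trans (hL _ _ (normr_ge0 _) (normr_ge0 _)).
  apply: (weight_le hw) => //.
  by apply: le_trans (ler_normD _ _); rewrite addrC subrK.
have h2 := hK `|x - a| (normr_ge0 _); rewrite (real_normK (num_real _)) in h2.
have h3 : lam * w `|x| <= lam * Lm * w `|a| + lam * Lm * w `|x - a| + lam * Cm.
  apply: le_trans (ler_wpM2l (ltW l0) h1) _.
  by rewrite le_eqVlt; apply/orP; left; apply/eqP; ring.
have h4 : lam * Lm * w `|x - a| <= (x - a) ^+ 2 / 2 + lam * Lm * K.
  apply: le_trans (ler_wpM2l (ltW lL0) h2) _.
  by rewrite le_eqVlt; apply/orP; left; apply/eqP; field; rewrite gt_eqF//= gt_eqF.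
apply: (@le_trans _ _ (- (1 / 2) * x ^+ 2 + (lam * Lm * w `|a| + ((x - a) ^+ 2 / 2 + lam * Lm * K) + lam * Cm) +
  (b ^+ 2 - a ^+ 2 + 2 * a * x - x ^+ 2 / 2))).
  by rewrite lerD2r lerD2l; apply: le_trans h3 _; rewrite lerD2r lerD2l.
by rewrite /K' le_eqVlt; apply/orP; left; apply/eqP; field.
Qed.

Definition gker_prod n (B : 'M[R]_n) (z : 'I_n -> R[i]) (x : 'cV[R]_n) : R[i] :=
  \prod_(k < n) gker (z k) ((B *m x) k ord0).

Lemma measurable_mulmx_coord n (B : 'M[R]_n) (k : 'I_n) :
  measurable_fun setT (fun x : 'cV[R]_n => (B *m x) k ord0).
Proof. exact: (measurableT_comp (measurable_cV_coord k) (measurable_mulmx B)). Qed.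

Lemma cmeas_gker_prod n (B : 'M[R]_n) z : cmeas (gker_prod B z).
Proof. by apply: cmeas_prod => k; apply: cmeas_gker; exact: measurable_mulmx_coord. Qed.

Lemma cmod_gker_prod n (B : 'M[R]_n) z x :
  cmod (gker_prod B z x) <= expR (\sum_(k < n) cmod (z k) ^+ 2).
Proof.
rewrite cmod_prod expR_sum; apply: ler_prod => k _.
by rewrite cmod_ge0 cmod_gker_le.
Qed.

(** Decay in one direction is enough: in the other directions the kernels
    themselves are integrable. *)
Lemma directional_bound n (B : 'M[R]_n) (j : 'I_n) (lam Lm Cm C0 : R) :
  posdef B -> 0 < lam -> 1 <= Lm -> 0 < C0 ->
  (forall t s, 0 <= t -> 0 <= s -> w (t + s) <= Lm * (w t + w s) + Cm) ->
  exists2 C : R, 0 < C & forall (u : 'cV[R]_n -> R[i]),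
    {ae leb n, forall x, cmod (u x) <= C0 * wgauss lam ((B *m x) j ord0)} ->
    forall z, cmeas (fun x => u x * gker_prod B z x) ->
    cmod (cint (leb n) (fun x => u x * gker_prod B z x)) <=
      C * expR (\sum_(k < n | k != j) cmod (z k) ^+ 2) *
      expR (complex.Im (z j) ^+ 2 + lam * Lm * w `|complex.Re (z j)|).
Proof.
move=> pB l0 L1 C00 hL; have [c c0 hc] := integral_posdef pB.
have [C1 C10 hC1] := integral_wgauss_gker l0 L1 hL.
have s0 : 0 < Num.sqrt (2 * pi) :> R by rewrite sqrtr_gt0 mulr_gt0// pi_gt0.
pose S : R := \prod_(k < n | k != j) Num.sqrt (2 * pi).
have S0 : 0 < S by exact: prodr_gt0.
exists (2 * (C0 * (c * (C1 * S)))); first by rewrite !mulr_gt0.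
move=> u hu z mu.
pose g (k : 'I_n) (x : R) : R := (if k == j then wgauss lam x else 1) * cmod (gker (z k) x).
have g0 k x : 0 <= g k x.
  by rewrite mulr_ge0 ?cmod_ge0//; case: ifP => // _; exact: wgauss_ge0.
have mg k : measurable_fun setT (g k).
  apply: measurable_funM; last by apply: cmeas_cmod; exact: cmeas_gker.
  by case: (k == j); [exact: measurable_wgauss|exact: measurable_cst].
pose Ej := expR (complex.Im (z j) ^+ 2 + lam * Lm * w `|complex.Re (z j)|).
pose ck (k : 'I_n) : R := if k == j then C1 * Ej else Num.sqrt (2 * pi) * expR (cmod (z k) ^+ 2).
have hg k : (\int[@lebesgue_measure R]_x (g k x)%:E <= (ck k)%:E)%E.
  rewrite /g /ck; case: eqP => [->|_]; first exact: hC1.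
  by under eq_integral do rewrite mul1r; rewrite integral_cmod_gker.
have hP := integral_cV_prod_le mg g0 hg.
have ckE : \prod_(k < n) ck k = C1 * S * (expR (\sum_(k < n | k != j) cmod (z k) ^+ 2) * Ej).
  rewrite (bigD1 j)//= {1}/ck eqxx.
  rewrite (eq_bigr (fun k => Num.sqrt (2 * pi) * expR (cmod (z k) ^+ 2))); last first.
    by move=> k kj; rewrite /ck (negbTE kj).
  by rewrite big_split/= -/S -expR_sum; ring.
have mG : measurable_fun setT (fun x : 'cV[R]_n => (\prod_(k < n) g k (x k ord0))%:E).
  exact: measurable_cV_prod.
have mGB : measurable_fun setT (fun x : 'cV[R]_n => \prod_(k < n) g k ((B *m x) k ord0)).
  apply: measurable_prod => k _; apply: (measurableT_comp (mg k)).
  exact: measurable_mulmx_coord.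
have hint : (\int[leb n]_x (cmod (u x * gker_prod B z x))%:E <=
    (C0 * (c * (C1 * S * (expR (\sum_(k < n | k != j) cmod (z k) ^+ 2) * Ej))))%:E)%E.
  apply: (@le_trans _ _ (\int[leb n]_x (C0%:E * (\prod_(k < n) g k ((B *m x) k ord0))%:E))%E).
    apply: ae_ge0_le_integral => //.
    - by move=> x _; rewrite lee_fin cmod_ge0.
    - by apply/measurable_EFinP/cmeas_cmod.
    - by move=> x _; rewrite -EFinM lee_fin mulr_ge0 ?(ltW C00)// prodr_ge0.
    - by apply: emeasurable_funM; [exact: measurable_cst|exact/measurable_EFinP].
    apply: filterS hu => x hx _; rewrite -EFinM lee_fin cmodM /gker_prod cmod_prod.
    have p0 : 0 <= \prod_(k < n) cmod (gker (z k) ((B *m x) k ord0)).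
      by apply: prodr_ge0 => k _; exact: cmod_ge0.
    apply: le_trans (ler_wpM2r p0 hx) _.
    rewrite -mulrA ler_pM2l// /g big_split/=.
    have -> : \prod_(k < n) (if k == j then wgauss lam ((B *m x) k ord0) else 1) =
        wgauss lam ((B *m x) j ord0).
      by rewrite (bigD1 j)//= eqxx big1 ?mulr1// => k kj; rewrite (negbTE kj).
    exact: lexx.
  rewrite integralZl_ge0 ?(ltW C00)//; last by move=> x; exact: prodr_ge0.
  rewrite EFinM lee_pmul2l ?lte_fin//.
  rewrite (hc (fun x => (\prod_(k < n) g k (x k ord0))%:E) mG); last first.
    by move=> x; rewrite lee_fin prodr_ge0.
  by rewrite EFinM lee_pmul2l ?lte_fin// -ckE.
have ci : cintble (leb n) (fun x => u x * gker_prod B z x).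
  by apply: cintble_finite => //; apply: le_lt_trans hint (ltry _).
rewrite -lee_fin; apply: le_trans (cint_bound ci) _.
apply: le_trans (lee_wpmul2l _ hint) _; first by rewrite lee_fin.
by rewrite -EFinM lee_fin le_eqVlt; apply/orP; left; apply/eqP; rewrite -/Ej; ring.
Qed.

(** Gaussian decay along every axis bounds [f] by the Gaussian of the largest
    coordinate, hence by a Gaussian of the Euclidean norm. *)
Lemma cintble_directional n (B : 'M[R]_n) (lam : R) (f : 'cV[R]_n -> R[i]) :
  (0 < n)%N -> posdef B -> 0 < lam -> cmeas f ->
  (forall j, exists2 C : R, 0 < C &
     {ae leb n, forall x, cmod (f x) <= C * wgauss lam ((B *m x) j ord0)}) ->
  cintble (leb n) f.
Proof.
move=> n0 pB l0 mf hf; have [c c0 hc] := integral_posdef pB.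
have e0 : 0 < (4 * lam)^-1 by rewrite invr_gt0 mulr_gt0.
have [K hK] := wsmall e0.
have hw1 x : wgauss lam x <= expR (lam * K) * expR (- (x ^+ 2 / 4)).
  rewrite /wgauss -expRD ler_expR.
  have := ler_wpM2l (ltW l0) (hK `|x| (normr_ge0 x)).
  rewrite (real_normK (num_real _)).
  have -> : lam * ((4 * lam)^-1 * x ^+ 2 + K) = x ^+ 2 / 4 + lam * K.
    by field; rewrite gt_eqF.
  lra.
pose Cf j := projT1 (cid2 (hf j)).
have Cf0 j : 0 < Cf j by rewrite /Cf; case: cid2.
have Cfh j : {ae leb n, forall x, cmod (f x) <= Cf j * wgauss lam ((B *m x) j ord0)}.
  by rewrite /Cf; case: cid2.
pose C := \sum_j Cf j.
have CfC j : Cf j <= C.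
  by rewrite /C (bigD1 j)//= lerDl sumr_ge0// => i _; exact: ltW.
pose q (t : R) : R := expR (- (t ^+ 2 / (4 * n%:R))).
have nR : 0 < n%:R :> R by rewrite ltr0n.
have mq : measurable_fun setT q.
  apply: measurableT_comp => //; apply: measurableT_comp => //.
  by apply: measurable_funM => //; exact: measurable_funX.
have q0 t : 0 <= q t by exact: expR_ge0.
have hae : {ae leb n, forall x, cmod (f x) <=
    C * expR (lam * K) * \prod_(k < n) q ((B *m x) k ord0)}.
  have := @filter_forall _ _ _ _ (ae_filter_ringOfSetsType (leb n)) Cfh.
  apply: filterS => x hx.
  pose y k := (B *m x) k ord0.
  have [j _ hj] : exists2 j : 'I_n, true & forall k, y k ^+ 2 <= y j ^+ 2.
    case: (@arg_maxP _ _ _ (Ordinal n0) xpredT (fun k => y k ^+ 2)) => // j _ hj.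
    by exists j => // k; exact: hj.
  apply: le_trans (hx j) _.
  apply: (@le_trans _ _ (C * (expR (lam * K) * expR (- (y j ^+ 2 / 4))))).
    by apply: ler_pM; rewrite ?wgauss_ge0 ?(ltW (Cf0 j)).
  rewrite -mulrA ler_wpM2l ?(le_trans (ltW (Cf0 j)))// ler_wpM2l ?expR_ge0//.
  rewrite /q -expR_sum ler_expR sumrN lerN2.
  apply: (@le_trans _ _ (\sum_(k < n) y j ^+ 2 / (4 * n%:R))).
    by apply: ler_sum => k _; rewrite ler_wpM2r ?invr_ge0 ?mulr_ge0 ?(ltW nR)//; exact: hj.
  rewrite sumr_const card_ord -mulr_natr le_eqVlt; apply/orP; left; apply/eqP.
  by field; rewrite gt_eqF.
pose al : R := (Num.sqrt (2 * n%:R))^-1.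
have al0 : 0 < al by rewrite invr_gt0 sqrtr_gt0 mulr_gt0.
have iq : (\int[@lebesgue_measure R]_x (q x)%:E <= (al^-1 * Num.sqrt (2 * pi))%:E)%E.
  have E t : q t = expR (- (al * t + 0 - 0) ^+ 2 / 2).
    rewrite /q; congr expR; rewrite subr0 addr0 exprMn /al exprVn sqr_sqrtr ?mulr_ge0 ?(ltW nR)//.
    by field; rewrite gt_eqF.
  under eq_integral do rewrite E.
  rewrite (lebesgue_affine 0 al0 (G := fun t => (expR (- (t - 0) ^+ 2 / 2))%:E)).
  - by rewrite integral_gauss -EFinM.
  - by apply/measurable_EFinP; exact: (measurable_gauss 0).
  - by move=> x; rewrite lee_fin expR_ge0.
have hP := @integral_cV_prod_le R n (fun=> q) _ (fun=> mq) (fun=> q0) (fun=> iq).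
have mG : measurable_fun setT (fun x : 'cV[R]_n => (\prod_(k < n) q (x k ord0))%:E).
  exact: (@measurable_cV_prod R n (fun=> q) (fun=> mq)).
have mGB : measurable_fun setT (fun x : 'cV[R]_n => \prod_(k < n) q ((B *m x) k ord0)).
  apply: measurable_prod => k _; apply: (measurableT_comp mq).
  exact: measurable_mulmx_coord.
have C0 : 0 <= C by apply: sumr_ge0 => j _; exact: ltW.
apply: cintble_finite => //.
apply: (@le_lt_trans _ _ (\int[leb n]_x ((C * expR (lam * K))%:E * (\prod_(k < n) q ((B *m x) k ord0))%:E))%E).
  apply: ae_ge0_le_integral => //.
  - by move=> x _; rewrite lee_fin cmod_ge0.
  - by apply/measurable_EFinP/cmeas_cmod.
  - by move=> x _; rewrite -EFinM lee_fin !mulr_ge0 ?expR_ge0// prodr_ge0.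
  - by apply: emeasurable_funM; [exact: measurable_cst|exact/measurable_EFinP].
  by apply: filterS hae => x hx _; rewrite -EFinM lee_fin.
rewrite integralZl_ge0 ?mulr_ge0 ?expR_ge0//; last by move=> x; exact: prodr_ge0.
rewrite (hc (fun x => (\prod_(k < n) q (x k ord0))%:E) mG); last first.
  by move=> x; rewrite lee_fin prodr_ge0.
apply: (@le_lt_trans _ _ ((C * expR (lam * K))%:E * (c%:E *
  (\prod_(k < n) (al^-1 * Num.sqrt (2 * pi)))%:E))%E); last by rewrite -!EFinM ltry.
by rewrite lee_wpmul2l ?lee_fin ?mulr_ge0 ?expR_ge0// lee_wpmul2l ?lee_fin ?(ltW c0).
Qed.

End weighted.
End directional.

(** * The entire transform *)

Section fourier_side.
Context {R : realType}.
Local Notation leb n := (lebesgue_cV R n).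
Local Notation I := ((0 +i* 1)%C : R[i]).

Lemma cintble_prod d1 d2 (T1 : measurableType d1) (T2 : measurableType d2)
    (m1 : {sigma_finite_measure set T1 -> \bar R})
    (m2 : {sigma_finite_measure set T2 -> \bar R}) (f : T1 -> R[i]) (g : T2 -> R[i]) :
  cintble m1 f -> cintble m2 g -> cintble (m1 \x m2)%E (fun p => f p.1 * g p.2).
Proof.
move=> cf cg; have mf := cintble_meas cf; have mg := cintble_meas cg.
have mh : cmeas (fun p : T1 * T2 => f p.1 * g p.2).
  by apply: cmeasM; [exact: (cmeas_comp mf measurable_fst)|exact: (cmeas_comp mg measurable_snd)].
have ff : (\int[m1]_x (cmod (f x))%:E)%E \is a fin_num by exact/integrable_fin_num/cintble_cmod.
have fg : (\int[m2]_x (cmod (g x))%:E)%E \is a fin_num by exact/integrable_fin_num/cintble_cmod.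
apply: cintble_finite => //.
rewrite (@fubini_tonelli1 _ _ _ _ _ m1 m2 (fun p => (cmod (f p.1 * g p.2))%:E)); last first.
- by move=> p; rewrite lee_fin cmod_ge0.
- exact/measurable_EFinP/cmeas_cmod.
rewrite /fubini_F /=.
have E x : (\int[m2]_y (cmod (f x * g y))%:E = (cmod (f x) * fine (\int[m2]_x (cmod (g x))%:E))%:E)%E.
  under eq_integral do rewrite cmodM EFinM.
  rewrite integralZl_ge0 ?cmod_ge0//; first by rewrite -{1}(fineK fg).
  - exact: cmeas_cmod.
  - by move=> y; exact: cmod_ge0.
under eq_integral do rewrite E mulrC EFinM.
rewrite integralZl_ge0.
- by rewrite -(fineK ff) -EFinM ltry.
- by apply: fine_ge0; apply: integral_ge0 => y _; rewrite lee_fin cmod_ge0.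
- exact: cmeas_cmod.
- by move=> y; exact: cmod_ge0.
Qed.

Lemma cmeas_cint_section d1 d2 (T1 : measurableType d1) (T2 : measurableType d2)
    (m1 : {sigma_finite_measure set T1 -> \bar R})
    (m2 : {sigma_finite_measure set T2 -> \bar R}) (f : T1 * T2 -> R[i]) :
  cintble (m1 \x m2)%E f -> cmeas (fun y => cint m1 (fun x => f (x, y))).
Proof.
have h (g : T1 * T2 -> R) : (m1 \x m2)%E.-integrable setT (fun p => (g p)%:E) ->
    measurable_fun setT (fun y => Rintegral m1 setT (fun x => g (x, y))).
  move=> ig; have mG := measurable_fubini_G ig.
  by apply: (measurableT_comp (fine_measurable measurableT) mG).
by move=> [f1 f2]; split; [exact: (h _ f1)|exact: (h _ f2)].
Qed.

Lemma cexpiD (a b : R) : cexpi (a + b) = cexpi a * cexpi b.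
Proof.
by rewrite !cexpiE -cexpD; congr cexp; apply: complex_ext; rewrite /= ?addr0.
Qed.

Lemma cexpi_sum (J : Type) (r : seq J) (F : J -> R) :
  cexpi (\sum_(i <- r) F i) = \prod_(i <- r) cexpi (F i).
Proof.
apply: (big_morph _ cexpiD); rewrite cexpiE.
by rewrite -[RHS]cexp0; congr cexp; apply: complex_ext.
Qed.

Lemma cmod_cexpi (t : R) : cmod (cexpi t) = 1.
Proof. by rewrite cexpiE cmod_cexp expR0. Qed.

Lemma cmeas_cexpi d (T : measurableType d) (u : T -> R) : measurable_fun setT u ->
  cmeas (fun t => cexpi (u t)).
Proof.
move=> mu; under eq_fun do rewrite cexpiE.
by apply: cmeas_cexp; split => //=; exact: measurable_cst.
Qed.

(** The Fourier transform at [B eta], up to normalisation: in this coordinate its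
    bounds decay in the components of [eta]. *)
Definition ftrans n (B : 'M[R]_n) (f : 'cV[R]_n -> R[i]) (eta : 'cV[R]_n) : R[i] :=
  cint (leb n) (fun x => f x * cexpi (- dotv (B *m x) eta)).

Lemma measurable_dotv n d (T : measurableType d) (u v : T -> 'cV[R]_n) :
  measurable_fun setT u -> measurable_fun setT v ->
  measurable_fun setT (fun t => dotv (u t) (v t)).
Proof.
move=> mu mv; apply: measurable_sum => k; apply: measurable_funM.
  exact: (measurableT_comp (measurable_cV_coord k) mu).
exact: (measurableT_comp (measurable_cV_coord k) mv).
Qed.

(** Fubini's theorem and [fourier_gker]: pairing [f] with the kernels is pairing
    its Fourier transform with the kernels of the quarter-turned parameters. *)
Lemma gker_prod_fourier n (B : 'M[R]_n) (f : 'cV[R]_n -> R[i]) (z : 'I_n -> R[i]) :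
  cintble (leb n) f ->
  cmeas (fun eta => ftrans B f eta * gker_prod 1%:M (fun k => I * z k) eta) /\
  cint (leb n) (fun x => f x * gker_prod B z x) =
  (((Num.sqrt (2 * pi) ^+ n)^-1)%:C)%C *
  cint (leb n) (fun eta => ftrans B f eta * gker_prod 1%:M (fun k => I * z k) eta).
Proof.
move=> cf; have mf := cintble_meas cf.
pose P (eta : 'cV[R]_n) : R[i] := \prod_(k < n) gker (I * z k) (eta k ord0).
have PE eta : gker_prod 1%:M (fun k => I * z k) eta = P eta by rewrite /gker_prod mul1mx.
have cP : cintble (leb n) P.
  by apply: (@cintble_cV_prod R n (fun k => gker (I * z k))) => k; exact: cintble_gker.
pose Phi (p : 'cV[R]_n * 'cV[R]_n) : R[i] := f p.1 * P p.2 * cexpi (- dotv (B *m p.1) p.2).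
have me : measurable_fun setT (fun p : 'cV[R]_n * 'cV[R]_n => - dotv (B *m p.1) p.2).
  apply: measurableT_comp => //; apply: measurable_dotv => //.
  exact: (measurableT_comp (measurable_mulmx B) measurable_fst).
have cPhi : cintble (leb n \x leb n)%E Phi.
  apply: (cintble_mulb (M := 1)) => //; first exact: cintble_prod.
    exact: cmeas_cexpi.
  by move=> p; rewrite cmod_cexpi.
have msec1 x : measurable_fun setT (fun eta : 'cV[R]_n => - dotv (B *m x) eta).
  by apply: measurableT_comp => //; apply: measurable_dotv => //; exact: measurable_cst.
have msec2 (eta : 'cV[R]_n) : measurable_fun setT (fun x => - dotv (B *m x) eta).
  apply: measurableT_comp => //; apply: measurable_dotv; last exact: measurable_cst.
  exact: measurable_mulmx.
have c1 x : cintble (leb n) (fun eta => Phi (x, eta)).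
  apply: (@cintble_mulb _ _ _ _ (fun eta => f x * P eta)
    (fun eta => cexpi (- dotv (B *m x) eta)) 1); first exact: cintbleZ.
    exact: cmeas_cexpi.
  by move=> eta; rewrite cmod_cexpi.
have cfe (eta : 'cV[R]_n) : cintble (leb n) (fun x => f x * cexpi (- dotv (B *m x) eta)).
  apply: (cintble_mulb (M := 1)) => //; first exact: cmeas_cexpi.
  by move=> x; rewrite cmod_cexpi.
have E2 eta x : Phi (x, eta) = P eta * (f x * cexpi (- dotv (B *m x) eta)).
  by rewrite /Phi /=; ring.
have c2 eta : cintble (leb n) (fun x => Phi (x, eta)).
  by under eq_fun do rewrite E2; exact: cintbleZ.
have I2 eta : cint (leb n) (fun x => Phi (x, eta)) = ftrans B f eta * gker_prod 1%:M (fun k => I * z k) eta.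
  under eq_cint do rewrite E2.
  by rewrite cintZ// PE mulrC.
have s0 : Num.sqrt (2 * pi) != 0 :> R.
  by rewrite gt_eqF// sqrtr_gt0 mulr_gt0// pi_gt0.
have I1 x : cint (leb n) (fun eta => Phi (x, eta)) =
    ((Num.sqrt (2 * pi) ^+ n)%:C)%C * (f x * gker_prod B z x).
  have E1 eta : Phi (x, eta) = f x * \prod_(k < n)
      (gker (I * z k) (eta k ord0) * cexpi (- (eta k ord0 * (B *m x) k ord0))).
    rewrite /Phi /= -mulrA big_split/=; congr (_ * (_ * _)).
    rewrite -cexpi_sum; congr cexpi; rewrite sumrN; congr (- _).
    by apply: eq_bigr => k _; rewrite mulrC.
  have ck (k : 'I_n) : cintble (@lebesgue_measure R)
      (fun t => gker (I * z k) t * cexpi (- (t * (B *m x) k ord0))).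
    apply: (cintble_mulb (M := 1)); first exact: cintble_gker.
      apply: cmeas_cexpi; apply: measurableT_comp => //.
      by apply: measurable_funM => //; exact: measurable_cst.
    by move=> t; rewrite cmod_cexpi.
  under eq_cint do rewrite E1.
  rewrite cintZ; last first.
    exact: (cintble_cV_prod (E := fun k t => gker (I * z k) t * cexpi (- (t * (B *m x) k ord0)))).
  rewrite (cint_cV_prod (E := fun k t => gker (I * z k) t * cexpi (- (t * (B *m x) k ord0))))//.
  rewrite (eq_bigr (fun k => ((Num.sqrt (2 * pi))%:C)%C * gker (z k) ((B *m x) k ord0))); last first.
    by move=> k _; exact: fourier_gker.
  rewrite big_split/= prodr_const card_ord -rmorphXn/= /gker_prod; ring.
split.
  have := cmeas_cint_section cPhi.
  by under eq_fun do rewrite I2.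
have [F1 F2] := cint_fubini cPhi c1 c2.
have cfg : cintble (leb n) (fun x => f x * gker_prod B z x).
  apply: (cintble_mulb cf); first exact: cmeas_gker_prod.
  exact: cmod_gker_prod.
have E : cint (leb n) (fun eta => ftrans B f eta * gker_prod 1%:M (fun k => I * z k) eta) =
    ((Num.sqrt (2 * pi) ^+ n)%:C)%C * cint (leb n) (fun x => f x * gker_prod B z x).
  rewrite -cintZ//; under eq_cint do rewrite -I2.
  rewrite F2 -F1; apply: eq_cint => x; exact: I1.
rewrite E mulrA -rmorphM/= mulVf ?mul1r//.
by rewrite expf_neq0.
Qed.

End fourier_side.

Section entire.
Context {R : realType} (w : R -> R) (hw : weight_function w).
Hypothesis wsmall : forall e : R, 0 < e -> exists K : R, forall t, 0 <= t ->
  w t <= e * t ^+ 2 + K.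
Local Notation leb n := (lebesgue_cV R n).
Local Notation I := ((0 +i* 1)%C : R[i]).

Lemma uniform_const (n : nat) (P : 'I_n -> R -> Prop) :
  (forall j c c', c <= c' -> P j c -> P j c') ->
  (forall j, exists2 c, 0 < c & P j c) -> exists2 c, 0 < c & forall j, P j c.
Proof.
move=> mono H; pose c j := projT1 (cid2 (H j)).
have c0 j : 0 < c j by rewrite /c; case: cid2.
have cP j : P j (c j) by rewrite /c; case: cid2.
exists (1 + \sum_j c j); first by rewrite ltr_pwDl// sumr_ge0// => j _; exact: ltW.
move=> j; apply: mono (cP j); rewrite (bigD1 j)//= addrCA lerDl addr_ge0// sumr_ge0//.
by move=> k _; exact: ltW.
Qed.

(** In each variable separately the transform is entire; its bounds near the
    two axes come from [f] and from its Fourier transform, and the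
    Phragmen-Lindelof property spreads them to the whole plane. *)
Lemma entire_bound n (B : 'M[R]_n) (f : 'cV[R]_n -> R[i]) (lam Lm Cm Lp : R) :
  (0 < n)%N -> posdef B -> cmeas f -> 0 < lam -> 1 <= Lm -> 1 <= Lp ->
  (forall t s, 0 <= t -> 0 <= s -> w (t + s) <= Lm * (w t + w s) + Cm) ->
  PL_admissible w (pi / 2) Lp%:E ->
  (forall j, exists2 C : R, 0 < C &
     {ae leb n, forall x, cmod (f x) <= C * wgauss w lam ((B *m x) j ord0)}) ->
  (forall j, exists2 C : R, 0 < C &
     {ae leb n, forall eta, cmod (ftrans B f eta) <= C * wgauss w lam (eta j ord0)}) ->
  exists2 C : R, 0 < C & forall j z,
    cmod (cint (leb n) (fun x => f x * gker_prod B z x)) <=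
    C * (expR (\sum_(k < n | k != j) cmod (z k) ^+ 2) *
         expR (Lp * (lam * Lm * w (cmod (z j))))).
Proof.
move=> n0 pB mf l0 L1 Lp1 hL hPL hf hF.
have cf := cintble_directional wsmall n0 pB l0 mf hf.
have lL0 : 0 < lam * Lm by rewrite mulr_gt0// (lt_le_trans _ L1).
apply: uniform_const.
  move=> j c c' cc H z; apply: le_trans (H z) _.
  by rewrite ler_wpM2r// mulr_ge0// expR_ge0.
move=> j.
have [C1 C10 hC1] := hf j; have [C2 C20 hC2] := hF j.
have [K1 K10 hK1] := directional_bound hw wsmall j pB l0 L1 C10 hL.
have [K2 K20 hK2] := directional_bound hw wsmall j (posdef1 n) l0 L1 C20 hL.
have [K3 K30 hK3] := PL_axes hw wsmall Lp1 hPL lL0.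
have s0 : 0 < Num.sqrt (2 * pi) :> R by rewrite sqrtr_gt0 mulr_gt0// pi_gt0.
pose K2' := (Num.sqrt (2 * pi) ^+ n)^-1 * K2.
have K2'0 : 0 < K2' by rewrite mulr_gt0// invr_gt0 exprn_gt0.
pose K := K1 + K2'.
have K0 : 0 < K by rewrite addr_gt0.
exists (K3 * K); first by rewrite mulr_gt0.
move=> z.
(* All parameters but the [j]-th are frozen. *)
pose zz (t : R[i]) (k : 'I_n) : R[i] := if k == j then t else z k.
pose S := \sum_(k < n | k != j) cmod (z k) ^+ 2.
have SE t : \sum_(k < n | k != j) cmod (zz t k) ^+ 2 = S.
  by apply: eq_bigr => k kj; rewrite /zz (negbTE kj).
pose rest (x : 'cV[R]_n) : R[i] := f x * \prod_(k < n | k != j) gker (z k) ((B *m x) k ord0).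
have E t x : f x * gker_prod B (zz t) x = rest x * gker t ((B *m x) j ord0).
  rewrite /rest /gker_prod (bigD1 j)//= {1}/zz eqxx mulrCA mulrC; congr (_ * _ * _).
  by apply: eq_bigr => k kj; rewrite /zz (negbTE kj).
have crest : cintble (leb n) rest.
  apply: (cintble_mulb (M := expR S)) => //.
    under eq_fun do rewrite big_mkcond/=.
    apply: cmeas_prod => k; case: (k != j); last exact: cmeas_cst.
    by apply: cmeas_gker; exact: measurable_mulmx_coord.
  move=> x; rewrite cmod_prod expR_sum; apply: ler_prod => k _.
  by rewrite cmod_ge0 cmod_gker_le.
pose H t := cint (leb n) (fun x => f x * gker_prod B (zz t) x).
have HE : H = gker_transform (leb n) rest (fun x => (B *m x) j ord0).
  by apply/funext => t; apply: eq_cint => x; exact: E.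
have dH t : derivable (H : R[i]^o -> R[i]^o) t 1.
  rewrite HE; apply: derivable_gker_transform => //.
  exact: measurable_mulmx_coord.
have zzj t : zz t j = t by rewrite /zz eqxx.
have b1 t : cmod (H t) <= K * expR S * expR (complex.Im t ^+ 2 + lam * Lm * w `|complex.Re t|).
  have := hK1 f hC1 (zz t) _; rewrite zzj SE => h.
  apply: le_trans (h _) _.
    by apply: cmeasM => //; exact: cmeas_gker_prod.
  by rewrite ler_wpM2r ?expR_ge0// ler_wpM2r ?expR_ge0// lerDl ltW.
have b2 t : cmod (H t) <= K * expR S * expR (complex.Re t ^+ 2 + lam * Lm * w `|complex.Im t|).
  have [mF HF] := gker_prod_fourier B (zz t) cf; rewrite /H HF.
  rewrite cmodM cmod_real ger0_norm ?invr_ge0 ?exprn_ge0 ?(ltW s0)//.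
  have := hK2 (ftrans B f) _ (fun k => I * zz t k) mF.
  have hae : {ae leb n, forall x, cmod (ftrans B f x) <= C2 * wgauss w lam ((1%:M *m x) j ord0)}.
    by apply: filterS hC2 => x; rewrite mul1mx.
  have mI u : cmod (I * u) = cmod u.
    by rewrite cmodM [cmod I](_ : _ = 1) ?mul1r// /cmod /= expr0n /= expr1n add0r sqrtr1.
  move=> /(_ hae); rewrite (eq_bigr (fun k => cmod (zz t k) ^+ 2)); last by move=> k _; rewrite mI.
  rewrite SE zzj.
  have -> : complex.Im (I * t) = complex.Re t by rewrite ImM /= mul0r add0r mul1r.
  have -> : complex.Re (I * t) = - complex.Im t by rewrite ReM /= mul0r sub0r mul1r.
  rewrite normrN => h.
  apply: le_trans (ler_wpM2l _ h) _; first by rewrite invr_ge0 exprn_ge0 ?(ltW s0).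
  rewrite !mulrA ler_wpM2r ?expR_ge0// ler_wpM2r ?expR_ge0//.
  by rewrite -/K2' lerDr ltW.
have := hK3 H (K * expR S) _ dH b1 b2 (z j).
have -> : H (z j) = cint (leb n) (fun x => f x * gker_prod B z x).
  apply: eq_cint => x; congr (_ * _); apply: eq_bigr => k _.
  by rewrite /zz; case: eqP => // ->.
rewrite mulr_ge0 ?expR_ge0 ?(ltW K0)// => /(_ isT); rewrite -/S.
by rewrite !mulrA.
Qed.

End entire.

(** * Cauchy estimates for the Hermite coefficients *)

Section hermite_coefficients.
Context {R : realType}.
Local Notation leb n := (lebesgue_cV R n).

Lemma measurable_hfun n : measurable_fun setT (hfun n : R -> R).
Proof.
apply: measurable_funM; last first.
  apply: measurableT_comp => //; apply: measurable_funM; last exact: measurable_cst.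
  by apply: measurableT_comp => //; exact: measurable_funX.
apply: measurable_funM; last exact: measurable_cst.
apply: (eq_measurable_fun (fun x : R => \sum_(i < size (hpoly n)) (hpoly n)`_i * x ^+ i)).
  by move=> x _; rewrite horner_coef.
apply: measurable_sum => i; apply: measurable_funM; first exact: measurable_cst.
exact: measurable_funX.
Qed.

(** Cauchy's estimate on the circle of radius [r]. *)
Lemma cmod_hfun_le (r x : R) n : 0 <= r -> cmod ((hfun n x * r ^+ n)%:C)%C <= expR (r ^+ 2).
Proof.
move=> r0; set c := (X in cmod X); apply/ler_addgt0Pr => e e0.
have /cvgrPdist_lt /(_ e e0) [N _ /(_ N (leqnn N))] := @cvg_gker_mean R r n n.+1 x r0 (ltnSn n).
rewrite -/c sub0r normrN ger0_norm ?cmod_ge0// => h.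
have := @cmod_gker_mean R r n (N + n.+1).*2 x r0 _; rewrite double_gt0 addnS => /(_ isT) h2.
set m := gker_mean _ _ _ _ in h2.
have -> : c = m - (m - c) by rewrite opprB addrC subrK.
apply: le_trans (cmodB _ _) _; apply: lerD => //; apply: ltW.
by move: h; rewrite addnS.
Qed.

Lemma cmod_prodB (J : Type) (s : seq J) (a b : J -> R[i]) (M : J -> R) :
  (forall i, 1 <= M i) -> (forall i, cmod (a i) <= M i) -> (forall i, cmod (b i) <= M i) ->
  cmod (\prod_(i <- s) a i - \prod_(i <- s) b i) <=
  (\prod_(i <- s) M i) * \sum_(i <- s) cmod (a i - b i).
Proof.
move=> M1 aM bM; have M0 i : 0 <= M i by exact: le_trans (M1 i).
elim: s => [|i s IH]; first by rewrite !big_nil subrr cmod0 mulr0.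
rewrite !big_cons; set A := \prod_(j <- s) a j; set B := \prod_(j <- s) b j.
set P := \prod_(j <- s) M j; set S := \sum_(j <- s) _.
have P0 : 0 <= P by apply: prodr_ge0 => j _.
have BP : cmod B <= P.
  by rewrite /B cmod_prod; apply: ler_prod => j _; rewrite cmod_ge0 bM.
have -> : a i * A - b i * B = a i * (A - B) + (a i - b i) * B by ring.
apply: le_trans (cmodD _ _) _; rewrite !cmodM addrC mulrDr; apply: lerD.
  rewrite mulrC; apply: ler_wpM2r; first exact: cmod_ge0.
  by apply: le_trans BP _; rewrite ler_peMl.
by rewrite -mulrA; apply: ler_pM; rewrite ?cmod_ge0.
Qed.

Lemma cvg_sum0 (J : Type) (s : seq J) (u : J -> nat -> R) :
  (forall i, u i N @[N --> \oo] --> (0 : R)) ->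
  (\sum_(i <- s) u i N) @[N --> \oo] --> (0 : R).
Proof.
move=> hu; elim: s => [|i s IH].
  by under eq_fun do rewrite big_nil; exact: cvg_cst.
have h := cvgD (hu i) IH; rewrite addr0 in h.
by under eq_fun do rewrite big_cons; exact: h.
Qed.

Lemma cintble_hfun n (B : 'M[R]_n) (f : 'cV[R]_n -> R[i]) (alpha : 'I_n -> nat) :
  cintble (leb n) f ->
  cintble (leb n) (fun x => f x * ((\prod_(k < n) hfun (alpha k) ((B *m x) k ord0))%:C)%C).
Proof.
move=> cf; apply: (@cintble_mulb _ _ _ _ f _ (\prod_(k < n) expR 1)) => //.
  apply: cmeas_real; apply: measurable_prod => k _.
  exact: (measurableT_comp (measurable_hfun _) (measurable_mulmx_coord B k)).
move=> x; rewrite rmorph_prod cmod_prod; apply: ler_prod => k _.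
rewrite cmod_ge0/=; have := @cmod_hfun_le 1 ((B *m x) k ord0) (alpha k) ler01.
by rewrite !expr1n mulr1.
Qed.

(** Cauchy's formula on a torus, discretised over roots of unity: the Hermite
    coefficients of [f] are the Taylor coefficients of its transform. *)
Lemma torus_bound n (B : 'M[R]_n) (f : 'cV[R]_n -> R[i]) (alpha : 'I_n -> nat)
    (rad : 'I_n -> R) (M : R) :
  cintble (leb n) f -> (forall k, 0 <= rad k) ->
  (forall z, (forall k, cmod (z k) = rad k) ->
     cmod (cint (leb n) (fun x => f x * gker_prod B z x)) <= M) ->
  cmod (cint (leb n) (fun x => f x * ((\prod_(k < n) hfun (alpha k) ((B *m x) k ord0))%:C)%C)) *
    \prod_(k < n) rad k ^+ alpha k <= M.
Proof.
move=> cf rad0 HM; have mf := cintble_meas cf.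
pose m := (\sum_(k < n) alpha k).+1.
have am k : (alpha k < m)%N by rewrite /m ltnS (bigD1 k)//= leq_addr.
(* [N + m] terms of the exponential series make a polynomial of degree less than
   [2 (N + m)] in the parameter. *)
pose N' N := (N + m).*2.
have N'0 N : (0 < N' N)%N by rewrite /N' double_gt0 addnS.
pose fN N x := f x * \prod_(k < n) gker_mean (rad k) (alpha k) (N' N) ((B *m x) k ord0).
pose h (x : 'cV[R]_n) := \prod_(k < n) (((hfun (alpha k) ((B *m x) k ord0)) * rad k ^+ alpha k)%:C)%C.
pose G := \prod_(k < n) expR (rad k ^+ 2).
have G0 : 0 <= G by apply: prodr_ge0 => k _; exact: expR_ge0.
have mmean N (k : 'I_n) : cmeas (fun x : 'cV[R]_n => gker_mean (rad k) (alpha k) (N' N) ((B *m x) k ord0)).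
  apply: cmeasM; first exact: cmeas_cst.
  apply: cmeas_sum => l; apply: cmeasM; first exact: cmeas_cst.
  by apply: cmeas_gker; exact: measurable_mulmx_coord.
have mh : cmeas h.
  apply: cmeas_prod => k; apply: cmeas_real; apply: measurable_funM; last exact: measurable_cst.
  exact: (measurableT_comp (measurable_hfun _) (measurable_mulmx_coord B k)).
have hG x : cmod (h x) <= G.
  by rewrite cmod_prod; apply: ler_prod => k _; rewrite cmod_ge0 cmod_hfun_le.
have fNG N (x : 'cV[R]_n) : cmod (\prod_(k < n) gker_mean (rad k) (alpha k) (N' N) ((B *m x) k ord0)) <= G.
  by rewrite cmod_prod; apply: ler_prod => k _; rewrite cmod_ge0 cmod_gker_mean.
have cvf x : cmod (fN N x - f x * h x) @[N --> \oo] --> (0 : R).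
  pose bnd N := cmod (f x) * (G * \sum_(k < n) cmod (gker_mean (rad k) (alpha k) (N' N) ((B *m x) k ord0) -
      ((hfun (alpha k) ((B *m x) k ord0) * rad k ^+ alpha k)%:C)%C)).
  pose dif N (k : 'I_n) := cmod (gker_mean (rad k) (alpha k) (N' N) ((B *m x) k ord0) -
      ((hfun (alpha k) ((B *m x) k ord0) * rad k ^+ alpha k)%:C)%C).
  have h1 : (\sum_(k < n) dif N k) @[N --> \oo] --> (0 : R).
    by apply: (@cvg_sum0 _ _ (fun k N => dif N k)) => k; exact: cvg_gker_mean.
  have bcv : bnd N @[N --> \oo] --> cmod (f x) * (G * 0).
    by apply: cvgMr; apply: cvgMr; exact: h1.
  rewrite !mulr0 in bcv.
  apply: (squeeze_cvgr _ (cvg_cst 0) bcv); apply: nearW => N /=.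
  rewrite cmod_ge0/= /fN -mulrBr cmodM ler_wpM2l ?cmod_ge0//.
  apply: cmod_prodB => k; first by rewrite -expR0 ler_expR sqr_ge0.
    exact: cmod_gker_mean.
  exact: cmod_hfun_le.
have key : cmod (cint (leb n) (fun x => f x * h x)) <= M.
  apply: (@cint_dominated_le _ _ _ _ fN _ (fun x => G * cmod (f x)) M) => //.
  - by move=> N; apply: cmeasM => //; exact: cmeas_prod.
  - exact: cmeasM.
  - exact: (integrableZl measurableT G (cintble_cmod cf)).
  - by move=> N x; rewrite cmodM mulrC ler_wpM2r ?cmod_ge0.
  - by move=> x; rewrite cmodM mulrC ler_wpM2r ?cmod_ge0.
  move=> N; set Q := N' N.
  (* Expanding the product of means gives a mean over points of the torus. *)
  pose zf (p : {ffun 'I_n -> 'I_Q}) (k : 'I_n) : R[i] := ((rad k)%:C)%C * unity_root Q ^+ p k.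
  pose cc (p : {ffun 'I_n -> 'I_Q}) : R[i] :=
    \prod_(k < n) (Q%:R^-1 * (unity_root Q ^+ p k) ^- alpha k).
  have E x : fN N x = \sum_(p : {ffun 'I_n -> 'I_Q}) cc p * (f x * gker_prod B (zf p) x).
    rewrite /fN -/Q /gker_mean.
    under eq_bigr do rewrite big_distrr/=.
    rewrite bigA_distr_bigA/= big_distrr/=; apply: eq_bigr => p _.
    rewrite mulrCA; congr (_ * _); rewrite /cc /gker_prod -big_split/=.
    by apply: eq_bigr => k _; rewrite mulrA.
  have cp (p : {ffun 'I_n -> 'I_Q}) : cintble (leb n) (fun x => f x * gker_prod B (zf p) x).
    by apply: (cintble_mulb cf); [exact: cmeas_gker_prod|exact: cmod_gker_prod].
  under eq_cint do rewrite E.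
  rewrite cint_sum; last by move=> p; exact: cintbleZ.
  apply: le_trans (cmod_sum _ _ _) _.
  have ccE p : cmod (cc p) = Q%:R^-1 ^+ n.
    rewrite cmod_prod (eq_bigr (fun=> Q%:R^-1)) ?prodr_const ?card_ord// => k _.
    by rewrite cmodM !cmodV cmod_nat !cmodX cmod_zroot !expr1n invr1 mulr1.
  apply: (@le_trans _ _ (\sum_(p : {ffun 'I_n -> 'I_Q}) Q%:R^-1 ^+ n * M)).
    apply: ler_sum => p _; rewrite cintZ// cmodM ccE ler_wpM2l ?exprn_ge0 ?invr_ge0//.
    apply: HM => k; rewrite /zf cmodM cmod_real cmodX cmod_zroot expr1n mulr1.
    by rewrite ger0_norm.
  rewrite sumr_const card_ffun !card_ord -[X in X <= _]mulr_natl natrX mulrA -exprMn mulfV ?expr1n ?mul1r//.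
  by rewrite pnatr_eq0 -lt0n N'0.
pose g (x : 'cV[R]_n) := f x * ((\prod_(k < n) hfun (alpha k) ((B *m x) k ord0))%:C)%C.
have cg : cintble (leb n) g by exact: cintble_hfun.
have P0 : 0 <= \prod_(k < n) rad k ^+ alpha k by apply: prodr_ge0 => k _; rewrite exprn_ge0.
apply: le_trans key; rewrite le_eqVlt; apply/orP; left; apply/eqP.
rewrite -/g -[X in _ * X](ger0_norm P0) -cmod_real mulrC -cmodM -cintZ//; congr cmod.
apply: eq_cint => x; rewrite /h /g mulrCA; congr (_ * _).
rewrite !rmorph_prod -big_split/=; apply: eq_bigr => k _.
by apply: complex_ext; rewrite ?ReM ?ImM /=; ring.
Qed.

(** Each estimate distinguishes one axis; in their geometric mean every exponent
    [alpha k] meets the same product of radii [t ^+ n]. *)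
Lemma axis_mean n (alpha : 'I_n -> nat) (X E t rho rho1 : R) :
  (0 < n)%N -> 0 <= X -> 0 <= t -> 0 <= rho -> 0 <= rho1 ->
  rho ^+ n.-1 * rho1 = t ^+ n ->
  (forall j, X * \prod_(k < n) (if k == j then rho1 else rho) ^+ alpha k <= E) ->
  X * t ^+ (\sum_(k < n) alpha k) <= E.
Proof.
move=> n0 X0 t0 r0 r10 ht H.
have p0 j : 0 <= \prod_(k < n) (if k == j then rho1 else rho) ^+ alpha k.
  by apply: prodr_ge0 => k _; case: ifP => _; exact: exprn_ge0.
have E0 : 0 <= E by apply: le_trans (H (Ordinal n0)); rewrite mulr_ge0.
rewrite -(@ler_pXn2r _ n) ?nnegrE// ?mulr_ge0 ?exprn_ge0//.
have -> : (X * t ^+ (\sum_(k < n) alpha k)) ^+ n =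
    \prod_(j < n) (X * \prod_(k < n) (if k == j then rho1 else rho) ^+ alpha k).
  rewrite big_split/= prodr_const card_ord exprMn; congr (_ * _).
  rewrite exchange_big/= -exprM mulnC exprM -ht -prodrXr; apply: eq_bigr => k _.
  rewrite prodrXl; congr (_ ^+ _); rewrite (bigD1 k)//= eqxx mulrC; congr (_ * _).
  rewrite (eq_bigr (fun=> rho)); last by move=> j jk; rewrite eq_sym (negbTE jk).
  by rewrite prodr_const cardC1 card_ord.
rewrite -[X in _ <= _ ^+ X](card_ord n) -prodr_const; apply: ler_prod => j _.
by rewrite mulr_ge0//= H.
Qed.

Lemma sqrtrX (x : R) n : 0 <= x -> Num.sqrt (x ^+ n) = Num.sqrt x ^+ n.
Proof.
by move=> x0; rewrite -{1}(sqr_sqrtr x0) -exprM mulnC exprM sqrtr_sqr ger0_norm// exprn_ge0.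
Qed.

(** The normalisation of the Hermite functions leaves [sqrt (alpha!)]. *)
Lemma cmod_hermite_coef d (A : 'M[R]_d) (f : 'cV[R]_d -> R[i]) (alpha : 'I_d -> nat) :
  cintble (leb d) (fun x => f x * ((\prod_(k < d) hfun (alpha k) ((sqrtmx A *m x) k ord0))%:C)%C) ->
  cmod (hermite_coef A f alpha) =
  (\det A) `^ (1 / 4) * pi `^ (- (d%:R / 4)) * Num.sqrt (mfact alpha)%:R *
  ((Num.sqrt 2)^-1 ^+ mabs alpha *
   cmod (cint (leb d) (fun x => f x * ((\prod_(k < d) hfun (alpha k) ((sqrtmx A *m x) k ord0))%:C)%C))).
Proof.
move=> cg; set K := (X in X * (_ * _)).
have F0 : 0 < (mfact alpha)%:R :> R.
  by rewrite ltr0n /mfact; apply: prodn_gt0 => k; exact: fact_gt0.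
have s20 : 0 < Num.sqrt 2 :> R by rewrite sqrtr_gt0.
have K0 : 0 <= K by rewrite !mulr_ge0 ?powR_ge0 ?sqrtr_ge0.
have E x : f x * ((hermiteA A alpha x)%:C)%C = ((K * (Num.sqrt 2)^-1 ^+ mabs alpha)%:C)%C *
    (f x * ((\prod_(k < d) hfun (alpha k) ((sqrtmx A *m x) k ord0))%:C)%C).
  rewrite mulrCA -rmorphM/=; congr (_ * (_)%:C)%C.
  rewrite /hermiteA hermiteE [(_ * _) `^ _]powRN [1 / 2]mul1r powR12_sqrt ?mulr_ge0 ?exprn_ge0 ?(ltW F0)//.
  rewrite sqrtrM ?exprn_ge0// sqrtrX// /K exprVn.
  rewrite -[X in _ * X * \prod_(_ < _) _](sqr_sqrtr (ltW F0)).
  have h1 : Num.sqrt (mfact alpha)%:R != 0 :> R by rewrite gt_eqF// sqrtr_gt0.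
  have h2 : Num.sqrt 2 ^+ mabs alpha != 0 :> R by rewrite expf_neq0// gt_eqF.
  by field; rewrite h1 h2.
rewrite /hermite_coef -[cintegral _]/(cint _ _).
under eq_cint do rewrite E.
rewrite cintZ// cmodM cmod_real ger0_norm ?mulrA//.
by apply: mulr_ge0 => //; rewrite exprn_ge0// invr_ge0 ltW.
Qed.

Lemma dotv_stdbasis n (v : 'cV[R]_n) j : dotv v (stdbasis R j) = v j ord0.
Proof.
rewrite /dotv (bigD1 j)//= big1 ?addr0; first by rewrite mxE !eqxx mulr1.
by move=> k kj; rewrite mxE (negbTE kj) mulr0.
Qed.

End hermite_coefficients.

(** * The choice of radii *)

Section balancing.
Context {R : realType} (w : R -> R) (hw : weight_function w).

(** The exponent to be minimised is the expression in the interpolation index: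
    [rho] and [rho1] are determined by its variable [s], up to a factor
    [d^(-1/2)] in [rho] that the dilation of [t] compensates. *)
Lemma optimal_radii (d : nat) (r kap LQ Lk CQ Ck : R) :
  (2 <= d)%N -> 0 < r -> 0 <= kap -> 0 <= LQ -> r * (kap * LQ * Lk) <= 1 ->
  (forall t, 0 <= t ->
     w (d%:R `^ ((d%:R - 1) / (2 * d%:R)) * t) <= Lk * w t + Ck) ->
  (forall t, 0 <= t -> exists2 s : R, 0 < s &
     (d%:R - 1) / (2 * d%:R) * s `^ (2 / (d%:R - 1)) + kap * w (t ^+ d / s) <=
     LQ * kap * w t + CQ) ->
  forall t, 0 < t -> exists rho rho1 : R,
    [/\ 0 <= rho, 0 <= rho1, rho ^+ d.-1 * rho1 = t ^+ d &
      (d.-1)%:R * (rho ^+ 2 / 2) + kap * w rho1 <= r^-1 * w t + (LQ * kap * Ck + CQ)].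
Proof.
move=> d2 r0 k0 L0 hr hk hQ t t0.
have d0 : (0 < d)%N by exact: ltn_trans d2.
have dR : 0 < d%:R :> R by rewrite ltr0n.
have d1E : (d.-1)%:R = d%:R - 1 :> R by rewrite -subn1 natrB.
have d1R : 0 < d%:R - 1 :> R by rewrite -d1E ltr0n -subn1 subn_gt0.
set kd := d%:R `^ ((d%:R - 1) / (2 * d%:R)) in hk.
have kd0 : 0 < kd by exact: powR_gt0.
have [s s0 hs] := hQ (kd * t) (mulr_ge0 (ltW kd0) (ltW t0)).
have sd0 : 0 < Num.sqrt d%:R :> R by rewrite sqrtr_gt0.
have kdE : kd ^+ d = Num.sqrt d%:R ^+ d.-1.
  rewrite -(powR_mulrn d (ltW kd0)) -powRrM -powR12_sqrt ?(ltW dR)//.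
  rewrite -(powR_mulrn d.-1 (powR_ge0 _ _)) -powRrM d1E; congr (_ `^ _).
  by field; rewrite gt_eqF.
have sE : (s `^ (1 / (d%:R - 1))) ^+ d.-1 = s.
  rewrite -(powR_mulrn d.-1 (powR_ge0 _ _)) -powRrM d1E mul1r mulVf ?gt_eqF//.
  by rewrite powRr1// ltW.
exists (s `^ (1 / (d%:R - 1)) / Num.sqrt d%:R), ((kd * t) ^+ d / s); split.
- by rewrite divr_ge0 ?powR_ge0// ltW.
- by rewrite divr_ge0 ?exprn_ge0 ?mulr_ge0 ?(ltW kd0) ?(ltW t0)// ltW.
- rewrite expr_div_n sE exprMn kdE.
  have h : Num.sqrt d%:R ^+ d.-1 != 0 :> R by rewrite expf_neq0// gt_eqF.
  by move: (_ ^+ d.-1) h => P P0; field; rewrite P0 gt_eqF.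
have e2 : (s `^ (1 / (d%:R - 1))) ^+ 2 = s `^ (2 / (d%:R - 1)).
  by rewrite -(powR_mulrn 2 (powR_ge0 _ _)) -powRrM; congr (_ `^ _); field; rewrite gt_eqF.
have -> : (d.-1)%:R * ((s `^ (1 / (d%:R - 1)) / Num.sqrt d%:R) ^+ 2 / 2) =
    (d%:R - 1) / (2 * d%:R) * s `^ (2 / (d%:R - 1)).
  by rewrite d1E expr_div_n e2 sqr_sqrtr ?(ltW dR)//; field; rewrite gt_eqF.
apply: le_trans hs _.
have h1 := ler_wpM2l (mulr_ge0 L0 k0) (hk t (ltW t0)).
have h2 : kap * LQ * Lk * w t <= r^-1 * w t.
  by rewrite ler_wpM2r ?(weight_ge0 hw (ltW t0))// -[X in X <= _](mulKf (lt0r_neq0 r0)) ler_piMr ?invr_ge0 ?(ltW r0).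
have -> : r^-1 * w t + (LQ * kap * Ck + CQ) = (r^-1 * w t + LQ * kap * Ck) + CQ by rewrite addrA.
rewrite lerD2r; apply: le_trans h1 _.
by rewrite mulrDr lerD2r; apply: le_trans h2; rewrite le_eqVlt; apply/orP; left; apply/eqP; ring.
Qed.

End balancing.

(** * Decay of the Hermite coefficients *)

Theorem theorem4p4 (R : realType) (d : nat) (hd : (2 <= d)%N)
  (A : 'M[R]_d) (hA : posdef A)
  (w : R -> R) (hw : weight_function w) (hbeta : beta2star w)
  (hdelta : cond_delta w) (hQI : quadratic_interpolation d w)
  (f : 'cV[R]_d -> R[i]) (hf : L2 f)
  (lambda : R) (hlambda : 0 < lambda)
  (hfbound : forall j : 'I_d, exists2 C : R, 0 < C &
     {ae lebesgue_cV R d, forall x,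
       let a := dotv (A *m x) (invmx (sqrtmx A) *m stdbasis R j) in
       cmod (f x) <= C * expR (- (1 / 2) * `|a| ^+ 2 + lambda * w `|a|)})
  (hFbound : forall j : 'I_d, exists2 C : R, 0 < C &
     {ae lebesgue_cV R d, forall xi,
       let a := dotv (invmx A *m xi) (sqrtmx A *m stdbasis R j) in
       cmod (fourier f xi) <=
         C * expR (- (1 / 2) * `|a| ^+ 2 + lambda * w `|a|)}) :
  forall r : R, 0 < r -> (r%:E < (C3 d w lambda * lambda%:E)^-1)%E ->
  exists2 C : R, 0 < C & forall alpha : 'I_d -> nat,
    ((cmod (hermite_coef A f alpha))%:E <=
       (C * Num.sqrt (mfact alpha)%:R)%:E *
       expeR (- ((r^-1)%:E * young_conjugate w (r * (mabs alpha)%:R))))%E.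
Proof.
have d0 : (0 < d)%N by exact: ltn_trans hd.
have wsmall := weight_small hw hbeta.
have [pB BB] := sqrtmxP d0 hA; set B := sqrtmx A in pB BB.
have symB : B^T = B by case: pB.
have uB := posdef_unit pB; have uA := posdef_unit hA.
(* The hypotheses bound [f] in the components of [B x] and its Fourier transform
   at [B eta] in those of [eta]. *)
have yE x j : dotv (A *m x) (invmx B *m stdbasis R j) = (B *m x) j ord0.
  rewrite -BB -mulmxA dotv_mulmx symB mulmxA mulmxV// mul1mx.
  exact: dotv_stdbasis.
have BAB : (B *m invmx A) *m B = 1%:M.
  by apply: mulmx1C; rewrite mulmxA BB mulmxV.
have etaE eta j : dotv (invmx A *m (B *m eta)) (B *m stdbasis R j) = eta j ord0.
  rewrite -[in X in dotv _ (X *m _)]symB -dotv_mulmx !mulmxA BAB mul1mx.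
  exact: dotv_stdbasis.
have mf : cmeas f by case: hf.
have hf1 j : exists2 C : R, 0 < C & {ae lebesgue_cV R d, forall x,
    cmod (f x) <= C * wgauss w lambda ((B *m x) j ord0)}.
  have [C C0 hC] := hfbound j; exists C => //.
  by apply: filterS hC => x /=; rewrite yE.
have K0 : 0 < (2 * pi) `^ (- (d%:R / 2)) :> R by rewrite powR_gt0// mulr_gt0// pi_gt0.
have hF1 j : exists2 C : R, 0 < C & {ae lebesgue_cV R d, forall eta,
    cmod (ftrans B f eta) <= C * wgauss w lambda (eta j ord0)}.
  have [C C0 hC] := hFbound j.
  exists (((2 * pi) `^ (- (d%:R / 2)))^-1 * C); first by rewrite mulr_gt0// invr_gt0.
  apply: filterS (ae_posdef pB hC) => eta h0.
  have h : cmod (fourier f (B *m eta)) <= C * wgauss w lambda (eta j ord0).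
    by rewrite -(etaE eta j); exact: h0.
  rewrite -mulrA ler_pdivlMl//; apply: le_trans h.
  rewrite /fourier cmodM cmod_real ger0_norm ?(ltW K0)// ler_wpM2l ?(ltW K0)//.
  rewrite -[cintegral _]/(cint _ _) le_eqVlt; apply/orP; left; apply/eqP; congr cmod.
  by apply: eq_cint => x; rewrite dotv_mulmx symB.
have cf := cintble_directional wsmall d0 pB hlambda mf hf1.
move=> r r0 hr.
have [Lm [Lp [Lk [LQ [kap H]]]]] := C3_witness hlambda r0 hr.
case: H => [[Lm1 Lp1 LQ0 kap0] hkap hrk [[Cm hLm] hPL] [[Ck hLk] [CQ hQ]]].
have [C1 C10 hC1] := entire_bound hw wsmall d0 pB mf hlambda Lm1 Lp1 hLm hPL hf1 hF1.
pose K := (\det A) `^ (1 / 4) * pi `^ (- (d%:R / 4)).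
have Kge0 : 0 <= K by rewrite mulr_ge0// powR_ge0.
pose C2' := C1 * expR (LQ * kap * Ck + CQ).
have C20 : 0 < C2' by rewrite mulr_gt0// expR_gt0.
exists ((K + 1) * C2'); first by rewrite mulr_gt0// ltr_wpDl.
move=> alpha.
pose coef := cint (lebesgue_cV R d)
  (fun x => f x * ((\prod_(k < d) hfun (alpha k) ((B *m x) k ord0))%:C)%C).
have s20 : 0 < Num.sqrt 2 :> R by rewrite sqrtr_gt0.
pose X := (Num.sqrt 2)^-1 ^+ mabs alpha * cmod coef.
have X0 : 0 <= X by rewrite mulr_ge0 ?cmod_ge0// exprn_ge0// invr_ge0 ltW.
have XE : cmod (hermite_coef A f alpha) = K * Num.sqrt (mfact alpha)%:R * X.
  apply: cmod_hermite_coef; exact: cintble_hfun.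
have growth t : 0 < t -> X * t ^+ mabs alpha <= C2' * expR (r^-1 * w t).
  move=> t0.
  have [rho [rho1 [rho0 rho10 rhoE cost]]] := optimal_radii hw hd r0 kap0 LQ0 hrk hLk hQ t0.
  apply: (axis_mean d0 X0 (ltW t0) rho0 rho10 rhoE) => j.
  (* The factor [1 / sqrt 2] pays for the power of two in the normalisation. *)
  pose rad (k : 'I_d) : R := (if k == j then rho1 else rho) / Num.sqrt 2.
  have rad0 k : 0 <= rad k.
    by rewrite /rad divr_ge0 ?(ltW s20)//; case: ifP.
  have := @torus_bound _ _ B f alpha rad (C2' * expR (r^-1 * w t)) cf rad0.
  have -> : \prod_(k < d) rad k ^+ alpha k = (Num.sqrt 2)^-1 ^+ mabs alpha *
      \prod_(k < d) (if k == j then rho1 else rho) ^+ alpha k.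
    rewrite -prodrXr -big_split/=; apply: eq_bigr => k _.
    by rewrite /rad exprMn mulrC.
  rewrite -/coef mulrA [cmod coef * _]mulrC -/X; apply => z hz.
  apply: le_trans (hC1 j z) _; rewrite /C2' -[X in _ <= X]mulrA ler_pM2l// -!expRD ler_expR.
  rewrite [X in _ <= X]addrC; apply: le_trans cost; apply: lerD.
    rewrite (eq_bigr (fun=> rho ^+ 2 / 2)); last first.
      by move=> k kj; rewrite hz /rad (negbTE kj) expr_div_n sqr_sqrtr.
    by rewrite sumr_const cardC1 card_ord mulr_natl.
  rewrite hz mulrA; apply: ler_pM.
  - by rewrite !mulr_ge0 ?(ltW hlambda)// ?(le_trans ler01 Lm1)// (le_trans ler01 Lp1).
  - exact: (weight_ge0 hw).
  - by apply: le_trans hkap; rewrite le_eqVlt; apply/orP; left; apply/eqP; ring.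
  apply: (weight_le hw) => //; rewrite /rad eqxx ler_pdivrMr// ler_peMr//.
  by rewrite -[leLHS]sqrtr1 ler_sqrt// ler1n.
have Xb : (X%:E <= C2'%:E * expeR (- ((r^-1)%:E * young_conjugate w (r * (mabs alpha)%:R))))%E.
  apply: young_bound => // u u0.
  have := growth (expR u) (expR_gt0 u).
  rewrite -expRM_natl -ler_pdivlMr ?expR_gt0// => /le_trans; apply.
  rewrite -mulrA -expRN -expRD ler_pM2l// ler_expR /phi le_eqVlt; apply/orP; left; apply/eqP.
  by field; rewrite gt_eqF.
set Y := expeR _ in Xb *.
have S0 : 0 <= Num.sqrt (mfact alpha)%:R :> R by exact: sqrtr_ge0.
apply: (@le_trans _ _ (((K + 1) * Num.sqrt (mfact alpha)%:R)%:E * X%:E)%E).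
  rewrite XE -EFinM lee_fin ler_wpM2r// ler_wpM2r// lerDl.
  exact: ler01.
apply: le_trans (lee_wpmul2l _ Xb) _; first by rewrite lee_fin mulr_ge0// addr_ge0.
by rewrite muleA -EFinM le_eqVlt; apply/orP; left; apply/eqP; congr (_%:E * _)%E; ring.
Qed.
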